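(* Let $k$ be a field of characteristic $p \geq 5$. Then the $p$-th power $R^p = R\circ\cdots\circ R$ ($p$ times) of the Ramanujan vector field, as a derivation of $k[e_2,e_4,e_6]$ (i.e. a global vector field on $\mathbf{A}^3_k$), is $$R^p = \frac{\tilde B^2 - e_4 \tilde A^2}{12}\frac{\partial}{\partial e_2} + \frac{\tilde A(e_4\tilde B - e_6\tilde A)}{3}\frac{\partial}{\partial e_4} + \frac{\tilde A(e_6\tilde B - e_4^2\tilde A)}{2}\frac{\partial}{\partial e_6}.$$ Equivalently, writing $P := \frac{\tilde B - e_2\tilde A}{12}$, $$R^p = \tilde A^2\, R - P^2\, F + \tilde A\, P\, H .$$
   Context: For even $\nu\ge 2$, $E_\nu(\tau) = 1 - \frac{2\nu}{B_\nu}\sum_{n\ge1}\sigma_{\nu-1}(n)q^n$ is the normalized Eisenstein series ($B_\nu$ the Bernoulli number, $\sigma_\mu(n)=\sum_{d\mid n}d^\mu$, $q=e^{2\pi i\tau}$). The Ramanujan vector field is the derivation $R = \frac{e_2^2-e_4}{12}\frac{\partial}{\partial e_2} + \frac{e_2e_4-e_6}{3}\frac{\partial}{\partial e_4} + \frac{e_2e_6-e_4^2}{2}\frac{\partial}{\partial e_6}$; also $F = -12\frac{\partial}{\partial e_2}$ and $H = 2e_2\frac{\partial}{\partial e_2}+4e_4\frac{\partial}{\partial e_4}+6e_6\frac{\partial}{\partial e_6}$. For a prime $p\ge5$, $A,B\in\mathbf{Q}[e_4,e_6]$ are the unique polynomials with $A(E_4,E_6)=E_{p-1}$ and $B(E_4,E_6)=E_{p+1}$;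 they have $p$-integral coefficients (in $\mathbf{Z}_{(p)}$), and $\tilde A,\tilde B\in\mathbf{F}_p[e_4,e_6]\subset k[e_4,e_6]$ denote their reductions modulo $p$. *)

(* Defs.v *)
From HB Require Import structures.
From mathcomp Require Import all_boot all_order all_algebra.
From mathcomp Require Import mpoly.
Set Implicit Arguments. Unset Strict Implicit. Unset Printing Implicit Defensive.
Import Order.TTheory GRing.Theory Num.Theory.
Local Open Scope ring_scope.

(* Bernoulli numbers (convention B_1 = -1/2; only even indices are used):
   B_0 = 1,  B_n = -1/(n+1) * sum_{k<n} C(n+1,k) B_k. *)
Fixpoint bern_upto (n : nat) : seq rat :=
  match n with
  | 0 => [:: 1]
  | m.+1 => let s := bern_upto m in
      rcons s (- (m.+2%:R)^-1 * \sum_(k < m.+1) ('C(m.+2, k))%:R * s`_k)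
  end.
Definition bernoulli (n : nat) : rat := (bern_upto n)`_n.

Definition sigma (m n : nat) : nat := \sum_(d <- divisors n) d ^ m.

Definition Ecoef (nu n : nat) : rat :=
  if n == 0%N then 1
  else - ((2 * nu)%:R / bernoulli nu) * (sigma nu.-1 n)%:R.

Definition Etrunc (nu N : nat) : {poly rat} := \poly_(i < N) Ecoef nu i.

Definition evalE46 (A : {mpoly rat[2]}) (N : nat) : {poly rat} :=
  mmap polyC (fun i : 'I_2 => if i == ord0 then Etrunc 4 N else Etrunc 6 N) A.

(* A(E4,E6) = E_nu as formal power series in q (equality modulo every q^N) *)
Definition is_Epoly (A : {mpoly rat[2]}) (nu : nat) : Prop :=
  forall N : nat, evalE46 A N %% 'X^N = Etrunc nu N.

(* reduction of a rational number into a field k (for p-integral rationals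
   in characteristic p this is reduction mod p) *)
Definition redr (k : fieldType) (x : rat) : k := ratr x.
Arguments redr k x : clear implicits.

Definition red46 (k : fieldType) (A : {mpoly rat[2]}) : {mpoly k[3]} :=
  mmap (fun x => (redr k x)%:MP)
       (fun i : 'I_2 => if i == ord0 then 'X_(inord 1) else 'X_(inord 2)) A.

Definition e2 (k : fieldType) : {mpoly k[3]} := 'X_(inord 0).
Definition e4 (k : fieldType) : {mpoly k[3]} := 'X_(inord 1).
Definition e6 (k : fieldType) : {mpoly k[3]} := 'X_(inord 2).
Arguments e2 k : clear implicits.
Arguments e4 k : clear implicits.
Arguments e6 k : clear implicits.

Definition vfield (k : fieldType) (c2 c4 c6 : {mpoly k[3]})
  (f : {mpoly k[3]}) : {mpoly k[3]} :=
  c2 * mderiv (inord 0) f + c4 * mderiv (inord 1) f + c6 * mderiv (inord 2) f.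

Definition invn (k : fieldType) (n : nat) : {mpoly k[3]} := ((n%:R : k)^-1)%:MP.
Arguments invn k n : clear implicits.
Arguments vfield k c2 c4 c6 f : clear implicits.
Arguments red46 k A : clear implicits.

Definition Ramanujan (k : fieldType) : {mpoly k[3]} -> {mpoly k[3]} :=
  vfield k (invn k 12 * (e2 k ^+ 2 - e4 k))
         (invn k 3 * (e2 k * e4 k - e6 k))
         (invn k 2 * (e2 k * e6 k - e4 k ^+ 2)).
Arguments Ramanujan k : clear implicits.

(* Main.v *)
(* On q-expansions R acts as theta = q d/dq, by Ramanujan's differential equations.
   In characteristic p we have theta^p = theta, while von Staudt's congruences give
   E_{p-1} = 1 and E_{p+1} = E_2; hence the two sides of the formula, applied to e_2, e_4
   or e_6, have the same q-expansion.  The right-hand sides are isobaric polynomials in e_4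
   and e_6.  So are the left-hand sides: [d/de_2, R] is proportional to the Euler field, so
   d/de_2 annihilates R^p e_i, which can then involve e_2 only through e_2^p; and the
   coefficient of e_2^p e_i in R^p e_i is divisible by a product of p consecutive integers.
   Finally, an isobaric polynomial in e_4 and e_6 is determined by its q-expansion.

   The p-integrality and homogeneity of A and B come from the recursion expressing the
   Eisenstein series of weight 2n through those of lower weights: it is proved for
   formal series, the constant terms by the equation of the degenerate Weierstrass
   function and the rest by Liouville's elementary method.  To compare the polynomials it
   produces with the given A and B one needs the algebraic independence of E_4 and E_6
   over Q, obtained by letting q tend to 1 along the reals: Delta decays faster than any
   power of 1 - q while E_4 tends to infinity. *)
Require Import Defs.
From HB Require Import structures.
From mathcomp Require Import all_boot all_order all_algebra.
From mathcomp Require Import ring lra zify.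
From mathcomp Require Import boolp.
From mathcomp Require Import mpoly.
From mathcomp Require Rstruct.
From Stdlib Require Reals.
From Coquelicot Require Coquelicot.
Set Implicit Arguments. Unset Strict Implicit. Unset Printing Implicit Defensive.
Import GRing.Theory Num.Theory Order.TTheory.
Local Open Scope ring_scope.

(** * Formal power series *)

(** In characteristic p the passage to q-expansions is not injective on k[e_2, e_4, e_6]. With A and
    B reduced modulo p, its kernel contains A - 1, which is not isobaric, and B - e_2 A, which is
    isobaric but involves e_2. Hence both properties, isobaric and free of e_2, have to be secured
    before any comparison of expansions; that the difference B - e_2 A reappears as 12 P in the
    theorem reflects the same fact. The prime p enters the recursion for Eisenstein series at one
    place. To reach weight N the recursion divides by a p-integral multiple of (N - 6)(N + 1), so
    that p-integrality is first lost at N = p - 1, where the multiplier p restores it. Weight p + 1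
    uses only weights up to p - 3 and is not affected. *)

Record fps (R : Type) := Fps { fcoef : nat -> R }.

HB.instance Definition _ (R : Type) := gen_eqMixin (fps R).
HB.instance Definition _ (R : Type) := gen_choiceMixin (fps R).

Coercion fcoef : fps >-> Funclass.

Lemma fpsP (R : Type) (f g : fps R) : (forall n, f n = g n) <-> f = g.
Proof.
split=> [|-> //]; case: f g => [f] [g] /= eq_fg.
by congr Fps; apply: functional_extensionality_dep.
Qed.

Section FpsZmod.
Variable R : zmodType.
Implicit Types f g h : fps R.

Definition fps_zero : fps R := Fps (fun=> 0).
Definition fps_add f g := Fps (fun n => f n + g n).
Definition fps_opp f := Fps (fun n => - f n).

Fact fps_addA : associative fps_add.
Proof. by move=> f g h; apply/fpsP => n /=; rewrite addrA. Qed.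
Fact fps_addC : commutative fps_add.
Proof. by move=> f g; apply/fpsP => n /=; rewrite addrC. Qed.
Fact fps_add0 : left_id fps_zero fps_add.
Proof. by move=> f; apply/fpsP => n /=; rewrite add0r. Qed.
Fact fps_addN : left_inverse fps_zero fps_opp fps_add.
Proof. by move=> f; apply/fpsP => n /=; rewrite addNr. Qed.

HB.instance Definition _ :=
  GRing.isZmodule.Build (fps R) fps_addA fps_addC fps_add0 fps_addN.

Definition fcoefn n f := f n.
Fact fcoefn_is_additive n : additive (fcoefn n).
Proof. by []. Qed.
HB.instance Definition _ n :=
  GRing.isAdditive.Build (fps R) R (fcoefn n) (fcoefn_is_additive n).

Lemma fcoef0 n : (0 : fps R) n = 0. Proof. by []. Qed.
Lemma fcoefD f g n : (f + g) n = f n + g n. Proof. by []. Qed.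
Lemma fcoefN f n : (- f) n = - f n. Proof. by []. Qed.
Lemma fcoefB f g n : (f - g) n = f n - g n. Proof. by []. Qed.
Lemma fcoef_sum (I : Type) (r : seq I) (P : pred I) (F : I -> fps R) n :
  (\sum_(i <- r | P i) F i) n = \sum_(i <- r | P i) (F i) n.
Proof. exact: (raddf_sum (fcoefn n)). Qed.
End FpsZmod.

Section FpsRing.
Variable R : comNzRingType.
Implicit Types f g h : fps R.

Definition fpsC (c : R) : fps R := Fps (fun n => if n == 0%N then c else 0).
Definition fps_mul f g := Fps (fun n => \sum_(i < n.+1) f i * g (n - i)%N).

Fact fps_mulC : commutative fps_mul.
Proof.
move=> f g; apply/fpsP => n /=; rewrite (reindex_inj rev_ord_inj) /=.
by apply: eq_bigr => i _; rewrite mulrC subSS subKn // -ltnS.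
Qed.

Fact fps_mulA : associative fps_mul.
Proof.
move=> f g h; apply/fpsP => n /=.
pose T i j := f i * (g (j - i)%N * h (n - j)%N).
transitivity (\sum_(i < n.+1) \sum_(j < n.+1 | (i <= j)%N) T i j).
  apply: eq_bigr => i _; rewrite big_distrr /=.
  rewrite -(big_mkord (fun j => i <= j)%N (T i)).
  rewrite (@big_cat_nat _ _ _ i) //=; last by rewrite ltnW.
  rewrite [X in _ = X + _]big1_seq; last first.
    by move=> j /andP[le_ij]; rewrite mem_index_iota; move: le_ij; lia.
  have := big_addn 0 n.+1 i (fun j => i <= j)%N (T i); rewrite add0n add0r => ->.
  rewrite big_mkord subSn; last by rewrite -ltnS.
  apply: eq_big => [j | j _]; first by lia.
  by rewrite /T addnK -subnDA addnC.
rewrite (exchange_big_dep xpredT) //=; apply: eq_bigr => j _.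
rewrite big_distrl /= (big_ord_widen_cond n.+1 xpredT
  (fun i => f i * g (j - i)%N * h (n - j)%N)) //.
by apply: eq_big => [i | i _]; rewrite ?ltnS // /T mulrA.
Qed.

Fact fps_mul1 : left_id (fpsC 1) fps_mul.
Proof.
move=> f; apply/fpsP => n /=; rewrite big_ord_recl /= mul1r subn0.
by rewrite big1 ?addr0 // => i _; rewrite mul0r.
Qed.

Fact fps_mulDl : left_distributive fps_mul +%R.
Proof.
move=> f g h; apply/fpsP => n /=; rewrite -big_split.
by apply: eq_bigr => i _; rewrite mulrDl.
Qed.

Fact fps_1_neq0 : fpsC 1 != 0.
Proof. by apply/eqP => /fpsP/(_ 0)/eqP; rewrite /= oner_eq0. Qed.

HB.instance Definition _ := GRing.Zmodule_isComNzRing.Build (fps R)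
  fps_mulA fps_mulC fps_mul1 fps_mulDl fps_1_neq0.

Lemma fcoefM f g n : (f * g) n = \sum_(i < n.+1) f i * g (n - i)%N.
Proof. by []. Qed.

Lemma fcoefM0 f g : (f * g) 0 = f 0 * g 0.
Proof. by rewrite fcoefM big_ord1. Qed.

Lemma fcoef1 n : (1 : fps R) n = (n == 0%N)%:R.
Proof. by rewrite /=; case: eqP. Qed.

Lemma fcoefX0 f k : (f ^+ k) 0 = f 0 ^+ k.
Proof. by elim: k => [|k IHk]; rewrite ?fcoef1 // !exprS fcoefM0 IHk. Qed.

Fact fpsC_is_additive : additive fpsC.
Proof. by move=> x y; apply/fpsP => n /=; case: eqP; rewrite ?subr0. Qed.
HB.instance Definition _ := GRing.isAdditive.Build R (fps R) fpsC fpsC_is_additive.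

Lemma fcoefCM c f n : (fpsC c * f) n = c * f n.
Proof.
rewrite fcoefM big_ord_recl /= subn0 big1 ?addr0 // => i _.
by rewrite mul0r.
Qed.

Fact fpsC_is_multiplicative : multiplicative fpsC.
Proof.
split=> // x y; apply/fpsP => n; rewrite fcoefCM /=.
by case: eqP; rewrite ?mulr0.
Qed.
HB.instance Definition _ :=
  GRing.isMultiplicative.Build R (fps R) fpsC fpsC_is_multiplicative.

Definition fpsX : fps R := Fps (fun n => (n == 1%N)%:R).

Lemma fcoefXM f n : (fpsX * f) n = if n is m.+1 then f m else 0.
Proof.
case: n => [|n]; first by rewrite fcoefM0 mul0r.
rewrite fcoefM big_ord_recl mul0r add0r big_ord_recl /= mul1r subSS subn0.
by rewrite big1 ?addr0 // => i _; rewrite mul0r.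
Qed.

Definition theta f : fps R := Fps (fun n => n%:R * f n).

Fact theta_is_additive : additive theta.
Proof. by move=> f g; apply/fpsP => n /=; rewrite mulrBr. Qed.
HB.instance Definition _ :=
  GRing.isAdditive.Build (fps R) (fps R) theta theta_is_additive.

Lemma thetaM f g : theta (f * g) = theta f * g + f * theta g.
Proof.
apply/fpsP => n; rewrite fcoefD !fcoefM /= -big_split big_distrr /=.
apply: eq_bigr => i _.
by rewrite -{1}(@subnKC i n) -1?ltnS // natrD; ring.
Qed.

Lemma thetaC c : theta (fpsC c) = 0.
Proof. by apply/fpsP => -[|n] /=; rewrite ?mul0r ?mulr0. Qed.

Lemma theta_iter n f k : (iter n theta f) k = k%:R ^+ n * f k.
Proof. by elim: n => [|n IHn] /=; rewrite ?mul1r // IHn exprS mulrA. Qed.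

Lemma thetaCM c f : theta (fpsC c * f) = fpsC c * theta f.
Proof. by rewrite thetaM thetaC mul0r add0r. Qed.

End FpsRing.

Section FpsMap.
Variables (R S : comNzRingType) (phi : {rmorphism R -> S}).
Definition map_fps (f : fps R) : fps S := Fps (fun n => phi (f n)).
Fact map_fps_is_additive : additive map_fps.
Proof. by move=> f g; apply/fpsP => n /=; rewrite rmorphB. Qed.
HB.instance Definition _ :=
  GRing.isAdditive.Build (fps R) (fps S) map_fps map_fps_is_additive.
Fact map_fps_is_multiplicative : multiplicative map_fps.
Proof.
split=> [f g|]; apply/fpsP => n.
  by rewrite fcoefM /= rmorph_sum; apply: eq_bigr => i _; rewrite rmorphM.
by rewrite /=; case: eqP; rewrite ?rmorph1 ?rmorph0.
Qed.
HB.instance Definition _ :=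
  GRing.isMultiplicative.Build (fps R) (fps S) map_fps map_fps_is_multiplicative.

Lemma map_fps_theta f : map_fps (theta f) = theta (map_fps f).
Proof. by apply/fpsP => n /=; rewrite rmorphM rmorph_nat. Qed.

End FpsMap.

Lemma fps_ord (R : comNzRingType) (f : fps R) : f != 0 ->
  exists2 n, f n != 0 & forall i, (i < n)%N -> f i = 0.
Proof.
move=> nz_f; have ex_n : exists n, f n != 0.
  apply/not_existsP => f0; case/eqP: nz_f; apply/fpsP => n.
  by apply/eqP/negPn/negP; exact: f0.
have [n nz_n min_n] := ex_minnP ex_n; exists n => // i lt_in.
by apply/eqP/negPn/negP => /min_n; rewrite leqNgt lt_in.
Qed.

(** In degree [m + n], the sum of the orders of two nonzero series, only the product of the lowest
    coefficients survives. *)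
Lemma fps_mulf_eq0 (R : idomainType) (f g : fps R) :
  f * g = 0 -> f != 0 -> g = 0.
Proof.
move=> fg0 /fps_ord[m nz_m min_m]; apply/eqP/negPn/negP => /fps_ord[n nz_n min_n].
have /fpsP/(_ (m + n)%N) := fg0; rewrite fcoefM fcoef0.
have lt_m : (m < (m + n).+1)%N by rewrite ltnS leq_addr.
rewrite (bigD1 (Ordinal lt_m)) //= addKn big1 ?addr0 => [/eqP|i].
  by rewrite mulf_eq0 (negPf nz_m) (negPf nz_n).
rewrite -val_eqE /= => ne_im; have [lt_im|le_mi] := ltnP i m.
  by rewrite min_m ?mul0r.
by rewrite min_n ?mulr0 //; move: (ltn_ord i) ne_im le_mi => /=; lia.
Qed.

Lemma fpsE (R : Type) (h : nat -> R) n : Fps h n = h n. Proof. by []. Qed.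

Lemma fcoefC (R : comNzRingType) (c : R) n :
  fpsC c n = if n == 0%N then c else 0.
Proof. by []. Qed.

Lemma fcoef_X (R : comNzRingType) n : fpsX R n = (n == 1%N)%:R.
Proof. by []. Qed.

Lemma fcoef_theta (R : comNzRingType) (f : fps R) n : theta f n = n%:R * f n.
Proof. by []. Qed.

Lemma fcoef_map (R S : comNzRingType) (phi : {rmorphism R -> S}) (f : fps R) n :
  map_fps phi f n = phi (f n).
Proof. by []. Qed.

Arguments fcoef : simpl never.

(** * Liouville's elementary method *)

Section Liouville.
Variable n : nat.

Local Notation quad := ('I_n.+1 * 'I_n.+1 * ('I_n.+1 * 'I_n.+1))%type.
Implicit Types q : quad.

Definition qa q : nat := q.1.1.
Definition qb q : nat := q.1.2.
Definition qx q : nat := q.2.1.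
Definition qy q : nat := q.2.2.

(** Positivity bounds every entry of a solution by [n], so the finite box [0, n]^4 loses none. *)
Definition sol q : bool :=
  [&& 0 < qa q, 0 < qb q, 0 < qx q, 0 < qy q & qa q * qx q + qb q * qy q == n]%N.

(** On solutions a + b and x + y are at most [n], so the default 0 of [inord] never occurs there;
    the truncated subtractions are exact when x < y, respectively b < a. *)
Let up q : quad := (inord (qa q + qb q), q.1.2, (q.2.1, inord (qy q - qx q))).
Let down q : quad := (inord (qa q - qb q), q.1.2, (q.2.1, inord (qy q + qx q))).

Let quad_eq q q' : qa q = qa q' -> qb q = qb q' -> qx q = qx q' -> qy q = qy q' ->
  q = q'.
Proof.
case: q q' => [[a b] [x y]] [[a' b'] [x' y']]; rewrite /qa /qb /qx /qy /=.
by do 4!move=> /val_inj->.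
Qed.

Let upaE q : (qa q + qb q <= n)%N -> qa (up q) = (qa q + qb q)%N.
Proof. by move=> le_n; rewrite {1}/qa inordK. Qed.
Let upyE q : qy (up q) = (qy q - qx q)%N.
Proof. by rewrite {1}/qy inordK // (leq_ltn_trans (leq_subr _ _)) ?ltn_ord. Qed.
Let dnaE q : qa (down q) = (qa q - qb q)%N.
Proof. by rewrite {1}/qa inordK // (leq_ltn_trans (leq_subr _ _)) ?ltn_ord. Qed.
Let dnyE q : (qy q + qx q <= n)%N -> qy (down q) = (qy q + qx q)%N.
Proof. by move=> le_n; rewrite {1}/qy inordK. Qed.

Let upP q : sol q && (qx q < qy q)%N ->
  [/\ sol (up q), (qb (up q) < qa (up q))%N & down (up q) = q].
Proof.
rewrite /sol => /andP[/and5P[a0 b0 x0 y0 /eqP def_n] lt_xy].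
have le_ab : (qa q + qb q <= n)%N by nia.
have [upb upx] : qb (up q) = qb q /\ qx (up q) = qx q by [].
have ltqy : (qy q <= n)%N by rewrite -ltnS; exact: ltn_ord.
split.
- rewrite upaE // upyE upb upx b0 x0 subn_gt0 lt_xy addn_gt0 a0 /=.
  by rewrite mulnDl mulnBr -addnA subnKC ?def_n // leq_mul2l (ltnW lt_xy) orbT.
- by rewrite upaE // upb -{1}[qb q]add0n ltn_add2r.
apply: quad_eq => //; first by rewrite dnaE upaE // upb addnK.
by rewrite dnyE upyE upx subnK // ltnW.
Qed.

Let downP q : sol q && (qb q < qa q)%N ->
  [/\ sol (down q), (qx (down q) < qy (down q))%N & up (down q) = q].
Proof.
rewrite /sol => /andP[/and5P[a0 b0 x0 y0 /eqP def_n] lt_ba].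
have le_xy : (qy q + qx q <= n)%N by nia.
have [dnb dnx] : qb (down q) = qb q /\ qx (down q) = qx q by [].
have leqa : (qa q <= n)%N by rewrite -ltnS; exact: ltn_ord.
split.
- rewrite dnaE dnyE // dnb dnx b0 x0 subn_gt0 lt_ba addn_gt0 y0 /=.
  rewrite mulnDr mulnBl addnCA subnK ?leq_mul2r ?(ltnW lt_ba) ?orbT //.
  by rewrite addnC def_n.
- by rewrite dnyE // dnx -{1}[qx q]add0n ltn_add2r.
apply: quad_eq => //; last by rewrite upyE dnyE // dnx addnK.
by rewrite upaE dnaE dnb subnK // ltnW.
Qed.

Variable V : zmodType.
Implicit Types f g : nat -> nat -> V.

Lemma sol_shift f :
  \sum_(q : quad | sol q && (qx q < qy q)%N) f (qa q) (qb q) =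
  \sum_(q : quad | sol q && (qb q < qa q)%N) f (qa q - qb q)%N (qb q).
Proof.
rewrite [RHS](reindex_onto up down) => [|q /downP[]//].
apply: eq_big => [q | q /upP[sol_q lt_q dK]].
  apply/idP/idP => [/[dup]Hq /upP[-> -> ->] | /andP[/downP[]]]; first by rewrite eqxx.
  by move=> ? ? _ /eqP <-; apply/andP.
by have := dnaE (up q); rewrite dK => <-.
Qed.

Let swap q : quad := (q.1.2, q.1.1, (q.2.2, q.2.1)).

Lemma sol_swap q : sol (swap q) = sol q.
Proof.
by rewrite /sol /qa /qb /qx /qy /= addnC; do 4![case: ltnP => //= _].
Qed.

Lemma sum_swap (P : rel nat) (Q : rel nat) f :
  \sum_(q : quad | sol q && (P (qx q) (qy q) && Q (qa q) (qb q))) f (qa q) (qb q) =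
  \sum_(q : quad | sol q && (P (qy q) (qx q) && Q (qb q) (qa q))) f (qb q) (qa q).
Proof.
have swapK : involutive swap by case=> [[? ?] [? ?]].
rewrite (reindex_inj (inv_inj swapK)).
by apply: eq_bigl => q; rewrite sol_swap.
Qed.

(* Liouville's elementary method: with x < y, (a,b,x,y) |-> (a+b,b,x,y-x) is a
   bijection from the solutions of ax + by = n with x < y to those with b < a. *)
Lemma liouville f g : (forall a b, f a b = f b a) -> (forall a b, g a b = g b a) ->
    (forall a b, g (a + b)%N b = f a b) ->
  \sum_(q : quad | sol q) f (qa q) (qb q) - \sum_(q : quad | sol q) g (qa q) (qb q) =
  \sum_(q : quad | sol q && (qx q == qy q)) f (qa q) (qb q)
    - \sum_(q : quad | sol q && (qa q == qb q)) g (qa q) (qb q).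
Proof.
move=> fC gC gf.
have split3 (h : nat -> nat -> V) (u v : quad -> nat) :
  \sum_(q : quad | sol q) h (qa q) (qb q) =
  \sum_(q : quad | sol q && (u q == v q)) h (qa q) (qb q) +
  (\sum_(q : quad | sol q && (u q < v q)%N) h (qa q) (qb q) +
   \sum_(q : quad | sol q && (v q < u q)%N) h (qa q) (qb q)).
  rewrite (bigID (fun q => u q == v q)) /=; congr (_ + _).
  rewrite (bigID (fun q => u q < v q)%N) /=.
  by congr (_ + _); apply: eq_bigl => q; case: (sol q); case: ltngtP.
rewrite (split3 f qx qy) (split3 g qa qb).
(* By symmetry of [f] the solutions with x > y contribute as much as those with x < y, and likewise
   for [g] with a and b; the bijection then cancels everything off the diagonals. *)
have -> : \sum_(q : quad | sol q && (qy q < qx q)%N) f (qa q) (qb q) =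
    \sum_(q : quad | sol q && (qx q < qy q)%N) f (qa q) (qb q).
  have := sum_swap (fun x y => y < x)%N (fun _ _ => true) f.
  under eq_bigl => q do rewrite andbT.
  under [in RHS]eq_bigl => q do rewrite andbT.
  by under [in RHS]eq_bigr => q _ do rewrite fC.
have -> : \sum_(q : quad | sol q && (qa q < qb q)%N) g (qa q) (qb q) =
    \sum_(q : quad | sol q && (qb q < qa q)%N) g (qa q) (qb q).
  have := sum_swap (fun _ _ => true) (fun a b => a < b)%N g.
  by under [in RHS]eq_bigr => q _ do rewrite gC.
have -> : \sum_(q : quad | sol q && (qx q < qy q)%N) f (qa q) (qb q) =
    \sum_(q : quad | sol q && (qb q < qa q)%N) g (qa q) (qb q).
  rewrite sol_shift; apply: eq_bigr => q /andP[_ lt_ba].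
  by rewrite -gf subnK // ltnW.
by rewrite opprD addrACA subrr addr0.
Qed.

End Liouville.

(** * Divisor sums *)

Section DivisorSums.
Variable R : comNzRingType.
Implicit Types F G : nat -> R.

(* [divisors 0 = [:: 1]] is a junk value *)
Definition dsum F (n : nat) : R :=
  if n == 0%N then 0 else \sum_(d <- divisors n) F d.
Definition dser F : fps R := Fps (dsum F).
Lemma dserE F n : dser F n = dsum F n. Proof. by []. Qed.

Lemma dsum_ord F n l : (0 < l)%N -> (l <= n)%N ->
  dsum F l = \sum_(a < n.+1 | (a %| l)%N) F a.
Proof.
move=> l0 le_ln; rewrite /dsum gtn_eqF // -(big_mkord (fun a => a %| l)%N F) /index_iota subn0.
rewrite -big_filter; apply: perm_big; apply: uniq_perm.
- exact: divisors_uniq.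
- by rewrite filter_uniq ?iota_uniq.
move=> d; rewrite mem_filter mem_iota -dvdn_divisors //= add0n ltnS.
by case d_l: (d %| l)%N => //=; rewrite (leq_trans (dvdn_leq l0 d_l)).
Qed.

Lemma sum_eq_ord n (k : nat) (z : R) :
  (k <= n)%N -> \sum_(x < n.+1) (if x == k :> nat then z else 0) = z.
Proof.
move=> le_kn; rewrite -big_mkcond /= (big_pred1 (Ordinal (le_kn : (k < n.+1)%N))) //.
Qed.

(** For fixed [a] the only possible [x] is the codivisor l / a. *)
Lemma sum_codivisor n l (a : nat) (z : R) : (0 < l)%N -> (l <= n)%N ->
  \sum_(x < n.+1) (if [&& 0 < a, 0 < x & a * x == l]%N then z else 0) =
  if (a %| l)%N then z else 0.
Proof.
move=> l0 le_ln; case: ifP => [/dvdnP[k def_l] | /negP a_l]; last first.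
  rewrite big1 // => x _; case: ifP => // /and3P[_ _ /eqP def_l].
  by case: a_l; apply/dvdnP; exists x; rewrite mulnC.
have [a0 k0] : (0 < a)%N /\ (0 < k)%N by move: l0; rewrite def_l muln_gt0 => /andP[].
rewrite -[RHS](@sum_eq_ord n k); last by apply: leq_trans le_ln; rewrite def_l leq_pmulr.
apply: eq_bigr => x _; congr (if _ then _ else _).
rewrite a0 /= def_l [X in _ == X]mulnC eqn_pmul2l //.
by apply/andP/eqP => [[_ /eqP] | ->]; rewrite ?eqxx.
Qed.

Lemma dsum_pairs F n l : (l <= n)%N ->
  dsum F l = \sum_(a < n.+1) \sum_(x < n.+1)
    (if [&& 0 < a, 0 < x & a * x == l]%N then F a else 0).
Proof.
have [-> _ | l0 le_ln] := posnP l.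
  rewrite [RHS]big1 // => a _; rewrite big1 // => x _.
  by case: (nat_of_ord a) (nat_of_ord x) => [|i] [|j].
rewrite (dsum_ord _ l0 le_ln) big_mkcond; apply: eq_bigr => a _.
by rewrite sum_codivisor.
Qed.

Lemma sum_quad n (P : pred ('I_n.+1 * 'I_n.+1 * ('I_n.+1 * 'I_n.+1)))
    (F : 'I_n.+1 * 'I_n.+1 * ('I_n.+1 * 'I_n.+1) -> R) :
  \sum_(q | P q) F q = \sum_(a < n.+1) \sum_(b < n.+1) \sum_(x < n.+1) \sum_(y < n.+1)
     (if P (a, b, (x, y)) then F (a, b, (x, y)) else 0).
Proof.
transitivity (\sum_(ab : 'I_n.+1 * 'I_n.+1) \sum_(xy : 'I_n.+1 * 'I_n.+1)
    (if P (ab, xy) then F (ab, xy) else 0)).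
  rewrite big_mkcond [RHS](pair_bigA _ (fun ab xy => if P (ab, xy) then F (ab, xy) else 0)).
  by apply: eq_bigr => -[].
rewrite [RHS](pair_bigA _ (fun a b => \sum_(x < n.+1) \sum_(y < n.+1)
  (if P (a, b, (x, y)) then F (a, b, (x, y)) else 0))) /=.
apply: eq_bigr => -[a b] _.
rewrite [RHS](pair_bigA _ (fun x y => if P (a, b, (x, y)) then F (a, b, (x, y)) else 0)).
by apply: eq_bigr => -[].
Qed.

(** Sorting the solutions by l = ax turns them into pairs of a divisor of l and a divisor of n - l,
    which is the Cauchy product. *)
Lemma sum_sol_mul n F G :
  \sum_(q | sol (n := n) q) F (qa q) * G (qb q) = (dser F * dser G) n.
Proof.
rewrite sum_quad fcoefM.
transitivity (\sum_(l < n.+1) \sum_(a < n.+1) \sum_(x < n.+1)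
  \sum_(b < n.+1) \sum_(y < n.+1)
  (if [&& 0 < a, 0 < x & a * x == l]%N then F a else 0) *
  (if [&& 0 < b, 0 < y & b * y == n - l]%N then G b else 0)); last first.
  apply: eq_bigr => l _; rewrite !dserE (@dsum_pairs F n l); last by rewrite -ltnS.
  rewrite (@dsum_pairs G n (n - l)) ?leq_subr // big_distrl; apply: eq_bigr => a _.
  rewrite big_distrl; apply: eq_bigr => x _.
  by rewrite big_distrr; apply: eq_bigr => b _; rewrite big_distrr.
rewrite [RHS]exchange_big; apply: eq_bigr => a _ /=.
rewrite [RHS]exchange_big /=.
under [RHS]eq_bigr => x _ do rewrite exchange_big.
rewrite [RHS]exchange_big; apply: eq_bigr => b _ /=.
apply: eq_bigr => x _; rewrite [RHS]exchange_big; apply: eq_bigr => y _ /=.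
rewrite /sol /qa /qb /qx /qy /=.
have [le_n | lt_n] := leqP (a * x + b * y) n; last first.
  rewrite [_ == n]gtn_eqF // !andbF big1 // => l _.
  case: ifP => [/and3P[a0 x0 /eqP ax]|_]; last by rewrite mul0r.
  case: ifP => [/and3P[b0 y0 /eqP bY]|_]; last by rewrite mulr0.
  by move: (ltn_ord l) lt_n; rewrite ax bY; lia.
rewrite -[LHS](@sum_eq_ord n (a * x)%N); last by apply: leq_trans le_n; rewrite leq_addr.
apply: eq_bigr => l _; rewrite [in RHS]eq_sym.
case: eqP => [-> | _]; last by rewrite !andbF mul0r.
rewrite andbT.
have -> : (b * y == n - a * x)%N = (a * x + b * y == n)%N by apply/eqP/eqP; lia.
by case: (0 < a)%N; case: (0 < b)%N; case: (0 < x)%N; case: (0 < y)%N;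
   rewrite /= ?mul0r ?mulr0 //; case: ifP; rewrite ?mulr0.
Qed.

(** When x = y the equation reads (a + b) x = n, so d = a + b runs over the divisors of n. *)
Lemma sum_sol_xy n (f : nat -> nat -> R) : (0 < n)%N ->
  \sum_(q | sol (n := n) q && (qx q == qy q)) f (qa q) (qb q) =
  dsum (fun d => \sum_(1 <= a < d) f a (d - a)%N) n.
Proof.
move=> n0; rewrite sum_quad (dsum_ord _ n0 (leqnn n)) [RHS]big_mkcond /=.
transitivity (\sum_(d < n.+1) \sum_(a < n.+1) \sum_(b < n.+1)
   (if [&& (d %| n), 0 < a, 0 < b & (d == a + b :> nat)]%N then f a b else 0)).
  rewrite [RHS]exchange_big; apply: eq_bigr => a _ /=.
  rewrite [RHS]exchange_big; apply: eq_bigr => b _ /=.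
  transitivity (if [&& 0 < a, 0 < b & a + b %| n]%N then f a b else 0).
    rewrite /sol /qa /qb /qx /qy /=.
    transitivity (\sum_(x < n.+1) if [&& 0 < a + b, 0 < x & (a + b) * x == n]%N
        then (if (0 < a)%N && (0 < b)%N then f a b else 0) else 0).
      apply: eq_bigr => x _; rewrite -[RHS](@sum_eq_ord n x); last by rewrite -ltnS.
      apply: eq_bigr => y _.
      case: (eqVneq (nat_of_ord x) (nat_of_ord y)) => [<-|_]; last by rewrite andbF.
      rewrite andbT mulnDl addn_gt0.
      by case: (0 < a)%N; case: (0 < b)%N; case: (0 < x)%N => //=; case: ifP.
    rewrite sum_codivisor //.
    by case: (0 < a)%N; case: (0 < b)%N => //=; case: ifP.
  have [ab_n | ab_n] := boolP ((a + b)%N <= n)%N; last first.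
    rewrite [LHS]ifN; last by apply: contra ab_n => /and3P[_ _ /dvdn_leq->].
    by rewrite big1 // => d _; rewrite ifN //; apply: contra ab_n => /and4P[_ _ _ /eqP<-];
       rewrite -ltnS.
  rewrite -[LHS](@sum_eq_ord n (a + b)%N) //; apply: eq_bigr => d _.
  case: eqP => [-> | _]; last by rewrite !andbF.
  by congr (if _ then _ else _); case: (_ %| _)%N; rewrite ?andbT ?andbF.
apply: eq_bigr => d _; case: ifP => d_n; last by rewrite big1 // => a _; rewrite big1.
rewrite (@big_nat_widen _ _ _ 1 d n.+1) 1?ltnW // big_geq_mkord [RHS]big_mkcond /=.
apply: eq_bigr => a _; case: ifP => [/andP[lt_ad a0] | cond_a].
  rewrite -[RHS](@sum_eq_ord n (d - a)%N); last first.
    by rewrite (leq_trans (leq_subr _ _)) // -ltnS.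
  apply: eq_bigr => b _; rewrite a0 /=.
  have -> : (b == d - a :> nat)%N = (0 < b)%N && (d == a + b :> nat)%N.
    apply/eqP/andP=> [-> | [_ /eqP->]]; last by rewrite addKn.
    by rewrite subn_gt0 lt_ad subnKC ?eqxx // ltnW.
  by case: ifP => // /andP[b0 /eqP->]; rewrite addKn.
rewrite big1 // => b _; rewrite ifN //; apply/negP=> /and3P[a0 b0 /eqP def_d].
by case/negP: cond_a; rewrite a0 def_d -[X in (X < _)%N]addn0 ltn_add2l b0.
Qed.

(** When a = b = d there remains x + y = n / d, which has n / d - 1 positive solutions. *)
Lemma sum_sol_ab n (g : nat -> nat -> R) : (0 < n)%N ->
  \sum_(q | sol (n := n) q && (qa q == qb q)) g (qa q) (qb q) =
  dsum (fun d => g d d *+ (n %/ d).-1) n.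
Proof.
move=> n0; rewrite sum_quad (dsum_ord _ n0 (leqnn n)) [RHS]big_mkcond /=.
apply: eq_bigr => a _.
transitivity (\sum_(x < n.+1) \sum_(y < n.+1)
   (if [&& 0 < a, 0 < x, 0 < y & a * (x + y) == n]%N then g a a else 0)).
  rewrite exchange_big; apply: eq_bigr => x _ /=.
  rewrite exchange_big; apply: eq_bigr => y _ /=.
  rewrite /sol /qa /qb /qx /qy /= -[RHS](@sum_eq_ord n a); last by rewrite -ltnS.
  apply: eq_bigr => b _.
  case: (eqVneq (nat_of_ord a) (nat_of_ord b)) => [<-|_]; last by rewrite andbF.
  by rewrite andbT mulnDr; case: (0 < a)%N.
case: ifP => [/dvdnP[k def_n] | /negP a_n]; last first.
  rewrite big1 // => x _; rewrite big1 // => y _; case: ifP => // /and4P[_ _ _ /eqP def_n].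
  by case: a_n; apply/dvdnP; exists (x + y)%N; rewrite mulnC.
have [k0 a0] : (0 < k)%N /\ (0 < a)%N.
  have: (0 < k * a)%N by rewrite -def_n.
  by rewrite muln_gt0 => /andP[].
have eqE z : (a * z == n)%N = (z == k) by rewrite [X in _ == X]def_n mulnC eqn_pmul2r.
have divE : (n %/ a)%N = k by have := mulnK k a0; rewrite -def_n.
have le_kn : (k <= n)%N by rewrite -divE leq_div.
transitivity (\sum_(x < n.+1) (if (0 < x < k)%N then g a a else 0)).
  apply: eq_bigr => x _; rewrite a0 /=.
  have [x0 | x0] := posnP x; first by rewrite big1.
  have [lt_xk | le_kx] := ltnP x k; last first.
    rewrite big1 // => y _; rewrite ifN //= eqE.
    by apply/negP=> /andP[y0 /eqP]; lia.
  rewrite -[RHS](@sum_eq_ord n (k - x)%N); last by lia.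
  apply: eq_bigr => y _; congr (if _ then _ else _); rewrite eqE /=.
  by apply/andP/eqP; lia.
rewrite -big_mkcond sumr_const divE; congr (_ *+ _).
rewrite -sum1_card big_mkcond /=.
rewrite -(big_mkord xpredT (fun x => if (0 < x < k)%N then 1%N else 0%N)) -big_mkcond.
rewrite /= sum1_count /index_iota subn0.
have -> : count (fun i => 0 < i < k)%N (iota 0 n.+1) = size (iota 1 k.-1).
  rewrite -size_filter; apply: perm_size; apply: uniq_perm.
  - by rewrite filter_uniq ?iota_uniq.
  - exact: iota_uniq.
  by move=> i; rewrite mem_filter !mem_iota; lia.
by rewrite size_iota.
Qed.

End DivisorSums.

(** * Bernoulli numbers *)

Section BernoulliSeries.
Lemma size_bern_upto n : size (bern_upto n) = n.+1.
Proof. by elim: n => //= n IHn; rewrite size_rcons IHn. Qed.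

Lemma nth_bern_upto n k : (k <= n)%N -> (bern_upto n)`_k = bernoulli k.
Proof.
elim: n => [|n IHn]; first by rewrite leqn0 => /eqP->.
rewrite leq_eqVlt => /predU1P[-> // | lt_kn].
by rewrite /= nth_rcons size_bern_upto lt_kn IHn.
Qed.

Lemma bernoulli0 : bernoulli 0 = 1. Proof. by []. Qed.

Lemma bernoulliS m : bernoulli m.+1 =
  - (m.+2%:R)^-1 * \sum_(k < m.+1) ('C(m.+2, k))%:R * bernoulli k.
Proof.
rewrite /bernoulli /= nth_rcons size_bern_upto ltnn eqxx; congr (_ * _).
by apply: eq_bigr => k _; rewrite nth_bern_upto // -ltnS.
Qed.

Lemma natr_neq0 (n : nat) : (n.+1%:R : rat) != 0.
Proof. by rewrite pnatr_eq0. Qed.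

Lemma factr_neq0 n : ((n`!)%:R : rat) != 0.
Proof. by rewrite pnatr_eq0 -lt0n fact_gt0. Qed.

Lemma sum_bernoulli n :
  \sum_(k < n.+1) ('C(n.+1, k))%:R * bernoulli k = (n == 0%N)%:R.
Proof.
case: n => [|m]; first by rewrite big_ord1 bin0 mul1r.
rewrite big_ord_recr /= bernoulliS mulrA mulrN binSn divff ?natr_neq0 //.
by rewrite mulN1r subrr.
Qed.

Lemma bin_ffactr n k : (k <= n)%N ->
  ('C(n, k))%:R / (n`!)%:R = ((k`!)%:R)^-1 * (((n - k)`!)%:R)^-1 :> rat.
Proof.
move=> le_kn; have := bin_fact le_kn => /(congr1 (fun z => z%:R : rat)).
rewrite !natrM => <-; field.
by rewrite !factr_neq0 pnatr_eq0 -lt0n bin_gt0 le_kn.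
Qed.

(** The exponential generating functions X / (e^X - 1) and e^(cX). Here the series variable is X,
    unrelated to q, and [theta] is X d/dX. *)
Definition bern_ser : fps rat := Fps (fun n => bernoulli n / (n`!)%:R).
Definition exp_ser (c : rat) : fps rat := Fps (fun n => c ^+ n / (n`!)%:R).
Lemma bern_serE n : bern_ser n = bernoulli n / (n`!)%:R. Proof. by []. Qed.
Lemma exp_serE c n : exp_ser c n = c ^+ n / (n`!)%:R. Proof. by []. Qed.
Local Notation b := bern_ser.
Local Notation X := (fpsX rat).
Local Notation half := (fpsC (2^-1 : rat)).

Lemma exp_serD c d : exp_ser (c + d) = exp_ser c * exp_ser d.
Proof.
apply/fpsP => n; rewrite fcoefM exp_serE addrC exprDn mulr_suml.
apply: eq_bigr => i _; have le_in : (i <= n)%N by rewrite -ltnS.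
rewrite !exp_serE -mulr_natr -!mulrA bin_ffactr //; ring.
Qed.

Lemma exp_ser0 : exp_ser 0 = 1.
Proof.
by apply/fpsP => -[|n]; rewrite fcoef1 exp_serE ?expr0n /= ?mul0r // divff.
Qed.

Lemma bern_serM : b * (exp_ser 1 - 1) = X.
Proof.
have eE k : (exp_ser 1 - 1) k = if k == 0%N then 0 else ((k`!)%:R)^-1.
  rewrite fcoefB fcoef1 exp_serE expr1n mul1r.
  by case: k => [|k] /=; rewrite ?subr0 // invr1 subrr.
apply/fpsP => n; rewrite fcoefM.
transitivity ((n`!)%:R^-1 * \sum_(i < n) ('C(n, i))%:R * bernoulli i).
  rewrite big_ord_recr /= eE subnn mulr0 addr0.
  rewrite mulr_sumr; apply: eq_bigr => i _.
  have lt_in : (i < n)%N by [].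
  rewrite bern_serE eE subn_eq0 leqNgt lt_in /=.
  by rewrite mulrA [_^-1 * _]mulrC bin_ffactr ?(ltnW lt_in) //; ring.
case: n => [|n]; first by rewrite big_ord0 mulr0.
rewrite sum_bernoulli fcoef_X eqSS; case: eqP => [->|_]; last by rewrite mulr0.
by rewrite mulr1 invr1.
Qed.

Lemma fpsX_neq0 : X != 0.
Proof. by apply/eqP => /fpsP/(_ 1%N). Qed.

Lemma theta_X : theta X = X.
Proof. by apply/fpsP => -[|[|n]]; rewrite fcoef_theta !fcoef_X ?mulr0 ?mulr1. Qed.

Lemma theta_exp c : theta (exp_ser c) = fpsC c * X * exp_ser c.
Proof.
apply/fpsP => -[|n]; rewrite -mulrA fcoefCM fcoefXM fcoef_theta ?exp_serE; first by rewrite mul0r mulr0.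
rewrite factS natrM exprS; field.
by rewrite factr_neq0 /= ?natr1 ?nat1r pnatr_eq0.
Qed.

(** Applying X d/dX to b (e^X - 1) = X and multiplying by b eliminates the exponential and leaves a
    Riccati equation. *)
Lemma theta_bern : theta b = b - b * X - b ^+ 2.
Proof.
apply/eqP; rewrite -subr_eq0; apply/eqP.
apply: (@fps_mulf_eq0 _ X) fpsX_neq0.
have := congr1 (fun f => b * theta f) bern_serM.
rewrite thetaM raddfB /= theta_exp theta_X rmorph1 (_ : theta 1 = 0) ?thetaC //.
rewrite -bern_serM; set e := exp_ser 1.
move: (theta b) => tb H.
by move/eqP: H; rewrite -subr_eq0 => /eqP <-; ring.
Qed.

(** This is (X/2) coth(X/2), an even function. *)
Definition bern_even : fps rat := b + half * X.
Local Notation beta := bern_even.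

Lemma theta_bern_even : theta beta = beta - beta ^+ 2 + half ^+ 2 * X ^+ 2.
Proof.
have h2 : half + half = 1 by rewrite -rmorphD -[RHS](rmorph1 (@fpsC rat)).
rewrite /beta raddfD /= thetaCM theta_X theta_bern -exprMn.
have {1}-> : X = half * X + half * X by rewrite -mulrDl h2 mul1r.
ring.
Qed.

Lemma bern_even0 : beta 0 = 1.
Proof. by rewrite fcoefD fcoefM0 bern_serE fcoef_X mulr0 addr0 divr1. Qed.

Lemma bern_evenE n : n != 1%N -> beta n = bernoulli n / (n`!)%:R.
Proof. by move=> n1; rewrite fcoefD fcoefCM bern_serE fcoef_X (negPf n1) mulr0 addr0. Qed.

(** The Riccati equation contains X only through X^2. In odd degree n every inner product of
    coefficients has a factor of smaller odd index, and what remains is (n + 1) beta_n = 0. *)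
Lemma bern_even_odd n : odd n -> beta n = 0.
Proof.
have [m] := ubnP n; elim: m n => // m IHm n; rewrite ltnS => le_nm odd_n.
have := congr1 (fun f : fps rat => f n) theta_bern_even.
rewrite fcoefD fcoefB fcoef_theta [beta ^+ 2]expr2 fcoefM.
have -> : (half ^+ 2 * X ^+ 2) n = 0.
  rewrite -rmorphXn fcoefCM [X ^+ 2]expr2 fcoefXM.
  by case: n odd_n {le_nm} => [|[|[|n]]] //=; rewrite mulr0.
case: n le_nm odd_n => // n le_nm odd_n.
rewrite big_ord_recl big_ord_recr /= subn0 subnn bern_even0 mul1r mulr1.
rewrite big1 ?add0r ?addr0 => [|i _]; last first.
  have lt_in : (i < n)%N by [].
  case odd_i: (odd i.+1).
    by rewrite (IHm i.+1) ?mul0r // (leq_trans _ le_nm).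
  rewrite (IHm (n.+1 - i.+1)%N) ?mulr0 ?oddB 1?ltnW // ?odd_n ?odd_i //.
  by move: le_nm lt_in; rewrite /bump /=; lia.
move=> H; have : n.+2%:R * beta n.+1 = 0.
  by rewrite -[n.+2%:R]natr1 mulrDl H; ring.
by move/eqP; rewrite mulf_eq0 (negPf (natr_neq0 _)) => /eqP.
Qed.

Lemma bernoulli_odd n : odd n -> (1 < n)%N -> bernoulli n = 0.
Proof.
move=> odd_n n1; have := bern_even_odd odd_n; rewrite bern_evenE; last by rewrite gtn_eqF.
by move/eqP; rewrite mulf_eq0 invr_eq0 (negPf (factr_neq0 _)) orbF => /eqP.
Qed.

Lemma bernoulli_small : [/\ bernoulli 1 = - 2^-1, bernoulli 2 = 6^-1,
  bernoulli 4 = - 30^-1, bernoulli 6 = 42^-1 & bernoulli 8 = - 30^-1].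
Proof.
have B1 : bernoulli 1 = - 2^-1 by rewrite bernoulliS big_ord1.
have B2 : bernoulli 2 = 6^-1.
  by rewrite bernoulliS !big_ord_recr big_ord0 /= B1 bernoulli0.
have B3 : bernoulli 3 = 0 by rewrite bernoulli_odd.
have B4 : bernoulli 4 = - 30^-1.
  by rewrite bernoulliS !big_ord_recr big_ord0 /= B1 B2 B3 bernoulli0.
have B5 : bernoulli 5 = 0 by rewrite bernoulli_odd.
have B6 : bernoulli 6 = 42^-1.
  by rewrite bernoulliS !big_ord_recr big_ord0 /= B1 B2 B3 B4 B5 bernoulli0.
have B7 : bernoulli 7 = 0 by rewrite bernoulli_odd.
split; [exact: B1 | exact: B2 | exact: B4 | exact: B6 |].
by rewrite bernoulliS !big_ord_recr big_ord0 /= B1 B2 B3 B4 B5 B6 B7 bernoulli0.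
Qed.

Definition wp_ser : fps rat := beta - theta beta.
Local Notation w := wp_ser.

(* With X^2 P(X) = w, this is the equation P'' = 6 P^2 + P of the degenerate
   Weierstrass function P = - (coth(X/2)/2)'. *)
Lemma wp_ser_ode :
  theta (theta w) - 5%:R * theta w + 6%:R * w = 6%:R * w ^+ 2 + X ^+ 2 * w.
Proof.
have h2 : half + half = 1 by rewrite -rmorphD -[RHS](rmorph1 (@fpsC rat)).
have wE : w = beta ^+ 2 - (half * X) ^+ 2.
  by rewrite /w theta_bern_even exprMn; ring.
have tbE : theta beta = beta - w by rewrite /w; ring.
have XE : X = half * X + half * X by rewrite -mulrDl h2 mul1r.
have thX : theta (half * X) = half * X by rewrite thetaCM theta_X.
have thetaB : {morph @theta rat : f g / f - g} by exact: raddfB.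
move: thX XE wE; move: (half * X) => hX thX XE wE.
have tw : theta w = 2%:R * w - 2%:R * beta * w.
  have -> : theta w = 2%:R * beta * (beta - w) - 2%:R * hX ^+ 2.
    by rewrite {1}wE thetaB !expr2 !thetaM thX tbE; ring.
  have -> : hX ^+ 2 = beta ^+ 2 - w by rewrite wE; ring.
  ring.
have t2 (f : fps rat) : theta (2%:R * f) = 2%:R * theta f.
  by rewrite -(rmorph_nat (@fpsC rat)) thetaCM.
(* Once X^2 is eliminated, both sides are polynomials in [beta] and [w]. *)
have -> : X ^+ 2 = 4%:R * (beta ^+ 2 - w).
  by rewrite wE {1}XE; ring.
rewrite tw thetaB -mulrA !t2 thetaM tbE tw.
ring.
Qed.

Lemma wp_serE n : w n = (1 - n%:R) * beta n.
Proof. by rewrite fcoefB fcoef_theta; ring. Qed.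

Lemma wp_ser_odd n : odd n -> w n = 0.
Proof. by move=> odd_n; rewrite wp_serE bern_even_odd // mulr0. Qed.

Lemma wp_ser0 : w 0 = 1.
Proof. by rewrite wp_serE bern_even0 subr0 mulr1. Qed.

Lemma wp_ser2 : w 2 = - 12^-1.
Proof. by rewrite wp_serE bern_evenE //; have [_ -> _ _ _] := bernoulli_small. Qed.

(* The constant term of the Eisenstein series of weight k normalized so that
   the coefficient of q is 1. *)
Definition Gconst (k : nat) : rat := - bernoulli k / (2 * k)%:R.

(** As for the Weierstrass function of a lattice, the Laurent coefficients of P are multiples of the
    constant terms of Eisenstein series. *)
Lemma wp_ser_Gconst j : w j.+2 = 2%:R * Gconst j.+2 / (j`!)%:R.
Proof.
rewrite wp_serE bern_evenE // /Gconst !factS !natrM -[j.+2%:R]natr1 -[j.+1%:R]natr1.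
field; rewrite !natr1 factr_neq0 ?pnatr_eq0.
by rewrite ?nat1r ?natrD ?pnatr_eq0; lia.
Qed.

(** The end terms are kept apart because in the uses below they involve weight 2 or vanish, and
    weight 2 must stay out of the recursion. *)
Lemma sum_even_split m (F : nat -> rat) : (4 <= m)%N -> ~~ odd m ->
  (forall i, odd i -> F i = 0) ->
  \sum_(i < m.+1) F i =
  F 0 + F m + \sum_(i < m.+1 | (1 < i < m.-1)%N && ~~ odd i) F i.
Proof.
move=> m4 ev_m Fodd.
rewrite (bigID (fun i : 'I_m.+1 => (1 < i < m.-1)%N && ~~ odd i)) /= addrC.
congr (_ + _).
rewrite (bigD1 ord0) //= (bigD1 ord_max) /=; last first.
  by rewrite -val_eqE /=; lia.
rewrite addrA [X in _ + X]big1 ?addr0 // => i /andP[/andP[notin i0] im].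
have [odd_i | ev_i] := boolP (odd i); first exact: Fodd.
move: notin i0 im; rewrite ev_i andbT -!val_eqE /= => notin i0 im.
have := ltn_ord i; lia.
Qed.

(** The coefficient of X^(m+4) in [wp_ser_ode]. Since w_2 = -1/12, the terms of 6 w^2 containing w_2
    cancel the contribution of X^2 w. With N = m + 4, the factor of w_N is (N - 2)(N - 3) - 12 = (N
    - 6)(N + 1) = (m - 2)(m + 5). *)
Lemma Gconst_rec m : (4 <= m)%N -> ~~ odd m ->
  \sum_(i < m.+1 | (1 < i < m.-1)%N && ~~ odd i)
     ('C(m, i))%:R * (Gconst i.+2 * Gconst (m - i).+2) =
  (m%:R - 2%:R) * (m%:R + 5%:R) / (12%:R * (m%:R + 1) * (m%:R + 2%:R)) * Gconst m.+4.
Proof.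
move=> m4 ev_m.
have := congr1 (fun f : fps rat => f m.+4) wp_ser_ode.
rewrite !fcoefD fcoefN -!(rmorph_nat (@fpsC rat)) !fcoefCM !fcoef_theta.
rewrite [X ^+ 2]expr2 -mulrA !fcoefXM.
rewrite expr2 fcoefM.
pose F j := w j.+2 * w (m - j).+2.
have -> : \sum_(i < m.+4.+1) w i * w (m.+4 - i)%N =
    2%:R * w m.+4 + 2%:R * w 2 * w m.+2 +
    \sum_(i < m.+1 | (1 < i < m.-1)%N && ~~ odd i) F i.
  rewrite big_ord_recl big_ord_recl big_ord_recr big_ord_recr /=.
  have -> : \sum_(i < m.+1) w (bump 0 (bump 0 i)) * w (m.+4 - bump 0 (bump 0 i))%N =
      \sum_(i < m.+1) F i.
    apply: eq_bigr => i _; rewrite /F /bump /= !add1n.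
    by congr (_ * w _); have := ltn_ord i; lia.
  rewrite /bump /= subn0 (wp_ser_odd (isT : odd 1)) mul0r add0r.
  rewrite (_ : m.+4 - m.+4 = 0)%N ?subnn // (_ : m.+4 - m.+3 = 1)%N; last by lia.
  rewrite (wp_ser_odd (isT : odd 1)) mulr0 addr0.
  rewrite (sum_even_split (F := F) m4 ev_m) => [|i odd_i]; last first.
    by rewrite /F wp_ser_odd ?mul0r //= negbK.
  rewrite /F subn0 subnn wp_ser0 !add1n.
  by move: (\sum_(i < m.+1 | _) _) (w m.+4) (w m.+2) (w 2) => S a c d; ring.
have -> : \sum_(i < m.+1 | (1 < i < m.-1)%N && ~~ odd i) F i =
   4%:R / (m`!)%:R * \sum_(i < m.+1 | (1 < i < m.-1)%N && ~~ odd i)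
     ('C(m, i))%:R * (Gconst i.+2 * Gconst (m - i).+2).
  rewrite mulr_sumr; apply: eq_bigr => i _; have le_im : (i <= m)%N by rewrite -ltnS.
  rewrite /F !wp_ser_Gconst.
  rewrite -[4%:R / _ * _]mulrA (mulrA (_^-1)) [_^-1 * _]mulrC bin_ffactr //.
  ring.
rewrite wp_ser2 !wp_ser_Gconst.
set S := (\sum_(i < _ | _) _) => H.
have fm : (m.+2)`!%:R = (m%:R + 2%:R) * (m%:R + 1) * (m`!)%:R :> rat.
  by rewrite !factS !natrM -[m.+2%:R]natr1 -[m.+1%:R]natr1; ring.
have [n1 n2 n0] : [/\ m%:R + 1 != 0 :> rat, m%:R + 2%:R != 0 :> rat & (m`!)%:R != 0 :> rat].
  by rewrite natr1 -natrD factr_neq0 !pnatr_eq0 addn2.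
move: H; rewrite fm.
have -> : m.+4%:R = m%:R + 4%:R :> rat by rewrite -natrD addn4.
move=> H; apply: (@mulfI _ (24%:R / (m`!)%:R)).
  by rewrite mulf_neq0 ?invr_neq0.
have -> : 24%:R / m`!%:R * S = 6%:R * (2%:R * (2%:R * Gconst m.+4 / ((m%:R + 2%:R) * (m%:R + 1) * m`!%:R)) +
       2%:R * (- 12%:R^-1) * (2%:R * Gconst m.+2 / m`!%:R) + 4%:R / m`!%:R * S) + 2%:R * Gconst m.+2 / m`!%:R
       - 12%:R * (2%:R * Gconst m.+4 / ((m%:R + 2%:R) * (m%:R + 1) * m`!%:R)).
  by field; rewrite n0 n1 n2.
by rewrite -H; field; rewrite n0 n1 n2.
Qed.

(** This is w = X^2 e^X / (e^X - 1)^2 with one denominator cleared. *)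
Lemma wp_serM : w * (exp_ser 1 - 1) = X * b * exp_ser 1.
Proof.
have -> : w = b * (X + b).
  rewrite /w /bern_even raddfD /= thetaCM theta_X theta_bern; ring.
have -> : b * (X + b) * (exp_ser 1 - 1) = (X + b) * (b * (exp_ser 1 - 1)) by ring.
have -> : X * b * exp_ser 1 = X * (b * (exp_ser 1 - 1) + b) by ring.
by rewrite bern_serM; ring.
Qed.

Lemma exp_ser_sum d :
  X * \sum_(a < d) exp_ser a%:R = b * (exp_ser d%:R - 1).
Proof.
elim: d => [|d IHd]; first by rewrite big_ord0 exp_ser0 subrr !mulr0.
rewrite big_ord_recr mulrDr IHd -bern_serM -[d.+1%:R]natr1 exp_serD.
ring.
Qed.

(** Raising d by one adds the plain geometric sum over a <= d, which [exp_ser_sum] evaluates. *)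
Lemma exp_ser_sum_lin d :
  X ^+ 2 * \sum_(a < d) fpsC (d%:R - a%:R) * exp_ser a%:R =
  w * (exp_ser d%:R - 1) - fpsC d%:R * X * b.
Proof.
elim: d => [|d IHd].
  by rewrite big_ord0 exp_ser0 subrr rmorph0 !(mulr0, mul0r) subrr.
have -> : \sum_(a < d.+1) fpsC (d.+1%:R - a%:R) * exp_ser a%:R =
    \sum_(a < d) fpsC (d%:R - a%:R) * exp_ser a%:R + \sum_(a < d.+1) exp_ser a%:R.
  rewrite !big_ord_recr /= addrA -big_split /=; congr (_ + _).
    apply: eq_bigr => a _; rewrite -natr1 addrAC rmorphD rmorph1 mulrDl mul1r //.
  by rewrite -natr1 addrAC subrr add0r rmorph1 mul1r.
rewrite mulrDr IHd expr2 -[X * X * \sum_(_ < d.+1) _]mulrA exp_ser_sum.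
rewrite -[d.+1%:R]natr1 exp_serD rmorphD rmorph1 /=.
have H := wp_serM; apply/eqP; rewrite -subr_eq0; apply/eqP.
rewrite (_ : _ - _ = exp_ser d%:R * (X * b * exp_ser 1 - w * (exp_ser 1 - 1))); last ring.
by rewrite H subrr mulr0.
Qed.

(** The coefficient of X^(m+2) in [exp_ser_sum_lin]; the term with [bernoulli m.+1] drops out
    because m + 1 is odd. Writing w through [Gconst] produces the sum that is subtracted in
    [Sser_wp]. *)
Lemma sum_pow_lin m d : (4 <= m)%N -> ~~ odd m ->
  \sum_(1 <= a < d) (d%:R - a%:R) * a%:R ^+ m =
  d%:R ^+ m.+2 / ((m%:R + 1) * (m%:R + 2%:R)) - d%:R ^+ m / 12%:R +
  2%:R * \sum_(i < m.+1 | (1 < i < m.-1)%N && ~~ odd i)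
    ('C(m, i))%:R * Gconst i.+2 * d%:R ^+ (m - i) :> rat.
Proof.
move=> m4 ev_m; have m0 : (0 < m)%N by lia.
have := congr1 (fun f : fps rat => f m.+2) (exp_ser_sum_lin d).
rewrite expr2 -mulrA !fcoefXM fcoef_sum fcoefB -mulrA fcoefCM fcoefXM bern_serE.
rewrite bernoulli_odd // mul0r !mulr0 subr0.
have -> : \sum_(i < d) (fpsC (d%:R - i%:R) * exp_ser i%:R) m =
    (\sum_(1 <= a < d) (d%:R - a%:R) * a%:R ^+ m) / (m`!)%:R.
  have [-> | d0] := posnP d; first by rewrite big_ord0 big_geq // mul0r.
  rewrite -(big_mkord xpredT (fun i => (fpsC (d%:R - i%:R) * exp_ser i%:R) m)).
  rewrite big_ltn // fcoefCM exp_serE expr0n (gtn_eqF m0) mul0r mulr0 add0r.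
  by rewrite mulr_suml; apply: eq_bigr => i _; rewrite fcoefCM exp_serE mulrA.
pose e k : rat := (exp_ser d%:R - 1) k.
have eE k : e k = if k == 0%N then 0 else d%:R ^+ k / (k`!)%:R.
  rewrite /e fcoefB fcoef1 exp_serE; case: eqP => [->|_]; last by rewrite subr0.
  by rewrite divr1 subrr.
rewrite fcoefM big_ord_recl big_ord_recl /= subn0 wp_ser0 (wp_ser_odd (isT : odd 1)).
rewrite mul0r add0r mul1r -/(e _).
pose F i := w i.+2 * e (m - i)%N.
have -> : \sum_(i < m.+1) w (bump 0 (bump 0 i)) * (exp_ser d%:R - 1) (m.+2 - bump 0 (bump 0 i))%N =
   \sum_(i < m.+1) F i.
  by apply: eq_bigr => i _; rewrite /bump /F /= !add1n !subSS.
rewrite (sum_even_split (F := F) m4 ev_m) => [|i odd_i]; last first.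
  by rewrite /F wp_ser_odd ?mul0r //= negbK.
rewrite /F subn0 subnn [e 0]eE /= mulr0 addr0 wp_ser2 !eE /= (gtn_eqF m0).
have -> : \sum_(i < m.+1 | (1 < i < m.-1)%N && ~~ odd i) w i.+2 * e (m - i)%N =
   2%:R / (m`!)%:R * \sum_(i < m.+1 | (1 < i < m.-1)%N && ~~ odd i)
    ('C(m, i))%:R * Gconst i.+2 * d%:R ^+ (m - i).
  rewrite mulr_sumr; apply: eq_bigr => i /andP[/andP[_ lt_im] _].
  have le_im : (i <= m)%N by rewrite -ltnS.
  rewrite wp_ser_Gconst eE subn_eq0 leqNgt (leq_trans lt_im (leq_pred m)) /=.
  transitivity (2%:R * Gconst i.+2 * d%:R ^+ (m - i) *
    ((i`!)%:R^-1 * (((m - i)`!)%:R)^-1)); first by ring.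
  by rewrite -bin_ffactr //; ring.
set S := (\sum_(i < _ | _) _) => H.
have fm : (m.+2)`!%:R = (m%:R + 2%:R) * (m%:R + 1) * (m`!)%:R :> rat.
  by rewrite !factS !natrM -[m.+2%:R]natr1 -[m.+1%:R]natr1; ring.
have [n1 n2 n0] : [/\ m%:R + 1 != 0 :> rat, m%:R + 2%:R != 0 :> rat & (m`!)%:R != 0 :> rat].
  by rewrite natr1 -natrD factr_neq0 !pnatr_eq0 addn2.
apply: (@mulIf _ (m`!%:R)^-1); first by rewrite invr_eq0.
by rewrite H fm; field; rewrite n0 n1 n2.
Qed.

Lemma sum_prod_compl (d : nat) :
  \sum_(1 <= a < d) a%:R * (d%:R - a%:R) = (d%:R ^+ 3 - d%:R) / 6%:R :> rat.
Proof.
have sum1 n : \sum_(1 <= a < n.+1) a%:R = n%:R * (n%:R + 1) / 2%:R :> rat.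
  elim: n => [|n IHn]; first by rewrite big_geq // !mul0r.
  by rewrite big_nat_recr // IHn -[n.+1%:R]natr1 /=; field.
elim: d => [|d IHd]; first by rewrite big_geq // expr0n subrr mul0r.
have [-> | d0] := posnP d; first by rewrite big_geq // expr1n subrr mul0r.
rewrite big_nat_recr //=.
have -> : \sum_(1 <= i < d) (i%:R * (d.+1%:R - i%:R)) =
   \sum_(1 <= i < d) (i%:R * (d%:R - i%:R)) + \sum_(1 <= i < d) i%:R :> rat.
  by rewrite -big_split; apply: eq_bigr => i _ /=; rewrite -natr1; ring.
rewrite IHd; case: d d0 {IHd} => // d _; rewrite sum1 -[d.+2%:R]natr1 -[d.+1%:R]natr1.
by field.
Qed.
End BernoulliSeries.

(** * The recursion for Eisenstein series *)

Section DsumLin.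
Variable R : comNzRingType.
Implicit Types F G : nat -> R.
Lemma dsumD F G n : dsum (fun d => F d + G d) n = dsum F n + dsum G n.
Proof. by rewrite /dsum; case: eqP => _; rewrite ?addr0 // big_split. Qed.
Lemma dsumB F G n : dsum (fun d => F d - G d) n = dsum F n - dsum G n.
Proof. by rewrite /dsum; case: eqP => _; rewrite ?subr0 // sumrB. Qed.
Lemma dsumZ c F n : dsum (fun d => c * F d) n = c * dsum F n.
Proof. by rewrite /dsum; case: eqP => _; rewrite ?mulr0 // mulr_sumr. Qed.
Lemma dsum_sum (I : finType) (P : pred I) (F : I -> nat -> R) n :
  dsum (fun d => \sum_(i | P i) F i d) n = \sum_(i | P i) dsum (F i) n.
Proof.
rewrite /dsum; case: eqP => _; first by rewrite big1.
by rewrite exchange_big.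
Qed.
Lemma eq_dsum F G n : (forall d, (0 < d)%N -> (d %| n)%N -> F d = G d) ->
  dsum F n = dsum G n.
Proof.
move=> eqFG; rewrite /dsum; case: posnP => // n0.
apply: eq_big_seq => d; rewrite -dvdn_divisors // => d_n.
by rewrite eqFG // (dvdn_gt0 n0).
Qed.
End DsumLin.

Definition Sser (s : nat) : fps rat := dser (fun d => d%:R ^+ s).

Definition Gser (k : nat) : fps rat := fpsC (Gconst k) + Sser k.-1.

Lemma Sser_mul n i j :
  (Sser i * Sser j) n = \sum_(q | sol (n := n) q) (qa q)%:R ^+ i * (qb q)%:R ^+ j.
Proof. by rewrite -(sum_sol_mul n (fun d => d%:R ^+ i) (fun d => d%:R ^+ j)). Qed.

Lemma Sser0 i : Sser i 0 = 0. Proof. by []. Qed.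

Lemma even_expD (x y : rat) m : ~~ odd m ->
  (x + y) ^+ m + (x - y) ^+ m =
  2%:R * \sum_(i < m.+1 | ~~ odd i) ('C(m, i))%:R * (x ^+ i * y ^+ (m - i)).
Proof.
move=> ev_m; have -> : (x - y) ^+ m = (y - x) ^+ m.
  by rewrite -opprB exprNn -signr_odd (negPf ev_m) mul1r.
rewrite [x + y]addrC exprDn exprBn -big_split /=.
rewrite mulr_sumr [RHS]big_mkcond /=; apply: eq_bigr => i _.
rewrite -signr_odd -2![(_ * _) *+ _]mulr_natr.
by case: (odd i); rewrite /= ?expr1 ?expr0; ring.
Qed.

(** For the weight N = m + 4 the numerator is (N - 6)(N + 1); it vanishes modulo p at N = p - 1. *)
Definition wp_coef (m : nat) : rat :=
  (m%:R - 2%:R) * (m%:R + 5%:R) / (12%:R * (m%:R + 1) * (m%:R + 2%:R)).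

Lemma Sser_wp m : (4 <= m)%N -> ~~ odd m ->
  \sum_(i < m.+1 | (1 < i < m.-1)%N && ~~ odd i)
     fpsC ('C(m, i))%:R * (Sser i.+1 * Sser (m - i).+1) =
  fpsC (wp_coef m) * Sser m.+3 -
  2%:R * \sum_(i < m.+1 | (1 < i < m.-1)%N && ~~ odd i)
     fpsC (('C(m, i))%:R * Gconst i.+2) * Sser (m - i).+1.
Proof.
move=> m4 ev_m; apply/fpsP => n.
rewrite fcoefB -(rmorph_nat (@fpsC rat)) !fcoefCM !fcoef_sum.
have [-> | n0] := posnP n.
  rewrite Sser0 mulr0 !big1 ?mulr0 ?subr0 // => i _; last by rewrite fcoefCM fcoefM0 Sser0 mul0r mulr0.
  by rewrite fcoefCM Sser0 mulr0.
(* [g] is [f] after the substitution of a - b for a. The leading terms of f - g combine to ab((a +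
   b)^m + (a - b)^m), and the others remove its end terms, which would give [Sser 1] times
   [Sser m.+1]. Moreover [g] vanishes for a = b, so no factor n / d arises and hence no
   derivative. *)
pose f (a b : nat) : rat :=
  a%:R * b%:R * (a%:R + b%:R) ^+ m - (a%:R + b%:R) * (b%:R * a%:R ^+ m + a%:R * b%:R ^+ m).
pose g (a b : nat) : rat :=
  - (a%:R * b%:R * (a%:R - b%:R) ^+ m) + (a%:R - b%:R) * (b%:R * a%:R ^+ m - a%:R * b%:R ^+ m).
have fC a b : f a b = f b a by rewrite /f [b%:R + a%:R]addrC; ring.
have gC a b : g a b = g b a.
  rewrite /g -[b%:R - a%:R]opprB exprNn -signr_odd (negPf ev_m) mul1r; ring.
have gf a b : g (a + b)%N b = f a b by rewrite /g /f natrD addrK; ring.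
have := liouville n fC gC gf.
rewrite (sum_sol_xy f n0) (sum_sol_ab g n0) -sumrB.
have -> : dsum (fun d => g d d *+ (n %/ d).-1) n = 0 :> rat.
  rewrite /dsum; case: eqP => // _; rewrite big1 // => d _.
  by rewrite /g subrr expr0n gtn_eqF ?(ltn_trans _ m4) // mul0r mulr0 oppr0 addr0 mul0rn.
rewrite subr0.
under eq_bigr => q _.
  have -> : f (qa q) (qb q) - g (qa q) (qb q) =
     2%:R * \sum_(i < m.+1 | (1 < i < m.-1)%N && ~~ odd i)
       ('C(m, i))%:R * ((qa q)%:R ^+ i.+1 * (qb q)%:R ^+ (m - i).+1).
    set x : rat := (qa q)%:R; set y : rat := (qb q)%:R.
    have := even_expD x y ev_m.
    rewrite big_mkcond /=.
    pose F i := if ~~ odd i then 'C(m, i)%:R * (x ^+ i * y ^+ (m - i)) else 0.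
    rewrite (sum_even_split (F := F) m4 ev_m) => [|i odd_i]; last by rewrite /F odd_i.
    rewrite {1 2}/F /= ev_m subn0 subnn bin0 binn !expr0 !mul1r mulr1 => H.
    have -> : \sum_(i < m.+1 | (1 < i < m.-1)%N && ~~ odd i) 'C(m, i)%:R * (x ^+ i.+1 * y ^+ (m - i).+1) =
       x * y * \sum_(i < m.+1 | (1 < i < m.-1)%N && ~~ odd i) F i.
      rewrite mulr_sumr; apply: eq_bigr => i /andP[_ ev_i].
      by rewrite /F ev_i !exprS; ring.
    rewrite /f /g -/x -/y.
    rewrite [LHS](_ : _ = x * y * ((x + y) ^+ m + (x - y) ^+ m) - 2%:R * x * y * (y ^+ m + x ^+ m)); last ring.
    by rewrite H; ring.
  over.
rewrite -mulr_sumr exchange_big /=.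
have -> : \sum_(i < m.+1 | (1 < i < m.-1)%N && ~~ odd i) \sum_(q | sol (n := n) q)
    'C(m, i)%:R * ((qa q)%:R ^+ i.+1 * (qb q)%:R ^+ (m - i).+1) =
  \sum_(i < m.+1 | (1 < i < m.-1)%N && ~~ odd i)
      (fpsC 'C(m, i)%:R * (Sser i.+1 * Sser (m - i).+1)) n.
  by apply: eq_bigr => i _; rewrite -mulr_sumr -Sser_mul fcoefCM.
have -> : dsum (fun d => \sum_(1 <= a < d) f a (d - a)%N) n =
   2%:R * (wp_coef m * Sser m.+3 n) - 4%:R * \sum_(i < m.+1 | (1 < i < m.-1)%N && ~~ odd i)
     (fpsC (('C(m, i))%:R * Gconst i.+2) * Sser (m - i).+1) n.
  under [in RHS]eq_bigr => i _ do rewrite fcoefCM /Sser dserE -dsumZ.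
  rewrite -dsum_sum /Sser dserE -!dsumZ -dsumB; apply: eq_dsum => d d0 _.
  have -> : \sum_(1 <= a < d) f a (d - a)%N =
    d%:R ^+ m * \sum_(1 <= a < d) a%:R * (d%:R - a%:R) -
    2%:R * d%:R * \sum_(1 <= a < d) (d%:R - a%:R) * a%:R ^+ m.
    have rev : \sum_(1 <= a < d) a%:R * (d%:R - a%:R) ^+ m =
        \sum_(1 <= a < d) (d%:R - a%:R) * a%:R ^+ m :> rat.
      rewrite big_nat_rev; apply: eq_big_nat => a /andP[_ lt_ad].
      by rewrite add1n subSS natrB ?(ltnW lt_ad) // subKr.
    have -> : 2%:R * d%:R * \sum_(1 <= a < d) (d%:R - a%:R) * a%:R ^+ m =
      d%:R * (\sum_(1 <= a < d) a%:R * (d%:R - a%:R) ^+ m +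
              \sum_(1 <= a < d) (d%:R - a%:R) * a%:R ^+ m) :> rat by rewrite rev; ring.
    rewrite -big_split !mulr_sumr -sumrB.
    apply: eq_big_nat => a /andP[_ lt_ad].
    by rewrite /f natrB ?(ltnW lt_ad) //= (_ : a%:R + (d%:R - a%:R) = d%:R); ring.
  rewrite sum_prod_compl sum_pow_lin //.
  have [n1 n2] : m%:R + 1 != 0 :> rat /\ m%:R + 2%:R != 0 :> rat.
    by rewrite natr1 -natrD !pnatr_eq0 addn2.
  have -> : \sum_(i < m.+1 | (1 < i < m.-1)%N && ~~ odd i) 'C(m, i)%:R * Gconst i.+2 * d%:R ^+ (m - i).+1 =
    d%:R * \sum_(i < m.+1 | (1 < i < m.-1)%N && ~~ odd i) 'C(m, i)%:R * Gconst i.+2 * d%:R ^+ (m - i).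
    by rewrite mulr_sumr; apply: eq_bigr => i _; rewrite exprS; ring.
  rewrite /wp_coef !exprS; field.
  by rewrite n1 n2.
move=> H; apply: (@mulfI _ 2%:R) => //; rewrite H; ring.
Qed.

(** The products of constants are handled by [Gconst_rec] and those of divisor series by [Sser_wp].
    The two families of mixed products agree under i -> m - i, which matches the factor 2 in
    [Sser_wp]. *)
Lemma Gser_wp m : (4 <= m)%N -> ~~ odd m ->
  \sum_(i < m.+1 | (1 < i < m.-1)%N && ~~ odd i)
     fpsC ('C(m, i))%:R * (Gser i.+2 * Gser (m - i).+2) =
  fpsC (wp_coef m) * Gser m.+4.
Proof.
move=> m4 ev_m; rewrite /Gser /=.
have sym : \sum_(i < m.+1 | (1 < i < m.-1)%N && ~~ odd i)
     fpsC (('C(m, i))%:R * Gconst i.+2) * Sser (m - i).+1 =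
  \sum_(i < m.+1 | (1 < i < m.-1)%N && ~~ odd i)
     fpsC (('C(m, i))%:R * Gconst (m - i).+2) * Sser i.+1.
  rewrite (reindex_inj rev_ord_inj) /=; apply: eq_big => [i | i _].
    have := ltn_ord i; move: m4 ev_m; lia.
  have le_im : (i <= m)%N by rewrite -ltnS.
  by rewrite subSS subKn // bin_sub.
rewrite mulrDr -rmorphM /= -Gconst_rec // -/(Sser _).
have := Sser_wp m4 ev_m => /eqP; rewrite eq_sym subr_eq => /eqP->.
rewrite mulr_natl mulr2n {2}sym rmorph_sum -!big_split /=; apply: eq_bigr => i _.
by rewrite !rmorphM /=; ring.
Qed.

(** * Ramanujan's differential equations *)

(** Liouville's method applies to the symmetric sums a^m + b^m + (a + b)^m and a^m + b^m + (a -
    b)^m. On the diagonal a = b the second is 2 d^m, taken n / d - 1 times; its part 2 n d^(m-1) is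
    the origin of [theta] in Ramanujan's equations. *)
Lemma liouville_pow m n : (0 < m)%N -> ~~ odd m ->
  \sum_(q | sol (n := n) q)
     (((qa q)%:R + (qb q)%:R) ^+ m - ((qa q)%:R - (qb q)%:R) ^+ m) =
  dsum (fun d => 2%:R * \sum_(1 <= a < d) a%:R ^+ m + (d%:R + 1) * d%:R ^+ m) n -
  2%:R * theta (Sser m.-1) n :> rat.
Proof.
move=> m0 ev_m.
have [-> | n0] := posnP n.
  rewrite fcoef_theta mul0r mulr0 subr0 big1 // => q.
  move=> /and5P[a0 _ x0 _ /eqP]; have: (0 < qa q * qx q)%N by rewrite muln_gt0 a0.
  lia.
pose f (a b : nat) : rat := a%:R ^+ m + b%:R ^+ m + (a%:R + b%:R) ^+ m.
pose g (a b : nat) : rat := a%:R ^+ m + b%:R ^+ m + (a%:R - b%:R) ^+ m.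
have fC a b : f a b = f b a by rewrite /f [b%:R + a%:R]addrC; ring.
have gC a b : g a b = g b a.
  rewrite /g -[b%:R - a%:R]opprB exprNn -signr_odd (negPf ev_m) mul1r; ring.
have gf a b : g (a + b)%N b = f a b by rewrite /g /f natrD addrK; ring.
have := liouville n fC gC gf; rewrite (sum_sol_xy f n0) (sum_sol_ab g n0) -sumrB.
have -> : \sum_(q | sol (n := n) q) (f (qa q) (qb q) - g (qa q) (qb q)) =
   \sum_(q | sol (n := n) q)
     (((qa q)%:R + (qb q)%:R) ^+ m - ((qa q)%:R - (qb q)%:R) ^+ m).
  by apply: eq_bigr => q _; rewrite /f /g; ring.
move=> ->; rewrite fcoef_theta /Sser dserE -!dsumZ -!dsumB.
apply: eq_dsum => d d0 d_n.
have -> : g d d *+ (n %/ d).-1 = 2%:R * (n%:R * d%:R ^+ m.-1) - 2%:R * d%:R ^+ m.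
  have nE : n%:R = (n %/ d)%:R * d%:R :> rat by rewrite -natrM divnK.
  have nd0 : (0 < n %/ d)%N by rewrite divn_gt0 // dvdn_leq.
  rewrite nE; move: nd0; case: (n %/ d)%N => // k _; rewrite -natr1 /= /g.
  rewrite subrr expr0n (gtn_eqF m0) addr0 -mulr_natr.
  by case: {f g fC gC gf ev_m} m m0 => // m _; rewrite exprS /=; ring.
have -> : \sum_(1 <= a < d) f a (d - a)%N =
    2%:R * \sum_(1 <= a < d) a%:R ^+ m + (d%:R - 1) * d%:R ^+ m.
  have rev : \sum_(1 <= a < d) (d%:R - a%:R) ^+ m = \sum_(1 <= a < d) a%:R ^+ m :> rat.
    rewrite [RHS]big_nat_rev; apply: eq_big_nat => a /andP[_ lt_ad].
    by rewrite add1n subSS natrB ?(ltnW lt_ad).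
  have -> : (d%:R - 1) * d%:R ^+ m = \sum_(1 <= a < d) d%:R ^+ m :> rat.
    by rewrite sumr_const_nat -[RHS]mulr_natl natrB.
  rewrite mulr_natl mulr2n -{2}rev -!big_split.
  apply: eq_big_nat => a /andP[_ lt_ad] /=.
  by rewrite /f natrB ?(ltnW lt_ad) // [a%:R + _]addrC subrK.
ring.
Qed.

Lemma sum_pow2 d : \sum_(1 <= a < d) a%:R ^+ 2 =
  (if d == 0%N then 0 else d%:R ^+ 3 / 3%:R - d%:R ^+ 2 / 2%:R + d%:R / 6%:R) :> rat.
Proof.
case: d => [|d]; first by rewrite big_geq.
elim: d => [|d IHd]; first by rewrite big_geq //=; field.
by rewrite big_nat_recr // IHd -[d.+2%:R]natr1 -[d.+1%:R]natr1 /=; field.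
Qed.

Lemma sum_pow4 d : \sum_(1 <= a < d) a%:R ^+ 4 =
  (if d == 0%N then 0 else
   d%:R ^+ 5 / 5%:R - d%:R ^+ 4 / 2%:R + d%:R ^+ 3 / 3%:R - d%:R / 30%:R) :> rat.
Proof.
case: d => [|d]; first by rewrite big_geq.
elim: d => [|d IHd]; first by rewrite big_geq //=; field.
by rewrite big_nat_recr // IHd -[d.+2%:R]natr1 -[d.+1%:R]natr1 /=; field.
Qed.

Lemma sum_pow6 d : \sum_(1 <= a < d) a%:R ^+ 6 =
  (if d == 0%N then 0 else
   d%:R ^+ 7 / 7%:R - d%:R ^+ 6 / 2%:R + d%:R ^+ 5 / 2%:R - d%:R ^+ 3 / 6%:R
     + d%:R / 42%:R) :> rat.
Proof.
case: d => [|d]; first by rewrite big_geq.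
elim: d => [|d IHd]; first by rewrite big_geq //=; field.
by rewrite big_nat_recr // IHd -[d.+2%:R]natr1 -[d.+1%:R]natr1 /=; field.
Qed.

Lemma SserE s n : Sser s n = dsum (fun d => d%:R ^+ s) n. Proof. by []. Qed.

Lemma Sser_comb n (F : rat -> rat -> rat) (l : seq (rat * nat * nat)) :
  (forall x y, F x y = \sum_(t <- l)
     t.1.1 * (x ^+ t.1.2 * y ^+ t.2)) ->
  \sum_(q | sol (n := n) q) F (qa q)%:R (qb q)%:R =
  \sum_(t <- l) t.1.1 * (Sser t.1.2 * Sser t.2) n.
Proof.
move=> FE; rewrite (eq_bigr _ (fun q _ => FE _ _)) exchange_big /=.
by apply: eq_bigr => t _; rewrite -mulr_sumr -Sser_mul.
Qed.

(** This identity and the next two are [liouville_pow] for m = 2, 4, 6, that is, Ramanujan's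
    equations for E_2, E_4 and E_6 in terms of divisor sums. The case m = 6 leaves [Sser 7], to be
    removed by [Sser7E]. *)
Lemma Sser11 : 12%:R * Sser 1 ^+ 2 = 5%:R * Sser 3 + Sser 1 - 6%:R * theta (Sser 1).
Proof.
apply/fpsP => n; rewrite fcoefB fcoefD -!(rmorph_nat (@fpsC rat)) !fcoefCM.
have := liouville_pow n (isT : 0 < 2)%N isT.
under eq_bigr => q _.
  rewrite [_ - _](_ : _ = 4%:R * ((qa q)%:R ^+ 1 * (qb q)%:R ^+ 1)); last ring.
  over.
rewrite -mulr_sumr -Sser_mul -expr2 => H.
have -> : (Sser 1 ^+ 2) n = 4%:R^-1 * (4%:R * (Sser 1 ^+ 2) n) by field.
rewrite {}H (_ : dsum _ _ = 5%:R / 3%:R * Sser 3 n + 3%:R^-1 * Sser 1 n); last first.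
  rewrite !SserE -!dsumZ -dsumD; apply: eq_dsum => d d0 _.
  by rewrite sum_pow2 gtn_eqF //; field.
by field.
Qed.

Lemma Sser13 :
  240%:R * (Sser 1 * Sser 3) = 21%:R * Sser 5 + 10%:R * Sser 3 - Sser 1 - 30%:R * theta (Sser 3).
Proof.
apply/fpsP => n; rewrite !fcoefB fcoefD -!(rmorph_nat (@fpsC rat)) !fcoefCM.
have := liouville_pow n (isT : 0 < 4)%N isT; rewrite [4.-1]/=.
under eq_bigr => q _.
  rewrite [_ - _](_ : _ = 8%:R * ((qa q)%:R ^+ 1 * (qb q)%:R ^+ 3) +
    8%:R * ((qa q)%:R ^+ 3 * (qb q)%:R ^+ 1)); last ring.
  over.
rewrite big_split /= -!mulr_sumr -!Sser_mul [Sser 3 * Sser 1]mulrC => H.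
have -> : (Sser 1 * Sser 3) n = 16%:R^-1 * (8%:R * (Sser 1 * Sser 3) n + 8%:R * (Sser 1 * Sser 3) n) by field.
rewrite {}H (_ : dsum _ _ = 7%:R / 5%:R * Sser 5 n + 2%:R / 3%:R * Sser 3 n - 15%:R^-1 * Sser 1 n); last first.
  rewrite !SserE -!dsumZ -dsumD -dsumB; apply: eq_dsum => d d0 _.
  by rewrite sum_pow4 gtn_eqF //; field.
by field.
Qed.

Lemma Sser15 :
  504%:R * (Sser 1 * Sser 5) + 840%:R * (Sser 3 * Sser 3) =
  27%:R * Sser 7 + 21%:R * Sser 5 - 7%:R * Sser 3 + Sser 1 - 42%:R * theta (Sser 5).
Proof.
apply/fpsP => n; rewrite !(fcoefD, fcoefN) -!(rmorph_nat (@fpsC rat)) !fcoefCM.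
have := liouville_pow n (isT : 0 < 6)%N isT; rewrite [6.-1]/=.
rewrite (@Sser_comb n (fun x y => (x + y) ^+ 6 - (x - y) ^+ 6)
  [:: (12%:R, 1, 5); (12%:R, 5, 1); (40%:R, 3, 3)]%N); last first.
  by move=> x y; rewrite !big_cons big_nil /=; ring.
rewrite !big_cons big_nil /= addr0 => H.
transitivity (21%:R * (12%:R * (Sser 1 * Sser 5) n +
    (12%:R * (Sser 5 * Sser 1) n + 40%:R * (Sser 3 * Sser 3) n))).
  have -> : (Sser 5 * Sser 1) n = (Sser 1 * Sser 5) n by rewrite mulrC.
  ring.
rewrite {}H (_ : dsum _ _ = 9%:R / 7%:R * Sser 7 n + Sser 5 n - 3%:R^-1 * Sser 3 n + 21%:R^-1 * Sser 1 n); last first.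
  rewrite !SserE -!dsumZ -dsumD -dsumB -dsumD; apply: eq_dsum => d d0 _.
  by rewrite sum_pow6 gtn_eqF //; field.
by field.
Qed.

(** In other words E_4^2 = E_8. For m = 4 the recursion has the single term i = 2, and 120 is the
    binomial coefficient 6 divided by [wp_coef 4] = 1/20. *)
Lemma Gser44 : 120%:R * Gser 4 ^+ 2 = Gser 8.
Proof.
have := Gser_wp (isT : 4 <= 4)%N isT; rewrite /= (_ : wp_coef 4 = 20%:R^-1); last by rewrite /wp_coef; field.
rewrite (big_pred1 (inord 2)) => [|i]; last first.
  by rewrite /= -val_eqE /= inordK //; case: i => -[|[|[|[|[|]]]]].
rewrite inordK // -expr2 => H.
have {1}-> : Gser 8 = fpsC 20%:R * (fpsC 20%:R^-1 * Gser 8).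
  by rewrite mulrA -rmorphM /= divff // rmorph1 mul1r.
by rewrite -H [RHS]mulrA -(rmorphM (@fpsC rat)) /= -natrM -(rmorph_nat (@fpsC rat)).
Qed.

Lemma fpsC_mulI (c : rat) (f g : fps rat) :
  c != 0 -> fpsC c * f = fpsC c * g -> f = g.
Proof.
move=> c0 eq_fg; apply/fpsP => i.
by have := congr1 (fun h : fps rat => h i) eq_fg; rewrite !fcoefCM => /(mulfI c0).
Qed.

Lemma fpsC_Gser (c : rat) k : c * Gconst k = 1 -> fpsC c * Gser k = 1 + fpsC c * Sser k.-1.
Proof. by move=> cG; rewrite /Gser mulrDr -(rmorphM (@fpsC rat)) cG rmorph1. Qed.

Lemma Sser7E : Sser 7 = Sser 3 + fpsC 120%:R * (Sser 3 * Sser 3).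
Proof.
(* The inverses of [Gconst 4] and [Gconst 8] are 240 = 2c and 480 = 4c. *)
pose c : rat := 120%:R; have c0 : c != 0 by [].
have c2 : fpsC (2%:R * c) = 2%:R * fpsC c by rewrite rmorphM /= rmorph_nat.
have c4 : fpsC (4%:R * c) = 4%:R * fpsC c by rewrite rmorphM /= rmorph_nat.
have G4 : fpsC (2%:R * c) * Gser 4 = 1 + fpsC (2%:R * c) * Sser 3.
  by apply: fpsC_Gser; rewrite /Gconst; have [_ _ -> _ _] := bernoulli_small.
have G8 : fpsC (4%:R * c) * Gser 8 = 1 + fpsC (4%:R * c) * Sser 7.
  by apply: fpsC_Gser; rewrite /Gconst; have [_ _ _ _ ->] := bernoulli_small.
apply: (@fpsC_mulI (4%:R * c)); first by rewrite mulf_neq0.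
apply: (@addrI _ 1); rewrite -{}G8 -Gser44 -/c.
have -> : 120%:R = fpsC c by rewrite rmorph_nat.
move: (Gser 4) (Sser 3) G4 => g s; rewrite c2 c4; move: (fpsC c) => t G4.
have -> : 4%:R * t * (t * g ^+ 2) = (2%:R * t * g) ^+ 2 by ring.
by rewrite G4; ring.
Qed.

Definition Ef2 (R : comNzRingType) : fps R := 1 - 24%:R * dser (fun d => d%:R ^+ 1).
Definition Ef4 (R : comNzRingType) : fps R := 1 + 240%:R * dser (fun d => d%:R ^+ 3).
Definition Ef6 (R : comNzRingType) : fps R := 1 - 504%:R * dser (fun d => d%:R ^+ 5).

Lemma theta_natM (R : comNzRingType) n (f : fps R) : theta (n%:R * f) = n%:R * theta f.
Proof. by rewrite -(rmorph_nat (@fpsC R)) thetaCM. Qed.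

Lemma theta1 (R : comNzRingType) : theta 1 = 0 :> fps R.
Proof. by rewrite -(rmorph1 (@fpsC R)) thetaC. Qed.

Lemma ramanujan_rat (E2 := Ef2 rat) (E4 := Ef4 rat) (E6 := Ef6 rat) :
  [/\ 12%:R * theta E2 = E2 ^+ 2 - E4, 3%:R * theta E4 = E2 * E4 - E6
    & 2%:R * theta E6 = E2 * E6 - E4 ^+ 2].
Proof.
rewrite /E2 /E4 /E6 /Ef2 /Ef4 /Ef6 -/(Sser 1) -/(Sser 3) -/(Sser 5).
rewrite !raddfB !raddfD /= !theta_natM theta1 !add0r.
split.
- have := Sser11; move: (Sser 1) (Sser 3) (theta _) => s1 s3 t H.
  rewrite [LHS](_ : _ = 48%:R * (5%:R * s3 + s1 - 6%:R * t) - 240%:R * s3 - 48%:R * s1); last ring.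
  by rewrite -H; ring.
- have := Sser13; move: (Sser 1) (Sser 3) (Sser 5) (theta _) => s1 s3 s5 t H.
  rewrite [LHS](_ : _ = - 24%:R * (21%:R * s5 + 10%:R * s3 - s1 - 30%:R * t)
    + 504%:R * s5 + 240%:R * s3 - 24%:R * s1); last ring.
  by rewrite -H; ring.
have := Sser15; rewrite Sser7E rmorph_nat.
move: (Sser 1) (Sser 3) (Sser 5) (theta _) => s1 s3 s5 t H.
rewrite [LHS](_ : _ = 24%:R * (27%:R * (s3 + 120%:R * (s3 * s3)) + 21%:R * s5 - 7%:R * s3
   + s1 - 42%:R * t) - 504%:R * s5 + 168%:R * s3 - 24%:R * s1
   - 648%:R * (s3 + 120%:R * (s3 * s3))); last ring.
by rewrite -H; ring.
Qed.

Lemma map_dser (R S : comNzRingType) (phi : {rmorphism R -> S}) s :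
  map_fps phi (dser (fun d => d%:R ^+ s)) = dser (fun d => d%:R ^+ s).
Proof.
apply/fpsP => n; rewrite fcoef_map !dserE /dsum; case: eqP => _; first exact: rmorph0.
by rewrite rmorph_sum; apply: eq_bigr => d _; rewrite rmorphXn rmorph_nat.
Qed.

Section MapEf.
Variables (R S : comNzRingType) (phi : {rmorphism R -> S}).
Lemma map_Ef2 : map_fps phi (Ef2 R) = Ef2 S.
Proof.
rewrite /Ef2 rmorphB rmorphM rmorph1 (rmorph_nat (map_fps phi)).
by congr (_ - _ * _); exact: map_dser.
Qed.
Lemma map_Ef4 : map_fps phi (Ef4 R) = Ef4 S.
Proof.
rewrite /Ef4 rmorphD rmorphM rmorph1 (rmorph_nat (map_fps phi)).
by congr (_ + _ * _); exact: map_dser.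
Qed.
Lemma map_Ef6 : map_fps phi (Ef6 R) = Ef6 S.
Proof.
rewrite /Ef6 rmorphB rmorphM rmorph1 (rmorph_nat (map_fps phi)).
by congr (_ - _ * _); exact: map_dser.
Qed.
End MapEf.

(** Denominators are cleared so that the equations make sense over every ring: proved over the
    rationals, they descend to the integers by injectivity and then map to any commutative ring. *)
Definition ramanujan_ode (R : comNzRingType) : Prop :=
  [/\ 12%:R * theta (Ef2 R) = Ef2 R ^+ 2 - Ef4 R,
      3%:R * theta (Ef4 R) = Ef2 R * Ef4 R - Ef6 R
    & 2%:R * theta (Ef6 R) = Ef2 R * Ef6 R - Ef4 R ^+ 2].

Lemma ramanujan_map (R S : comNzRingType) (phi : {rmorphism R -> S}) :
  ramanujan_ode R -> ramanujan_ode S.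
Proof.
case=> o2 o4 o6; split.
- have := congr1 (map_fps phi) o2.
  by rewrite rmorphM rmorphB rmorphXn (rmorph_nat (map_fps phi)) /= map_fps_theta map_Ef2 map_Ef4.
- have := congr1 (map_fps phi) o4.
  by rewrite rmorphM rmorphB rmorphM (rmorph_nat (map_fps phi)) /= map_fps_theta map_Ef2 map_Ef4 map_Ef6.
- have := congr1 (map_fps phi) o6.
  by rewrite rmorphM rmorphB rmorphM rmorphXn (rmorph_nat (map_fps phi)) /= map_fps_theta map_Ef2 map_Ef4 map_Ef6.
Qed.

Lemma map_fps_inj (R S : comNzRingType) (phi : {rmorphism R -> S}) :
  injective phi -> injective (map_fps phi).
Proof.
move=> phi_inj f g /fpsP eq_fg; apply/fpsP => n; apply: phi_inj.
exact: eq_fg.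
Qed.

Lemma ramanujan_int : ramanujan_ode int.
Proof.
have inj : injective (map_fps (intmul (1 : rat))) by apply: map_fps_inj; exact: intr_inj.
have [o2 o4 o6] := ramanujan_rat.
split; apply: inj.
- by rewrite rmorphM rmorphB rmorphXn (rmorph_nat (map_fps _)) /= map_fps_theta map_Ef2 map_Ef4.
- by rewrite rmorphM rmorphB rmorphM (rmorph_nat (map_fps _)) /= map_fps_theta map_Ef2 map_Ef4 map_Ef6.
- by rewrite rmorphM rmorphB rmorphM rmorphXn (rmorph_nat (map_fps _)) /= map_fps_theta map_Ef2 map_Ef4 map_Ef6.
Qed.

Lemma ramanujan (R : comNzRingType) : ramanujan_ode R.
Proof. exact: ramanujan_map (intmul (1 : R)) ramanujan_int. Qed.

(** * The Ramanujan vector field *)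

Lemma mpoly_gen_ind (R : comNzRingType) n (P : {mpoly R[n]} -> Prop) :
  (forall c, P c%:MP) -> (forall i, P 'X_i) ->
  (forall f g, P f -> P g -> P (f + g)) -> (forall f g, P f -> P g -> P (f * g)) ->
  forall f, P f.
Proof.
move=> PC PX PD PM f; rewrite (mpolyE f).
apply: big_ind; [by rewrite -(mpolyC0 n) | exact: PD | move=> m _].
rewrite -mul_mpolyC; apply: (PM) => //; rewrite mpolyXE_id.
apply: big_ind; [by rewrite -(mpolyC1 n) | exact: (PM) | move=> i _].
by elim: (m i) => [|j IHj]; rewrite ?exprS; [rewrite expr0 -(mpolyC1 n) | exact: (PM)].
Qed.

(** * The p-th iterate of a derivation *)

Section Leibniz.
Variables (A : comNzRingType) (D : {additive A -> A}).
Hypothesis DM : forall f g, D (f * g) = D f * g + f * D g.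

Lemma leibniz n f g :
  iter n D (f * g) = \sum_(i < n.+1) (iter i D f * iter (n - i) D g) *+ 'C(n, i).
Proof.
elim: n => [|n IHn]; first by rewrite big_ord1.
rewrite iterS IHn raddf_sum /=.
under eq_bigr => i _ do rewrite raddfMn /= DM mulrnDl.
rewrite big_split /=; pose F i := (iter i D f * iter (n.+1 - i) D g).
have -> : \sum_(i < n.+1) (iter i D f * D (iter (n - i) D g)) *+ 'C(n, i) =
    \sum_(i < n.+2) F i *+ 'C(n, i).
  rewrite [RHS]big_ord_recr /= bin_small // addr0; apply: eq_bigr => i _.
  by rewrite /F subSn // -ltnS.
have -> : \sum_(i < n.+1) (D (iter i D f) * iter (n - i) D g) *+ 'C(n, i) =
    \sum_(i < n.+1) F i.+1 *+ 'C(n, i).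
  by apply: eq_bigr => i _; rewrite /F subSS.
rewrite [X in _ + X]big_ord_recl [RHS]big_ord_recl /= !bin0 addrCA; congr (_ + _).
by rewrite -big_split; apply: eq_bigr => i _; rewrite /bump /= add1n binS mulrnDr addrC.
Qed.

(** The inner binomial coefficients vanish in characteristic p, so the p-th iterate of a derivation
    is again a derivation. *)
Lemma leibniz_char p f g : p \in [pchar A] ->
  iter p D (f * g) = iter p D f * g + f * iter p D g.
Proof.
case: p => [|q] pA; first by have := pcharf_prime pA.
rewrite leibniz big_ord_recl big_ord_recr /= /bump /= add1n subnn bin0 binn.
rewrite big1 ?add0r => [|i _]; first by rewrite addrC /= !mulr1n.
rewrite -mulr_natr (bin_lt_pcharf_0 pA) ?mulr0 //.
by have := ltn_ord i; lia.
Qed.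
End Leibniz.

Section VectorField.
Variable k : fieldType.
Implicit Types f g : {mpoly k[3]}.
Local Notation x2 := (e2 k).
Local Notation x4 := (e4 k).
Local Notation x6 := (e6 k).
Local Notation d2 := (mderiv (inord 0 : 'I_3)).
Local Notation d4 := (mderiv (inord 1 : 'I_3)).
Local Notation d6 := (mderiv (inord 2 : 'I_3)).

Lemma mderivXU n (i j : 'I_n) : mderiv i ('X_j : {mpoly k[n]}) = (j == i)%:R.
Proof.
rewrite mderivX mnm1E; case: eqP => [->|_]; last by rewrite scale0r.
by rewrite scale1r (_ : (_ - _)%MM = 0%MM) ?mpolyX0 //; apply/mnmP => l; rewrite mnmBE subnn mnm0E.
Qed.

Lemma inord3_eq (i j : nat) : (i < 3)%N -> (j < 3)%N ->
  (inord i == inord j :> 'I_3) = (i == j).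
Proof. by move=> i3 j3; rewrite -val_eqE /= !inordK. Qed.

Lemma mderiv_e : [/\ [/\ d2 x2 = 1, d2 x4 = 0 & d2 x6 = 0],
  [/\ d4 x2 = 0, d4 x4 = 1 & d4 x6 = 0] & [/\ d6 x2 = 0, d6 x4 = 0 & d6 x6 = 1]].
Proof. by rewrite /e2 /e4 /e6 !mderivXU !inord3_eq. Qed.

Lemma ord3_cases (i : 'I_3) : [\/ i = inord 0, i = inord 1 | i = inord 2].
Proof.
case: i => -[|[|[|//]]] lt3; [apply: Or31 | apply: Or32 | apply: Or33];
  by apply: val_inj; rewrite /= inordK.
Qed.

Section Field.
Variables c2 c4 c6 : {mpoly k[3]}.
Local Notation V := (vfield k c2 c4 c6).

Fact vfield_is_additive : additive V.
Proof. by move=> f g; rewrite /vfield !mderivB; ring. Qed.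
HB.instance Definition _ :=
  GRing.isAdditive.Build {mpoly k[3]} {mpoly k[3]} V vfield_is_additive.

Lemma vfieldM f g : V (f * g) = V f * g + f * V g.
Proof. by rewrite /vfield !mderivM; ring. Qed.

Lemma vfieldC c : V c%:MP = 0.
Proof. by rewrite /vfield !mderivC !mulr0 !addr0. Qed.

Lemma vfieldCM c f : V (c%:MP * f) = c%:MP * V f.
Proof. by rewrite vfieldM vfieldC mul0r add0r. Qed.

Lemma vfield_e : [/\ V x2 = c2, V x4 = c4 & V x6 = c6].
Proof.
have [[a1 a2 a3] [b1 b2 b3] [g1 g2 g3]] := mderiv_e.
by rewrite /vfield a1 a2 a3 b1 b2 b3 g1 g2 g3 !(mulr0, mulr1, addr0, add0r).
Qed.
End Field.

Lemma derivation_vfield (D : {mpoly k[3]} -> {mpoly k[3]}) :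
  {morph D : f g / f + g} -> (forall f g, D (f * g) = D f * g + f * D g) -> (forall c, D c%:MP = 0) ->
  forall f, D f = vfield k (D x2) (D x4) (D x6) f.
Proof.
move=> DD DM DC; have [v2 v4 v6] := vfield_e (D x2) (D x4) (D x6).
apply: mpoly_gen_ind => [c | i | f g Df Dg | f g Df Dg].
- by rewrite DC vfieldC.
- by have [] := ord3_cases i => ->.
- by rewrite DD raddfD /= Df Dg.
- by rewrite DM vfieldM Df Dg.
Qed.

(* mnmwgt gives e_2, e_4, e_6 the weights 1, 2, 3: half the modular weights. *)
Local Notation "w .-wt" := (w.-homog for (@mnmwgt 3)) (at level 1).

Lemma mnmwgt3 (m : 'X_{1..3}) :
  mnmwgt m = (m (inord 0) + 2 * m (inord 1) + 3 * m (inord 2))%N.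
Proof.
rewrite /mnmwgt !big_ord_recl big_ord0 addn0 addnA; congr (_ + _ + _)%N.
- by rewrite muln1; congr (m _ : nat); apply: val_inj; rewrite /= inordK.
- by rewrite mulnC; congr (_ * m _)%N; apply: val_inj; rewrite /= inordK.
- by rewrite mulnC; congr (_ * m _)%N; apply: val_inj; rewrite /= inordK.
Qed.

Lemma wt_e : [/\ x2 \is 1.-wt, x4 \is 2.-wt & x6 \is 3.-wt].
Proof. by rewrite /e2 /e4 /e6 !dhomogX /= !mnmwgt1 !inordK. Qed.

Lemma wtC c : (c%:MP : {mpoly k[3]}) \is 0.-wt.
Proof. by rewrite -[c%:MP]mulr1 mul_mpolyC; apply: dhomogZ; exact: dhomog1. Qed.

Lemma mpoly_wt_ind w (P : {mpoly k[3]} -> Prop) :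
  P 0 -> (forall c f, P f -> P (c *: f)) -> (forall f g, P f -> P g -> P (f + g)) ->
  (forall m, mnmwgt m = w -> P 'X_[m]) -> forall f, f \is w.-wt -> P f.
Proof.
move=> P0 PZ PD PX f /dhomogP f_wt; rewrite (mpolyE f) big_seq.
by apply: big_ind => // m /f_wt m_wt; apply: (PZ); apply: PX.
Qed.

(** The variable of index [i] has weight i + 1, so a coefficient of weight i + 2 gives an operator
    raising weights by one, as each term of R does. *)
Lemma mderiv_wt (i : 'I_3) w c f :
  f \is w.-wt -> c \is (i.+2).-wt -> c * mderiv i f \is w.+1.-wt.
Proof.
move=> f_wt c_wt; move: f f_wt; apply: mpoly_wt_ind => [|a f|f g|m m_wt].
- by rewrite mderiv0 mulr0 dhomog0.
- by rewrite mderivZ -scalerAr; apply: dhomogZ.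
- by rewrite mderivD mulrDr; apply: dhomogD.
rewrite mderivX; have [-> | mi0] := posnP (m i).
  by rewrite scale0r mulr0 dhomog0.
rewrite -scalerAr; apply: dhomogZ.
have le_m : (U_(i) <= m)%MM by rewrite lep1mP -lt0n.
have := mnmwgtD (m - U_(i))%MM U_(i)%MM; rewrite submK // mnmwgt1 m_wt => wE.
have -> : w.+1 = (i.+2 + mnmwgt (m - U_(i))%MM)%N by rewrite wE; lia.
by apply: dhomogM => //; rewrite dhomogX.
Qed.

Lemma euler w f : f \is w.-wt ->
  x2 * d2 f + 2%:R * (x4 * d4 f) + 3%:R * (x6 * d6 f) = w%:R * f.
Proof.
have Xd (i : 'I_3) (m : 'X_{1..3}) : 'X_i * mderiv i 'X_[m] = (m i)%:R * 'X_[m] :> {mpoly k[3]}.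
  rewrite mderivX; have [-> | mi0] := posnP (m i); first by rewrite scale0r mulr0 mul0r.
  have le_m : (U_(i) <= m)%MM by rewrite lep1mP -lt0n.
  by rewrite -scalerAr -mpolyXD addmC submK // scaler_nat mulr_natl.
move: f; apply: mpoly_wt_ind => [|a f Hf|f g Hf Hg|m m_wt].
- by rewrite !mderiv0 !mulr0 !addr0.
- rewrite !mderivZ -!mul_mpolyC.
  transitivity (a%:MP * (w%:R * f)); last by ring.
  by rewrite -Hf; move: (a%:MP) (d2 f) (d4 f) (d6 f) => *; ring.
- by rewrite !mderivD [RHS]mulrDr -Hf -Hg; ring.
rewrite /e2 /e4 /e6 !Xd -m_wt mnmwgt3 !natrD; ring.
Qed.

(** * The iterates of R in characteristic p *)

Section Char.
Variable p : nat.
Hypothesis hp5 : (5 <= p)%N.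
Hypothesis hchar : p \in [pchar k].
Local Notation R := (Ramanujan k).

Lemma natr_small (n : nat) : (0 < n < p)%N -> n%:R != 0 :> k.
Proof.
move=> /andP[n0 lt_np]; rewrite -(dvdn_pcharf hchar).
by apply/negP => /(dvdn_leq n0); rewrite leqNgt lt_np.
Qed.

Lemma invnE n : (n%:R : k) != 0 -> n%:R * invn k n = 1.
Proof. by move=> n0; rewrite /invn -mpolyC_nat -mpolyCM divff // mpolyC1. Qed.

Lemma natr12 : (12%:R : k) != 0.
Proof.
by rewrite (_ : 12 = 3 * 4)%N // natrM mulf_neq0 // natr_small //=; exact: leq_trans hp5.
Qed.

(** Bringing all denominators to 12 makes R equal to 1/12 times a field with integral coefficients,
    a form accessible to [ring]. *)
Lemma invn_3_12 : invn k 3 = 4%:R * invn k 12.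
Proof.
have n3 : (3%:R : k) != 0 by apply: natr_small; exact: leq_trans hp5.
transitivity (invn k 3 * (12%:R * invn k 12)).
  by rewrite invnE ?mulr1 // natr12.
transitivity ((3%:R * invn k 3) * (4%:R * invn k 12)); first by ring.
by rewrite invnE // mul1r.
Qed.

Lemma invn_2_12 : invn k 2 = 6%:R * invn k 12.
Proof.
have n2 : (2%:R : k) != 0 by apply: natr_small; exact: leq_trans hp5.
transitivity (invn k 2 * (12%:R * invn k 12)).
  by rewrite invnE ?mulr1 // natr12.
transitivity ((2%:R * invn k 2) * (6%:R * invn k 12)); first by ring.
by rewrite invnE // mul1r.
Qed.

Lemma RamanujanE f : R f = invn k 12 * ((x2 ^+ 2 - x4) * d2 f +
  4%:R * (x2 * x4 - x6) * d4 f + 6%:R * (x2 * x6 - x4 ^+ 2) * d6 f).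
Proof. by rewrite /Ramanujan /vfield invn_3_12 invn_2_12; ring. Qed.

Lemma RamanujanM f g : R (f * g) = R f * g + f * R g.
Proof. exact: vfieldM. Qed.

Lemma RamanujanD f g : R (f + g) = R f + R g.
Proof. exact: (raddfD (vfield k _ _ _)). Qed.

Lemma Ramanujan_invn n f : R (invn k n * f) = invn k n * R f.
Proof. exact: vfieldCM. Qed.

Lemma Ramanujan_invnX n j f : R (invn k n ^+ j * f) = invn k n ^+ j * R f.
Proof. by rewrite /invn -(rmorphXn (@mpolyC 3 k)); exact: vfieldCM. Qed.

Lemma Ramanujan_nat n f : R (n%:R * f) = n%:R * R f.
Proof. by rewrite -mpolyC_nat; exact: vfieldCM. Qed.

Lemma Ramanujan_wt w f : f \is w.-wt -> R f \is w.+1.-wt.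
Proof.
have [w2 w4 w6] := wt_e => f_wt; rewrite RamanujanE.
have wtI : invn k 12 \is 0.-wt by exact: wtC.
have wtn n : (n%:R : {mpoly k[3]}) \is 0.-wt by rewrite -mpolyC_nat wtC.
have inord_val j : (j < 3)%N -> (inord j : 'I_3) = j :> nat by move=> j3; rewrite inordK.
have wtM0 c g v : c \is 0.-wt -> g \is v.-wt -> c * g \is v.-wt.
  by move=> c_wt g_wt; apply: (@dhomogM _ _ _ 0 _ v).
apply: (wtM0) => //; do 2?apply: dhomogD; apply: mderiv_wt => //; rewrite inord_val //.
- by apply: rpredB => //; exact: (dhomogMn 2 w2).
- by apply: (wtM0) => //; apply: rpredB => //; exact: (dhomogM w2 w4).
apply: (wtM0) => //; apply: rpredB; first exact: (dhomogM w2 w6).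
exact: (dhomogMn 2 w4).
Qed.

Lemma iter_Ramanujan_wt n w f : f \is w.-wt -> iter n R f \is (n + w).-wt.
Proof. by move=> f_wt; elim: n => [|n IHn] //=; rewrite addSn; apply: Ramanujan_wt. Qed.

(* [F, R] is proportional to the Euler field H, which acts by weights. *)
Lemma d2_Ramanujan w f : f \is w.-wt ->
  d2 (R f) = R (d2 f) + invn k 12 * ((2 * w)%:R * f).
Proof.
move=> f_wt; have [[a1 a2 a3] [b1 b2 b3] [g1 g2 g3]] := mderiv_e.
have dA : d2 (x2 ^+ 2 - x4) = 2%:R * x2 by rewrite mderivB expr2 mderivM a1 a2; ring.
have dB : d2 (x2 * x4 - x6) = x4 by rewrite mderivB mderivM a1 a2 a3; ring.
have dC : d2 (x2 * x6 - x4 ^+ 2) = x6.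
  by rewrite mderivB expr2 !mderivM a1 a2 a3; ring.
have dn n : d2 (n%:R) = 0 by rewrite -mpolyC_nat mderivC.
have d24 g : d2 (d4 g) = d4 (d2 g) by exact: mderiv_comm.
have d26 g : d2 (d6 g) = d6 (d2 g) by exact: mderiv_comm.
rewrite !RamanujanE natrM -[2%:R * _ * f]mulrA -(euler f_wt).
move: dA dB dC; move: (_ - _) (_ - _) (_ - _) => A B C dA dB dC.
rewrite mderiv_mulC !mderivD !mderivM dA dB dC !dn d24 d26.
ring.
Qed.

(** R^i f has weight w + i, so the commutators contribute the sum of 2(w + i) over i < n, which is
    n(2w + n - 1). *)
Lemma d2_iter_Ramanujan n w f : f \is w.-wt ->
  d2 (iter n R f) = iter n R (d2 f) +
    invn k 12 * ((n * (2 * w + n.-1))%:R * iter n.-1 R f).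
Proof.
move=> f_wt; elim: n => [|n IHn] /=; first by rewrite mul0n mul0r mulr0 addr0.
rewrite (d2_Ramanujan (iter_Ramanujan_wt n f_wt)) IHn RamanujanD -addrA; congr (_ + _).
rewrite Ramanujan_invn Ramanujan_nat -mulrDr; congr (_ * _).
case: n {IHn} => [|n] /=; first by rewrite !mul0n mul0r add0r mul1n addn0.
by rewrite -mulrDl -natrD; congr (_%:R * _); lia.
Qed.

Lemma mpoly_pchar : p \in [pchar {mpoly k[3]}].
Proof.
rewrite inE (pcharf_prime hchar) /= -mpolyC_nat mpolyC_eq0.
by rewrite (pcharf0 hchar).
Qed.

Lemma d2_iterp_Ramanujan w f : f \is w.-wt ->
  d2 (iter p R f) = iter p R (d2 f).
Proof.
move=> f_wt; rewrite (d2_iter_Ramanujan p f_wt) natrM (pcharf0 mpoly_pchar).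
by rewrite !mul0r mulr0 addr0.
Qed.

Lemma iterp_RamanujanE f : iter p R f =
  vfield k (iter p R x2) (iter p R x4) (iter p R x6) f.
Proof.
apply: (@derivation_vfield (iter p R)) => [g h|g h|c].
- by elim: p => //= n ->; rewrite RamanujanD.
- exact: (@leibniz_char _ (vfield k _ _ _) (vfieldM _ _ _) _ _ _ mpoly_pchar).
have RC : R c%:MP = 0 by exact: vfieldC.
have R0 : R 0 = 0 by exact: (raddf0 (vfield k _ _ _)).
rewrite -(prednK (prime_gt0 (pcharf_prime hchar))).
by elim: p.-1 => // n IHn; rewrite iterS IHn.
Qed.

Local Notation i12 := (invn k 12).

Lemma Ramanujan_e : [/\ R x2 = i12 * (x2 ^+ 2 - x4), R x4 = i12 * (4%:R * (x2 * x4 - x6))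
  & R x6 = i12 * (6%:R * (x2 * x6 - x4 ^+ 2))].
Proof.
rewrite /Ramanujan; have [-> -> ->] := vfield_e (i12 * (x2 ^+ 2 - x4)) (invn k 3 * (x2 * x4 - x6))
  (invn k 2 * (x2 * x6 - x4 ^+ 2)).
by rewrite invn_3_12 invn_2_12; split; ring.
Qed.

(** Only the behaviour modulo e_4 matters below, so the cofactor [u] is left unspecified. *)
Lemma Ramanujan_pow2 n : exists u, R (x2 ^+ n) = i12 * (n%:R * x2 ^+ n.+1) + u * x4.
Proof.
have [r2 _ _] := Ramanujan_e.
elim: n => [|n [u IHn]].
  exists 0; rewrite expr0 mul0r mulr0 mul0r addr0 -(mpolyC1 3); exact: vfieldC.
exists (- i12 * x2 ^+ n + x2 * u).
by rewrite exprS RamanujanM IHn r2 -[n.+1%:R]natr1 !exprS; ring.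
Qed.

Lemma rising_pchar a : \prod_(j < p) (a + j)%:R = 0 :> k.
Proof.
have p0 := prime_gt0 (pcharf_prime hchar).
(* This index makes a + j divisible by p; the outer reduction covers the case where p divides a. *)
have lt_j : (((p - a %% p) %% p) < p)%N by rewrite ltn_mod.
rewrite (bigD1 (Ordinal lt_j)) //= [X in X * _](_ : _ = 0) ?mul0r //.
apply/eqP; rewrite -(dvdn_pcharf hchar) /dvdn modnDmr -modnDml.
by rewrite subnKC ?modnn // ltnW ?ltn_mod.
Qed.

(** The ideal (e_4^2, e_6) is stable under R. Modulo it, R multiplies e_2^n e_4 by (n + 4) e_2 / 12,
    with n coming from e_2^n and 4 from e_4. *)
Lemma iter_Ramanujan_e4 n : exists a b, iter n R x4 =
  i12 ^+ n * ((\prod_(j < n) (4 + j)%:R)%:MP * (x2 ^+ n * x4)) + a * x4 ^+ 2 + b * x6.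
Proof.
have [r2 r4 r6] := Ramanujan_e.
elim: n => [|n [a [b IHn]]].
  by exists 0, 0; rewrite big_ord0 mpolyC1 !mul0r !addr0 expr0 !mul1r.
have [u Hu] := Ramanujan_pow2 n.
have Rc c f : R (i12 ^+ n * (c%:MP * f)) = i12 ^+ n * (c%:MP * R f).
  by rewrite Ramanujan_invnX; congr (_ * _); exact: vfieldCM.
rewrite iterS IHn !RamanujanD Rc !RamanujanM Hu r4 r6.
rewrite big_ord_recr /= mpolyCM mpolyC_nat natrD.
move: (_%:MP) (R a) (R b) => c Ra Rb.
exists (i12 ^+ n * (c * u) + Ra + a * i12 * 8%:R * x2 - b * i12 * 6%:R).
exists (- (i12 ^+ n * (c * (x2 ^+ n * (i12 * 4%:R)))) - a * 8%:R * i12 * x4 + Rb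
  + b * i12 * 6%:R * x2).
by rewrite !exprS; ring.
Qed.

(** The same computation modulo the square of the ideal (e_4, e_6), which is stable under R: there R
    multiplies e_2^n e_6 by (n + 6) e_2 / 12. *)
Lemma iter_Ramanujan_e6 n : exists a b c, iter n R x6 =
  i12 ^+ n * ((\prod_(j < n) (6 + j)%:R)%:MP * (x2 ^+ n * x6)) + a * x4 ^+ 2
  + b * x4 * x6 + c * x6 ^+ 2.
Proof.
have [r2 r4 r6] := Ramanujan_e.
elim: n => [|n [a [b [c IHn]]]].
  by exists 0, 0, 0; rewrite big_ord0 mpolyC1 !mul0r !addr0 expr0 !mul1r.
have [u Hu] := Ramanujan_pow2 n.
have Rc d f : R (i12 ^+ n * (d%:MP * f)) = i12 ^+ n * (d%:MP * R f).
  by rewrite Ramanujan_invnX; congr (_ * _); exact: vfieldCM.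
rewrite iterS IHn !RamanujanD Rc !RamanujanM Hu r4 r6.
rewrite big_ord_recr /= mpolyCM mpolyC_nat natrD.
move: (_%:MP) (R a) (R b) (R c) => d Ra Rb Rc'.
exists (- (i12 ^+ n * (d * (x2 ^+ n * (i12 * 6%:R)))) + Ra + a * 8%:R * i12 * x2
  - b * i12 * 6%:R * x4 - c * 12%:R * i12 * x6).
exists (i12 ^+ n * d * u - a * 8%:R * i12 + Rb + b * 10%:R * i12 * x2).
exists (- b * 4%:R * i12 + Rc' + c * 12%:R * i12 * x2).
by rewrite !exprS; ring.
Qed.

Lemma mcoeff_mulX_small (i : 'I_3) j g (m : 'X_{1..3}) : (m i < j)%N -> (g * 'X_i ^+ j)@_m = 0.
Proof.
move=> lt_mj; apply: memN_msupp_eq0; apply/negP.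
rewrite mpolyXn (perm_mem (msuppMX _ _)) => /mapP[m' _ def_m].
by move: lt_mj; rewrite def_m mnmDE mulmnE mnm1E eqxx mul1n ltnNge leq_addr.
Qed.

Definition e2_free f := forall m : 'X_{1..3}, m \in msupp f -> m (inord 0) = 0%N.

Lemma d2_eq0_dvd f (m : 'X_{1..3}) : d2 f = 0 -> m \in msupp f -> (p %| m (inord 0))%N.
Proof.
move=> df0 m_f; have [-> | m0] := posnP (m (inord 0)); first exact: dvdn0.
have le_m : (U_(inord 0) <= m)%MM by rewrite lep1mP -lt0n.
have := mcoeff_deriv (inord 0) (m - U_(inord 0))%MM f.
rewrite df0 mcoeff0 submK // mnmBE mnm1E eqxx subn1 prednK // => /esym/eqP.
rewrite -mulr_natr mulf_eq0 (dvdn_pcharf hchar) => /orP[|->//].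
by move: m_f; rewrite mcoeff_msupp => /negP.
Qed.

(* By d2_eq0_dvd, e_2 can only occur through e_2^p. *)
Lemma e2_free_of_wt w f : (w <= 3)%N -> f \is (p + w).-wt -> d2 f = 0 ->
  (forall m : 'X_{1..3}, m (inord 0) = p -> (2 * m (inord 1) + 3 * m (inord 2) = w)%N -> f@_m = 0) ->
  e2_free f.
Proof.
move=> w3 /dhomogP f_wt df0 f0 m m_f.
have := f_wt m m_f; rewrite /= mnmwgt3 => mw.
have /dvdnP[q mq] := d2_eq0_dvd df0 m_f.
case: q mq => [|[|q]] mq; first by rewrite mq.
  have m0 : m (inord 0) = p by rewrite mq mul1n.
  have m12 : (2 * m (inord 1) + 3 * m (inord 2) = w)%N by move: mw; rewrite m0; lia.
  by move: m_f; rewrite mcoeff_msupp (f0 _ m0 m12) eqxx.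
(* A factor e_2^(2p) would exceed the weight, since p + w < 2p. *)
by exfalso; move: mw; rewrite mq !mulSn; lia.
Qed.

Lemma iterp_Ramanujan_free :
  [/\ e2_free (iter p R x2), e2_free (iter p R x4) & e2_free (iter p R x6)].
Proof.
have [w2 w4 w6] := wt_e; have [[a1 a2 a3] _ _] := mderiv_e.
have d2p w f : f \is w.-wt -> d2 f = 0 -> d2 (iter p R f) = 0.
  move=> fw df0; rewrite (d2_iterp_Ramanujan fw) df0.
  by elim: p => //= n ->; exact: (raddf0 (vfield k _ _ _)).
have m1E (m : 'X_{1..3}) : (2 * m (inord 1) + 3 * m (inord 2) = 2)%N ->
    m (inord 1) = 1%N /\ m (inord 2) = 0%N by lia.
have m2E (m : 'X_{1..3}) : (2 * m (inord 1) + 3 * m (inord 2) = 3)%N ->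
    m (inord 1) = 0%N /\ m (inord 2) = 1%N by lia.
split.
(* In weight p + 1 a factor e_2^p would leave a monomial of weight 1 in e_4 and e_6, and there is
   none. *)
- apply: (@e2_free_of_wt 1); rewrite ?iter_Ramanujan_wt //; last by move=> m _; lia.
  rewrite (d2_iterp_Ramanujan w2) a1 -(prednK (prime_gt0 (pcharf_prime hchar))).
  elim: p.-1 => [|n IHn]; last by rewrite iterS IHn; exact: (raddf0 (vfield k _ _ _)).
  by rewrite /= -(mpolyC1 3); exact: vfieldC.
- apply: (@e2_free_of_wt 2); rewrite ?iter_Ramanujan_wt ?(d2p _ _ w4) // => m _ /m1E[m1 m2].
  have [a [b ->]] := iter_Ramanujan_e4 p.
  rewrite rising_pchar mpolyC0 mul0r mulr0 add0r mcoeffD.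
  by rewrite (mcoeff_mulX_small (j := 2)) ?m1 // -[x6]expr1 mcoeff_mulX_small ?m2 ?addr0.
apply: (@e2_free_of_wt 3); rewrite ?iter_Ramanujan_wt ?(d2p _ _ w6) // => m _ /m2E[m1 m2].
have [a [b [c ->]]] := iter_Ramanujan_e6 p.
rewrite rising_pchar mpolyC0 mul0r mulr0 add0r !mcoeffD.
rewrite (mcoeff_mulX_small (j := 2)) ?m1 // (mcoeff_mulX_small (j := 2)) ?m2 //.
by rewrite mulrAC -[x4]expr1 mcoeff_mulX_small ?m1 ?addr0.
Qed.

End Char.
End VectorField.

(** * Expansions in characteristic p *)

Section Coefs01.
Variable R : comNzRingType.
Lemma fcoefM1 (f g : fps R) : (f * g) 1%N = f 0%N * g 1%N + f 1%N * g 0%N.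
Proof. by rewrite fcoefM big_ord_recr big_ord1. Qed.

Lemma dser01 s : dser (fun d => d%:R ^+ s : R) 0 = 0 /\ dser (fun d => d%:R ^+ s : R) 1 = 1.
Proof. by split=> //; rewrite dserE /dsum /= big_seq1 expr1n. Qed.

Lemma Ef4_01 : Ef4 R 0%N = 1 /\ Ef4 R 1%N = 240%:R.
Proof.
have [d0 d1] := dser01 3.
by rewrite !fcoefD -(rmorph_nat (@fpsC R)) !fcoefCM d0 d1 !fcoef1 mulr0 mulr1 addr0 add0r.
Qed.

Lemma Ef6_01 : Ef6 R 0%N = 1 /\ Ef6 R 1%N = - 504%:R.
Proof.
have [d0 d1] := dser01 5.
by rewrite !fcoefB -(rmorph_nat (@fpsC R)) !fcoefCM d0 d1 !fcoef1 mulr0 mulr1 subr0 sub0r.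
Qed.

Lemma discriminant01 (D := Ef4 R ^+ 3 - Ef6 R ^+ 2) : D 0%N = 0 /\ D 1%N = 1728%:R.
Proof.
have [a0 a1] := Ef4_01; have [b0 b1] := Ef6_01; rewrite /D !fcoefB; split.
  by rewrite !fcoefX0 a0 b0 !expr1n subrr.
rewrite 2!exprS expr1 expr2 !(fcoefM1, fcoefM0) a0 a1 b0 b1.
rewrite !mul1r !mulr1 opprD !opprK -!natrD; congr _%:R; lia.
Qed.
End Coefs01.

(** E_4^3 - E_6^2 starts with 1728 q, where 1728 = 3 * 240 + 2 * 504. The hypothesis is met both
    over the rationals and in characteristic p >= 5. *)
Lemma discriminant_mul_eq0 (k : fieldType) (f : fps k) : (1728%:R : k) != 0 ->
  (Ef4 k ^+ 3 - Ef6 k ^+ 2) * f = 0 -> f = 0.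
Proof.
move=> n1728 /fps_mulf_eq0; apply; apply: contra_neq n1728 => D0.
by have [_ <-] := discriminant01 k; rewrite D0.
Qed.

(** * Isobaric polynomials in e_4 and e_6 and their q-expansions *)

Section Homogeneous.
Variable k : fieldType.
Implicit Types f g : {mpoly k[3]}.
Local Notation x2 := (e2 k).
Local Notation x4 := (e4 k).
Local Notation x6 := (e6 k).
Local Notation "w .-wt" := (w.-homog for (@mnmwgt 3)) (at level 1).

(** These are the isobaric polynomials in e_4 and e_6, kept inside k[e_2, e_4, e_6] so that they can
    be compared directly with the components of R^p. *)
Definition modular w f := f \is w.-wt /\ e2_free f.

Lemma modular0 w : modular w 0.
Proof. by split; [exact: dhomog0 | move=> m; rewrite msupp0]. Qed.

Lemma modularD w f g : modular w f -> modular w g -> modular w (f + g).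
Proof.
move=> [wf ff] [wg fg]; split; first exact: dhomogD.
by move=> m /msuppD_le; rewrite mem_cat => /orP[/ff | /fg].
Qed.

Lemma modularZ w c f : modular w f -> modular w (c *: f).
Proof. by move=> [wf ff]; split; [exact: dhomogZ | move=> m /msuppZ_le/ff]. Qed.

Lemma modularB w f g : modular w f -> modular w g -> modular w (f - g).
Proof. by move=> mf mg; rewrite -scaleN1r; apply: modularD => //; apply: modularZ. Qed.

Lemma modularM v w f g : modular v f -> modular w g -> modular (v + w) (f * g).
Proof.
move=> [wf ff] [wg fg]; split; first exact: dhomogM.
by move=> m /msuppM_le/allpairsP[[m1 m2] [/= /ff m1_0 /fg m2_0 ->]]; rewrite mnmDE m1_0 m2_0.
Qed.

Lemma modularC c : modular 0 c%:MP.
Proof.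
split; first exact: wtC.
by move=> m; rewrite msuppC; case: eqP => //= _; rewrite inE => /eqP->; rewrite mnm0E.
Qed.

Lemma modular_e4 : modular 2 x4.
Proof.
have [_ w4 _] := wt_e k; split=> // m.
by rewrite /e4 msuppX inE => /eqP->; rewrite mnm1E inord3_eq.
Qed.

Lemma modular_e6 : modular 3 x6.
Proof.
have [_ _ w6] := wt_e k; split=> // m.
by rewrite /e6 msuppX inE => /eqP->; rewrite mnm1E inord3_eq.
Qed.

Lemma modularX w n f : modular w f -> modular (n * w) (f ^+ n).
Proof.
move=> mf; elim: n => [|n IHn]; first by rewrite expr0 -(mpolyC1 3); exact: modularC.
by rewrite exprS mulSn; apply: modularM.
Qed.

Lemma modular_ind w (P : {mpoly k[3]} -> Prop) :
  P 0 -> (forall c f, P f -> P (c *: f)) -> (forall f g, P f -> P g -> P (f + g)) ->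
  (forall a b, (2 * a + 3 * b)%N = w -> P (x4 ^+ a * x6 ^+ b)) ->
  forall f, modular w f -> P f.
Proof.
move=> P0 PZ PD PX f [/dhomogP f_wt f_free]; rewrite (mpolyE f) big_seq.
apply: big_ind => // m m_f; apply: (PZ).
have m0 := f_free m m_f; have := f_wt m m_f; rewrite /= mnmwgt3 m0 add0n => m_wt.
have -> : 'X_[m] = x4 ^+ m (inord 1) * x6 ^+ m (inord 2); last exact: PX.
rewrite mpolyXE_id !big_ord_recl big_ord0 mulr1.
have o0 : ord0 = inord 0 :> 'I_3 by apply: val_inj; rewrite /= inordK.
have o1 : lift ord0 ord0 = inord 1 :> 'I_3 by apply: val_inj; rewrite /= inordK.
have o2 : lift ord0 (lift ord0 ord0) = inord 2 :> 'I_3 by apply: val_inj; rewrite /= inordK.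
by rewrite o1 o2 o0 m0 expr0 mul1r.
Qed.

Let Delta := x4 ^+ 3 - x6 ^+ 2.

(** The factor e_6^2 is replaced [t] times by e_4^3 - Delta. For w < 6 the truncated [w - 6] is 0, a
    weight that admits constants; hence the separate clause h = 0. *)
Lemma modular_monomial w i t c : (c < 2)%N -> (2 * i + 3 * (c + 2 * t) = w)%N ->
  exists2 h, modular (w - 6) h /\ ((w < 6)%N -> h = 0) &
  x4 ^+ i * x6 ^+ (c + 2 * t) = x4 ^+ (i + 3 * t) * x6 ^+ c + Delta * h.
Proof.
move=> c2; elim: t i => [|t IHt] i wE.
  by exists 0; rewrite ?mulr0 ?addr0 ?addn0 //; split=> //; exact: modular0.
have wE' : (2 * (i + 3) + 3 * (c + 2 * t) = w)%N by lia.
have [h [mh h0] hE] := IHt _ wE'.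
exists (h - x4 ^+ i * x6 ^+ (c + 2 * t)).
  split=> [|w6]; last by move: wE'; lia.
  apply: modularB => //.
  have -> : (w - 6 = i * 2 + (c + 2 * t) * 3)%N by move: wE'; lia.
  by apply: modularM; apply: modularX; [exact: modular_e4 | exact: modular_e6].
have -> : (i + 3 * t.+1 = i + 3 + 3 * t)%N by lia.
have -> : (c + 2 * t.+1 = c + 2 * t + 2)%N by lia.
rewrite mulrBr addrA -hE /Delta; move: (c + 2 * t)%N => n.
by rewrite !exprD; ring.
Qed.

(** The exponent of e_6 has the parity of w, so modulo Delta at most one monomial of each weight
    remains, with exponent [b] equal to 0 or 1. *)
Lemma modular_decomp w f : modular w f -> exists a b c h,
  [/\ modular (w - 6) h, (w < 6)%N -> h = 0 &
      f = c *: (x4 ^+ a * x6 ^+ b) + Delta * h].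
Proof.
pose b := (w %% 2)%N; pose a := ((w - 3 * b) %/ 2)%N.
move=> mf; exists a, b; move: f mf; apply: modular_ind => [|c f|f g|i j wE].
- exists 0, 0; split=> //; first exact: modular0.
  by rewrite scale0r mulr0 addr0.
- move=> [c1 [h [mh h0 ->]]]; exists (c * c1), (c *: h); split; first exact: modularZ.
    by move=> /h0->; rewrite scaler0.
  by rewrite scalerDr scalerA -scalerAr.
- move=> [c1 [h1 [mh1 h10 ->]]] [c2 [h2 [mh2 h20 ->]]].
  exists (c1 + c2), (h1 + h2); split; first exact: modularD.
    by move=> w6; rewrite h10 ?h20 ?addr0.
  by rewrite scalerDl mulrDr addrACA.
have b2 : (b < 2)%N by rewrite ltn_mod.
have jE : j = (b + 2 * (j %/ 2))%N by rewrite /b -wE; lia.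
have wE' : (2 * i + 3 * (b + 2 * (j %/ 2)) = w)%N by rewrite -jE.
have [h [mh h0] hE] := modular_monomial b2 wE'.
exists 1, h; split=> //; rewrite scale1r jE hE; congr (_ ^+ _ * _ + _).
by rewrite /a; lia.
Qed.

Definition qexp_var (i : 'I_3) : fps k :=
  if i == inord 0 then Ef2 k else if i == inord 1 then Ef4 k else Ef6 k.
Definition qexp : {rmorphism {mpoly k[3]} -> fps k} := mmap (@fpsC k) qexp_var.

Lemma qexpC c : qexp c%:MP = fpsC c. Proof. exact: mmapC. Qed.

Lemma qexp_e : [/\ qexp x2 = Ef2 k, qexp x4 = Ef4 k & qexp x6 = Ef6 k].
Proof. by rewrite /qexp /e2 /e4 /e6 /= !mmapX !mmap1U /qexp_var !inord3_eq. Qed.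

(** E_4 and E_6 have constant term 1 and Delta has constant term 0, so the constant term of the
    expansion of f is the coefficient [c] of its only monomial modulo Delta. If it vanishes, f is
    Delta times a form of weight lower by 6, and Delta can be cancelled. *)
Lemma qexp_inj w f : (1728%:R : k) != 0 -> modular w f -> qexp f = 0 -> f = 0.
Proof.
move=> n1728; have [m] := ubnP w; elim: m w f => // m IHm w f lt_wm mf qf0.
have [a [b [c [h [mh h0 fE]]]]] := modular_decomp mf.
have [_ q4 q6] := qexp_e.
have [a0 _] := Ef4_01 k; have [b0 _] := Ef6_01 k; have [D0 _] := discriminant01 k.
move: qf0; rewrite fE -mul_mpolyC rmorphD !rmorphM !rmorphXn rmorphB !rmorphXn q4 q6 qexpC => q0.
have c0 : c = 0.
  have := congr1 (fun s : fps k => s 0%N) q0.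
  by rewrite fcoefD fcoefCM !fcoefM0 !fcoefX0 a0 b0 !expr1n !mulr1 D0 mul0r addr0.
move: q0; rewrite c0 rmorph0 mul0r add0r => /(discriminant_mul_eq0 n1728) qh0.
rewrite mpolyC0 mul0r add0r; have [/h0->|le_6w] := ltnP w 6; first by rewrite mulr0.
by rewrite (IHm (w - 6)%N h) ?mulr0 //; lia.
Qed.

Section Char.
Variable p : nat.
Hypothesis hp5 : (5 <= p)%N.
Hypothesis hchar : p \in [pchar k].
Local Notation R := (Ramanujan k).

Lemma natr1728 : (1728%:R : k) != 0.
Proof.
have [n2 n3] : (2%:R : k) != 0 /\ (3%:R : k) != 0.
  by split; apply: (natr_small hchar); apply: leq_trans hp5.
have -> : (1728%:R : k) = 2%:R ^+ 6 * 3%:R ^+ 3 by ring.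
by rewrite mulf_neq0 ?expf_neq0.
Qed.

Lemma qexp_Ramanujan f : qexp (R f) = theta (qexp f).
Proof.
have [r2 r4 r6] := Ramanujan_e hp5 hchar.
have [q2 q4 q6] := qexp_e; have [o2 o4 o6] := ramanujan k.
have n12 : fpsC ((12%:R : k)^-1) * 12%:R = 1.
  by rewrite -(rmorph_nat (@fpsC k)) -(rmorphM (@fpsC k)) mulVf ?rmorph1 // (natr12 hp5 hchar).
move: f; apply: mpoly_gen_ind => [c|i|f g qf qg|f g qf qg].
- by rewrite (_ : R c%:MP = 0) ?rmorph0 ?qexpC ?thetaC //; exact: vfieldC.
- have [] := ord3_cases i => ->.
  + rewrite -/(e2 k) r2 q2 rmorphM rmorphB rmorphXn q2 q4 /invn qexpC -o2.
    by rewrite mulrA n12 mul1r.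
  + rewrite -/(e4 k) r4 q4 rmorphM rmorphM rmorphB rmorphM q2 q4 q6 /invn qexpC -o4.
    rewrite (rmorph_nat qexp); transitivity (fpsC (12%:R : k)^-1 * 12%:R * theta (Ef4 k)); first by ring.
    by rewrite n12 mul1r.
  rewrite -/(e6 k) r6 q6 rmorphM rmorphM rmorphB rmorphM rmorphXn q2 q4 q6 /invn qexpC -o6.
  rewrite (rmorph_nat qexp); transitivity (fpsC (12%:R : k)^-1 * 12%:R * theta (Ef6 k)); first by ring.
  by rewrite n12 mul1r.
- by rewrite RamanujanD (rmorphD qexp (R f)) (rmorphD qexp f) qf qg raddfD.
by rewrite RamanujanM (rmorphD qexp (R f * g)) (rmorphM qexp (R f)) (rmorphM qexp f)
  (rmorphM qexp f) qf qg thetaM.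
Qed.

Lemma natr_expp d : d%:R ^+ p = d%:R :> k.
Proof. by rewrite -(pFrobenius_autE hchar) pFrobenius_aut_nat. Qed.

Lemma theta_iter_char (f : fps k) : iter p (@theta k) f = theta f.
Proof.
by apply/fpsP => n; rewrite theta_iter fcoef_theta natr_expp.
Qed.

Lemma qexp_iterp f : qexp (iter p R f) = theta (qexp f).
Proof.
rewrite -theta_iter_char; elim: p => //= n <-.
exact: qexp_Ramanujan.
Qed.

Lemma iterp_Ramanujan_modular : [/\ modular (p + 1) (iter p R x2),
  modular (p + 2) (iter p R x4) & modular (p + 3) (iter p R x6)].
Proof.
have [w2 w4 w6] := wt_e k; have [f2 f4 f6] := iterp_Ramanujan_free hp5 hchar.
by split; split=> //; apply: (iter_Ramanujan_wt hp5 hchar).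
Qed.

(* On q-expansions R acts as q d/dq, so R^p acts as R does; A = 1 and B = E_2
   there.  Both sides of each identity being isobaric and free of e_2, equality
   of q-expansions is equality. *)
Lemma Ramanujan_pth_power (A B : {mpoly k[3]}) w : (2 * w + 1)%N = p ->
  modular w A -> modular w.+1 B -> qexp A = 1 -> qexp B = Ef2 k ->
  forall f, iter p R f =
    vfield k (invn k 12 * (B ^+ 2 - x4 * A ^+ 2))
             (invn k 3 * (A * (x4 * B - x6 * A)))
             (invn k 2 * (A * (x6 * B - x4 ^+ 2 * A))) f.
Proof.
move=> wE mA mB qA qB f; rewrite (iterp_RamanujanE hchar).
have [m2 m4 m6] := iterp_Ramanujan_modular.
have [q2 q4 q6] := qexp_e; have [r2 r4 r6] := Ramanujan_e hp5 hchar.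
have mC n v g : modular v g -> modular v (invn k n * g).
  by move=> mg; rewrite -[v]add0n; apply: modularM => //; exact: modularC.
have eq_of g h v u : modular v g -> modular v h -> qexp g = theta (qexp u) ->
    qexp h = qexp (R u) -> g = h.
  move=> mg mh qg qh; apply/eqP; rewrite -subr_eq0; apply/eqP.
  apply: (qexp_inj natr1728 (modularB mg mh)).
  by rewrite rmorphB qg qh qexp_Ramanujan subrr.
congr (vfield k _ _ _ f).
- apply: (eq_of _ _ (p + 1)%N x2) => //; last first.
  + rewrite r2 !(rmorphM qexp) !(rmorphB qexp) !(rmorphXn qexp, rmorphM qexp) qA qB q2 q4.
    ring.
  + exact: qexp_iterp.
  apply: mC; apply: modularB.
    have -> : (p + 1 = 2 * w.+1)%N by lia.
    exact: modularX.
  have -> : (p + 1 = 2 + 2 * w)%N by lia.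
  by apply: modularM; [exact: modular_e4 | exact: modularX].
- apply: (eq_of _ _ (p + 2)%N x4) => //; last first.
  + rewrite /Ramanujan; have [_ -> _] := vfield_e (invn k 12 * (x2 ^+ 2 - x4))
      (invn k 3 * (x2 * x4 - x6)) (invn k 2 * (x2 * x6 - x4 ^+ 2)).
    rewrite !(rmorphM qexp) !(rmorphB qexp) !(rmorphM qexp) qA qB q2 q4 q6.
    ring.
  + exact: qexp_iterp.
  apply: mC; have -> : (p + 2 = w + (w + 3))%N by lia.
  apply: modularM => //; apply: modularB.
    have -> : (w + 3 = 2 + w.+1)%N by lia.
    by apply: modularM => //; exact: modular_e4.
  by rewrite addnC; apply: modularM => //; exact: modular_e6.
apply: (eq_of _ _ (p + 3)%N x6) => //; last first.
+ rewrite /Ramanujan; have [_ _ ->] := vfield_e (invn k 12 * (x2 ^+ 2 - x4))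
    (invn k 3 * (x2 * x4 - x6)) (invn k 2 * (x2 * x6 - x4 ^+ 2)).
  rewrite !(rmorphM qexp) !(rmorphB qexp) !(rmorphXn qexp, rmorphM qexp) qA qB q2 q4 q6.
  ring.
+ exact: qexp_iterp.
apply: mC; have -> : (p + 3 = w + (w + 4))%N by lia.
apply: modularM => //; apply: modularB.
  have -> : (w + 4 = 3 + w.+1)%N by lia.
  by apply: modularM => //; exact: modular_e6.
have -> : (w + 4 = 2 * 2 + w)%N by lia.
by apply: modularM => //; apply: modularX; exact: modular_e4.
Qed.

End Char.
End Homogeneous.

(** * Reduction of p-integral rational numbers *)

Section Reduction.
Variable k : fieldType.
Local Notation red := (redr k).

(* [redr k x] is a junk value (a division by 0) outside [pint]. *)
Definition pint : pred rat := fun x => (denq x)%:~R != 0 :> k.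

(** The denominator in lowest terms divides any d such that x d is an integer, so [red] may be
    computed from any fraction whose denominator is nonzero in k. *)
Lemma pint_frac (x : rat) (a d : int) : d%:~R != 0 :> k -> x * d%:~R = a%:~R ->
  x \in pint /\ red x * d%:~R = a%:~R.
Proof.
move=> kd0 xd; have xE : numq x * d = a * denq x.
  apply: (@intr_inj rat); rewrite !rmorphM /= -xd numqE.
  by rewrite mulrAC.
have /dvdzP[e dE] : (denq x %| d)%Z.
  rewrite -(@Gauss_dvdzr (denq x) (numq x)); last first.
    by rewrite coprimezE coprime_sym coprime_num_den.
  by rewrite xE dvdz_mull.
have kx0 : (denq x)%:~R != 0 :> k.
  by apply: contra_neq kd0; rewrite dE rmorphM /= => ->; rewrite mulr0.
split; first by [].
rewrite /redr /ratr mulrAC; apply: (canLR (mulfK kx0)).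
by rewrite -!rmorphM /= xE.
Qed.

Lemma pintP x : x \in pint ->
  exists a d : int, [/\ d%:~R != 0 :> k, x * d%:~R = a%:~R & red x * d%:~R = a%:~R].
Proof.
move=> px; exists (numq x), (denq x); split=> //; first by rewrite numqE.
by rewrite /redr /ratr divfK.
Qed.

Lemma pint_int (z : int) : z%:~R \in pint /\ red z%:~R = z%:~R.
Proof.
have [||p1 r1] := @pint_frac z%:~R z 1; rewrite ?mulr1 ?oner_neq0 //.
by split=> //; rewrite mulr1 in r1.
Qed.

Lemma pint_nat (n : nat) : n%:R \in pint /\ red n%:R = n%:R.
Proof. exact: (pint_int n). Qed.

Lemma pint_sub x y : x \in pint -> y \in pint ->
  x - y \in pint /\ red (x - y) = red x - red y.
Proof.
move=> /pintP[a [d [d0 xd rd]]] /pintP[b [e [e0 ye re]]].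
have de0 : (d * e)%:~R != 0 :> k by rewrite rmorphM mulf_neq0.
have [|pxy rxy] := @pint_frac (x - y) (a * e - b * d) (d * e) de0.
  by rewrite rmorphB !rmorphM /= -xd -ye; ring.
split=> //; apply: (mulIf de0); rewrite rxy rmorphB !rmorphM /= -rd -re; ring.
Qed.

Lemma pint_mul x y : x \in pint -> y \in pint ->
  x * y \in pint /\ red (x * y) = red x * red y.
Proof.
move=> /pintP[a [d [d0 xd rd]]] /pintP[b [e [e0 ye re]]].
have de0 : (d * e)%:~R != 0 :> k by rewrite rmorphM mulf_neq0.
have [|pxy rxy] := @pint_frac (x * y) (a * b) (d * e) de0.
  by rewrite !rmorphM /= -xd -ye; ring.
split=> //; apply: (mulIf de0); rewrite rxy !rmorphM /= -rd -re; ring.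
Qed.

Fact pint_subring_closed : subring_closed pint.
Proof.
split=> [|x y px py|x y px py]; first by have [] := pint_nat 1.
  by have [] := pint_sub px py.
by have [] := pint_mul px py.
Qed.
HB.instance Definition _ := GRing.isSubringClosed.Build rat pint pint_subring_closed.

Lemma redB x y : x \in pint -> y \in pint -> red (x - y) = red x - red y.
Proof. by move=> px py; have [] := pint_sub px py. Qed.

Lemma red0 : red 0 = 0.
Proof. by have [_] := pint_nat 0. Qed.

Lemma redN x : x \in pint -> red (- x) = - red x.
Proof. by move=> px; rewrite -[- x]sub0r redB ?rpred0 // red0 sub0r. Qed.

Lemma redD x y : x \in pint -> y \in pint -> red (x + y) = red x + red y.
Proof. by move=> px py; rewrite -{1}[y]opprK redB ?rpredN // redN // opprK. Qed.

Lemma redM x y : x \in pint -> y \in pint -> red (x * y) = red x * red y.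
Proof. by move=> px py; have [] := pint_mul px py. Qed.

Lemma red_nat n : red n%:R = n%:R.
Proof. by have [] := pint_nat n. Qed.

Lemma red_sum (I : Type) (r : seq I) (P : pred I) (F : I -> rat) :
  (forall i, P i -> F i \in pint) ->
  red (\sum_(i <- r | P i) F i) = \sum_(i <- r | P i) red (F i).
Proof.
move=> pF; elim: r => [|i r IHr]; first by rewrite !big_nil red0.
rewrite !big_cons; case: ifP => // Pi.
by rewrite redD ?IHr ?pF ?rpred_sum.
Qed.

Lemma pint_inv x : x \in pint -> red x != 0 ->
  x^-1 \in pint /\ red x^-1 = (red x)^-1.
Proof.
move=> /pintP[a [d [d0 xd rd]]] rx0.
have ka0 : a%:~R != 0 :> k by rewrite -rd mulf_neq0.
have a0 : a%:~R != 0 :> rat by apply: contra_neq ka0 => /eqP; rewrite intr_eq0 => /eqP->; rewrite rmorph0.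
have x0 : x != 0 by apply: contra_neq a0; rewrite -xd => ->; rewrite mul0r.
have [|px rx] := @pint_frac x^-1 d a ka0; first by rewrite -xd mulrA mulVf ?mul1r.
split=> //; apply: (mulIf ka0); rewrite rx -rd mulrA mulVf ?mul1r //.
Qed.

(** Integrality and value are carried together so that reductions of compound expressions can be
    assembled term by term. *)
Definition Red x y := x \in pint /\ red x = y.
Lemma RedD x y x' y' : Red x y -> Red x' y' -> Red (x + x') (y + y').
Proof. by move=> [px <-] [px' <-]; split; [exact: rpredD | exact: redD]. Qed.
Lemma RedB x y x' y' : Red x y -> Red x' y' -> Red (x - x') (y - y').
Proof. by move=> [px <-] [px' <-]; split; [exact: rpredB | exact: redB]. Qed.
Lemma RedM x y x' y' : Red x y -> Red x' y' -> Red (x * x') (y * y').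
Proof. by move=> [px <-] [px' <-]; split; [exact: rpredM | exact: redM]. Qed.
Lemma RedN x y : Red x y -> Red (- x) (- y).
Proof. by move=> [px <-]; split; [rewrite rpredN | exact: redN]. Qed.

Section Char.
Variable p : nat.
Hypothesis hp5 : (5 <= p)%N.
Hypothesis hchar : p \in [pchar k].

Lemma pint_natV n : n%:R != 0 :> k -> n%:R^-1 \in pint /\ red n%:R^-1 = n%:R^-1.
Proof.
by move=> n0; have [] := @pint_inv n%:R; rewrite ?red_nat //; have [] := pint_nat n.
Qed.

Lemma pint_natr n : n%:R \in pint. Proof. by have [] := pint_nat n. Qed.

(** Up to this index the recursion divides only by integers smaller than p. *)
Lemma bernoulli_pint n : (n <= p - 2)%N -> bernoulli n \in pint.
Proof.
have [m] := ubnP n; elim: m n => // m IHm [|n] lt_nm le_np.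
  by rewrite bernoulli0; exact: rpred1.
rewrite bernoulliS mulNr rpredN rpredM //.
  by have [] := @pint_natV n.+2 (natr_small hchar _) => //; lia.
apply: rpred_sum => i _; apply: rpredM; first exact: pint_natr.
by apply: IHm; have := ltn_ord i; lia.
Qed.

(** In the recursion for B_{p-1} the coefficients C(p, i) with 0 < i < p - 1 are divisible by p and
    the B_i are p-integral; only the term i = 0 survives. *)
Lemma p_bernoulli : p%:R * bernoulli p.-1 \in pint /\ red (p%:R * bernoulli p.-1) = -1.
Proof.
have -> : p%:R * bernoulli p.-1 =
    - (1 + \sum_(1 <= i < p.-1) ('C(p, i))%:R * bernoulli i).
  have p2 : p = p.-2.+2 by lia.
  have -> : p.-1 = p.-2.+1 by lia.
  rewrite bernoulliS -p2 mulrA mulrN divff ?mulN1r; last by rewrite pnatr_eq0; lia.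
  congr (- _); rewrite -(big_mkord xpredT (fun i => ('C(p, i))%:R * bernoulli i)).
  by rewrite big_ltn // bin0 mul1r bernoulli0.
have pB i : (1 <= i < p.-1)%N -> bernoulli i \in pint.
  by move=> ip; apply: bernoulli_pint; lia.
have pS : \sum_(1 <= i < p.-1) ('C(p, i))%:R * bernoulli i \in pint.
  by rewrite big_nat; apply: rpred_sum => i /pB pBi; rewrite rpredM ?pint_natr.
split; first by rewrite rpredN rpredD ?rpred1.
rewrite redN ?rpredD ?rpred1 // redD ?rpred1 // (red_nat 1) big_nat red_sum => [|i /pB pBi]; last first.
  by rewrite rpredM ?pint_natr.
rewrite big1 ?addr0 // => i ip; rewrite redM ?pB ?pint_natr // red_nat.
by rewrite (bin_lt_pcharf_0 hchar) ?mul0r //; lia.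
Qed.

Lemma factr_small n : (n < p)%N -> (n`!)%:R != 0 :> k.
Proof.
elim: n => [|n IHn] lt_np; first by rewrite oner_neq0.
rewrite factS natrM mulf_neq0 ?IHn ?(ltnW lt_np) //.
by apply: (natr_small hchar); rewrite lt_np.
Qed.

(** p divides (p + 2)! but neither i! nor (p + 2 - i)!, both arguments being smaller than p. *)
Lemma bin_p2 i : (3 <= i < p)%N -> ('C(p.+2, i))%:R = 0 :> k.
Proof.
move=> /andP[i3 ip]; have le_i : (i <= p.+2)%N by lia.
have F0 : ((p.+2)`!)%:R = 0 :> k.
  by apply/eqP; rewrite -(dvdn_pcharf hchar) dvdn_fact //; lia.
have := congr1 (fun n : nat => n%:R : k) (bin_fact le_i); rewrite F0 2!natrM => /eqP.
rewrite !mulf_eq0 (negPf (factr_small ip)) (negPf (factr_small _)) ?orbF; last by lia.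
by move=> /eqP.
Qed.

(* In the recursion for B_{p+1} only the terms B_0, B_1, B_2 and B_{p-1} survive,
   since p divides C(p+2, i) for 3 <= i < p. *)
Lemma bernoulli_p1 : bernoulli p.+1 \in pint /\ red (bernoulli p.+1) = 12%:R^-1.
Proof.
have [B1 B2 _ _ _] := bernoulli_small.
have [pB rB] := p_bernoulli.
have n2 : 2%:R != 0 :> k by apply: (natr_small hchar); lia.
have n3 : 3%:R != 0 :> k by apply: (natr_small hchar); lia.
have n6 : 6%:R != 0 :> k by rewrite (_ : 6 = 2 * 3)%N // natrM mulf_neq0.
have odd_p : odd p by case: (even_prime (pcharf_prime hchar)) => // p2; move: hp5; rewrite p2.
pose S := \sum_(3 <= i < p.-1) ('C(p.+2, i))%:R * bernoulli i.
have pS : S \in pint /\ red S = 0.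
  have pBi i : (3 <= i < p.-1)%N -> bernoulli i \in pint.
    by move=> ip; apply: bernoulli_pint; lia.
  rewrite /S big_nat; split; first by apply: rpred_sum => i /pBi pi; rewrite rpredM ?pint_natr.
  rewrite red_sum => [|i /pBi pi]; last by rewrite rpredM ?pint_natr.
  rewrite big1 // => i ip; rewrite redM ?pBi ?pint_natr // red_nat bin_p2 ?mul0r //; lia.
(* The coefficient of B_{p-1} is C(p + 2, 3) = (p + 2)(p + 1)p / 6; its factor p is grouped with
   B_{p-1}, which alone is not p-integral. *)
have -> : bernoulli p.+1 = - (p.+2)%:R^-1 *
    (1 - p.+2%:R * 2%:R^-1 + p.+2%:R * p.+1%:R * 2%:R^-1 * 6%:R^-1 + S +
     p.+2%:R * p.+1%:R * 6%:R^-1 * (p%:R * bernoulli p.-1)).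
  rewrite bernoulliS; congr (_ * _).
  rewrite -(big_mkord xpredT (fun i => ('C(p.+2, i))%:R * bernoulli i)).
  rewrite big_nat_recr //=.
  have -> : bernoulli p = 0 by apply: bernoulli_odd => //; lia.
  rewrite mulr0 addr0.
  have recr (F : nat -> rat) :
      \sum_(0 <= i < p) F i = \sum_(0 <= i < p.-1) F i + F p.-1.
    by rewrite -{1}(@prednK p) ?big_nat_recr //; lia.
  rewrite recr big_ltn; last by lia.
  rewrite big_ltn; last by lia.
  rewrite big_ltn; last by lia.
  rewrite -/S bin0 bin1 bernoulli0 B1 B2 mul1r.
  have binE n : 'C(n.+2, 2)%:R = n.+2%:R * n.+1%:R * 2%:R^-1 :> rat.
    have := bin_ffactr (isT : 2 <= n.+2)%N.
    have f0 := factr_neq0 n; have f2 := factr_neq0 n.+2.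
    rewrite subSS subSS subn0 => /(canRL (mulfVK f2)) ->.
    by rewrite !factS !natrM; field.
  have binE3 : 'C(p.+2, p.-1)%:R = p.+2%:R * p.+1%:R * 6%:R^-1 * p%:R :> rat.
    have le_p : (p.-1 <= p.+2)%N by lia.
    have pE : p = p.-1.+1 by lia.
    have := bin_ffactr le_p; rewrite (_ : p.+2 - p.-1 = 3)%N; last by lia.
    have f0 := factr_neq0 p.-1; have f2 := factr_neq0 p.+2.
    move=> /(canRL (mulfVK f2)) ->.
    rewrite !factS {4}pE factS -pE !natrM.
    by field.
  by rewrite binE binE3; field.
have k2 : p.+2%:R = 2%:R :> k by rewrite -addn2 natrD (pcharf0 hchar) add0r.
have k1 : p.+1%:R = 1 :> k by rewrite -addn1 natrD (pcharf0 hchar) add0r.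
have i2 : Red 2%:R^-1 2%:R^-1 := pint_natV n2.
have i6 : Red 6%:R^-1 6%:R^-1 := pint_natV n6.
have r1 : Red 1 1 := pint_nat 1.
have q1 : Red p.+1%:R 1 by have := pint_nat p.+1; rewrite k1.
have q2 : Red p.+2%:R 2%:R by have := pint_nat p.+2; rewrite k2.
have iq : Red p.+2%:R^-1 2%:R^-1 by have := @pint_natV p.+2; rewrite k2 => /(_ n2).
(* Modulo p the value is -1/2 (1 - 1 + 1/6 + 0 - 1/3) = 1/12. *)
have [pX rX] := RedM (RedN iq) (RedD (RedD (RedD (RedB r1 (RedM q2 i2))
  (RedM (RedM (RedM q2 q1) i2) i6)) pS) (RedM (RedM (RedM q2 q1) i6) p_bernoulli)).
split=> //; rewrite rX.
by field; rewrite n6 n2 (natr12 hp5 hchar).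
Qed.

End Char.
End Reduction.

(** * Eisenstein series as p-integral polynomials in E_4 and E_6 *)

(* Half the modular weight. *)
Definition wt46 (m : 'X_{1..2}) : nat := (2 * m ord0 + 3 * m ord_max)%N.

Fact wt46_0 : wt46 0%MM = 0%N. Proof. by rewrite /wt46 !mnm0E. Qed.
Fact wt46_D : {morph wt46 : m1 m2 / (m1 + m2)%MM >-> (m1 + m2)%N}.
Proof. by move=> m1 m2; rewrite /wt46 !mnmDE; lia. Qed.
HB.instance Definition _ := isMeasure.Build 2 wt46 wt46_0 wt46_D.

Definition qexp2_var (i : 'I_2) : fps rat := if i == ord0 then Ef4 rat else Ef6 rat.
Definition qexp2 : {rmorphism {mpoly rat[2]} -> fps rat} := mmap (@fpsC rat) qexp2_var.

Lemma qexp2C c : qexp2 c%:MP = fpsC c. Proof. exact: mmapC. Qed.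

Lemma qexp2X : qexp2 'X_ord0 = Ef4 rat /\ qexp2 'X_ord_max = Ef6 rat.
Proof. by rewrite /= !mmapX !mmap1U. Qed.

Section GserPoly.
Variables (k : fieldType) (p : nat).
Hypothesis hp5 : (5 <= p)%N.
Hypothesis hchar : p \in [pchar k].

(** The multiplier [c] is 1 except in weight p - 1, where the constant term of [Gser] has p in its
    denominator and [c] is p. *)
Definition Gpoly n c := exists P : {mpoly rat[2]},
  [/\ P \is a mpolyOver 2 (pint k), P \is n.-homog for wt46 & qexp2 P = fpsC c * Gser (2 * n)].

(** The binomial coefficients are integers, so only the division by [wp_coef] can spoil
    p-integrality. *)
Lemma Gpoly_rec n c : (4 <= n)%N -> c / wp_coef (2 * n - 4) \in pint k ->
  (forall j, (2 <= j <= n - 2)%N -> Gpoly j 1) -> Gpoly n c.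
Proof.
move=> n4 pc IH; set m := (2 * n - 4)%N in pc.
have [m4 ev_m mE] : [/\ (4 <= m)%N, ~~ odd m & m.+4 = (2 * n)%N] by rewrite /m; split; lia.
have wp0 : wp_coef m != 0.
  have [n1 n2 n3 n5] : [/\ m%:R + 1 != 0 :> rat, m%:R + 2%:R != 0 :> rat,
      m%:R - 2%:R != 0 :> rat & m%:R + 5%:R != 0 :> rat].
    by rewrite natr1 -!natrD subr_eq0 eqr_nat !pnatr_eq0; split; lia.
  apply: mulf_neq0; first exact: mulf_neq0.
  by rewrite invr_eq0 (mulf_neq0 _ n2) // (mulf_neq0 _ n1).
have /fin_all_exists[P HP] : forall i : 'I_m.+1, exists P : {mpoly rat[2]}, (1 < i < m.-1)%N && ~~ odd i ->
   [/\ P \is a mpolyOver 2 (pint k), P \is (i.+2)./2.-homog for wt46 & qexp2 P = Gser i.+2].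
  move=> i; have [|_] := boolP ((1 < i < m.-1)%N && ~~ odd i); last by exists 0.
  move=> /andP[/andP[i1 im] ev_i].
  have [|P [oP hP qP]] := IH (i.+2)./2; first by move: i1 im ev_i; rewrite /m; lia.
  exists P => _; split=> //; rewrite qP rmorph1 mul1r; congr Gser; move: ev_i; lia.
exists ((c / wp_coef m)%:MP * \sum_(i < m.+1 | (1 < i < m.-1)%N && ~~ odd i)
    ('C(m, i))%:R%:MP * (P i * P (rev_ord i))).
have revP (i : 'I_m.+1) : (1 < i < m.-1)%N && ~~ odd i ->
    (1 < rev_ord i < m.-1)%N && ~~ odd (rev_ord i).
  by rewrite /=; have := ltn_ord i; lia.
split.
- rewrite rpredM ?mpolyOverC // rpred_sum // => i ci.
  have [oP _ _] := HP i ci; have [oP' _ _] := HP _ (revP i ci).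
  by rewrite !rpredM // mpolyOverC; have [] := pint_nat k 'C(m, i).
- rewrite mul_mpolyC; apply: dhomogZ; apply: rpred_sum => i ci.
  have [_ hP _] := HP i ci; have [_ hP' _] := HP _ (revP i ci).
  rewrite mul_mpolyC; apply: dhomogZ.
  have -> : n = ((i.+2)./2 + (rev_ord i).+2./2)%N.
    by move: ci; rewrite /= /m; have := ltn_ord i; lia.
  exact: dhomogM.
rewrite rmorphM rmorph_sum qexp2C -mE.
have -> : fpsC c = fpsC (c / wp_coef m) * fpsC (wp_coef m).
  by rewrite -(rmorphM (@fpsC rat)) divfK.
rewrite -mulrA -Gser_wp //; congr (_ * _); apply: eq_bigr => i ci.
have [_ _ qP] := HP i ci; have [_ _ qP'] := HP _ (revP i ci).
by rewrite !(rmorphM qexp2) qexp2C qP qP'.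
Qed.
Lemma natr_prime_neq0 n : prime n -> n != p -> n%:R != 0 :> k.
Proof.
move=> pr_n ne_np; rewrite -(dvdn_pcharf hchar) dvdn_prime2 ?(pcharf_prime hchar) //.
by rewrite eq_sym.
Qed.

Lemma Gpoly_base n (c : rat) (e : {mpoly rat[2]}) :
  e \is a mpolyOver 2 (pint k) -> e \is n.-homog for wt46 ->
  qexp2 e = fpsC (Gconst (2 * n))^-1 * Gser (2 * n) -> Gconst (2 * n) != 0 ->
  c * Gconst (2 * n) \in pint k -> Gpoly n c.
Proof.
move=> oe he qe G0 pc; exists ((c * Gconst (2 * n))%:MP * e); split.
- by rewrite rpredM ?mpolyOverC.
- by rewrite mul_mpolyC; exact: dhomogZ.
by rewrite rmorphM qexp2C qe mulrA -(rmorphM (@fpsC rat)) mulfK.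
Qed.

Lemma Gconst46 : (Gconst 4)^-1 = 240%:R /\ (Gconst 6)^-1 = - 504%:R.
Proof.
rewrite /Gconst; have [_ _ -> -> _] := bernoulli_small.
by split; field.
Qed.

Lemma Gser_normalize j : Gconst j != 0 ->
  fpsC (Gconst j)^-1 * Gser j = 1 + fpsC (Gconst j)^-1 * Sser j.-1.
Proof. by move=> G0; apply: fpsC_Gser; rewrite mulVf. Qed.

Lemma Gconst46_neq0 : Gconst 4 != 0 /\ Gconst 6 != 0.
Proof.
have [G4 G6] := Gconst46.
split; rewrite -invr_eq0.
  by rewrite G4 pnatr_eq0.
by rewrite G6 oppr_eq0 pnatr_eq0.
Qed.

Lemma Gpoly4 c : c * Gconst 4 \in pint k -> Gpoly 2 c.
Proof.
have [G0 _] := Gconst46_neq0; have [GV _] := Gconst46; have [q4 _] := qexp2X.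
apply: (@Gpoly_base 2 c 'X_ord0 (mpolyOverX _ _) _ _ G0).
  by rewrite dhomogX /= /wt46 !mnm1E.
rewrite (Gser_normalize G0) q4 GV (rmorph_nat (@fpsC rat) 240) //.
Qed.

Lemma Gpoly6 c : c * Gconst 6 \in pint k -> Gpoly 3 c.
Proof.
have [_ G0] := Gconst46_neq0; have [_ GV] := Gconst46; have [_ q6] := qexp2X.
apply: (@Gpoly_base 3 c 'X_ord_max (mpolyOverX _ _) _ _ G0).
  by rewrite dhomogX /= /wt46 !mnm1E.
rewrite (Gser_normalize G0) q6 GV rmorphN (rmorph_nat (@fpsC rat) 504) mulNr //.
Qed.

Lemma pint_frac_nat (x : rat) (a d : nat) : d%:R != 0 :> k -> x * d%:R = a%:R -> x \in pint k.
Proof. by move=> d0 xd; have [] := @pint_frac k x a d d0 xd. Qed.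

(** The equation says that c / [wp_coef m] = a / d, cross-multiplied so that it can be checked on
    natural numbers. *)
Lemma pint_wpV (m : nat) (c : rat) (a d : nat) : (4 <= m)%N -> (d%:R : k) != 0 ->
  (c * (12 * (m + 1) * (m + 2) * d)%:R = (a * ((m - 2) * (m + 5)))%:R :> rat) ->
  c / wp_coef m \in pint k.
Proof.
move=> m4 d0 E; apply: (@pint_frac_nat _ a d) => //.
have [n1 n2 n3 n4] : [/\ m%:R + 1 != 0 :> rat, m%:R + 2%:R != 0 :> rat,
    m%:R - 2%:R != 0 :> rat & m%:R + 5%:R != 0 :> rat].
  by rewrite natr1 -!natrD subr_eq0 eqr_nat !pnatr_eq0; split; lia.
have le2 : (2 <= m)%N by lia.
move: E; rewrite !natrM (natrB _ le2) !natrD => E.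
have D0 : (m%:R - 2%:R) * (m%:R + 5%:R) != 0 :> rat by rewrite mulf_neq0.
apply: (mulIf D0); rewrite -E /wp_coef; field.
by rewrite n1 n2 n3 n4.
Qed.

(** For n >= 4 both 2n - 6 and 2n + 1, the factors of the numerator of [wp_coef], lie strictly
    between 0 and p. In weights 4 and 6 the denominators 240 = 2^4 3 5 and 504 = 2^3 3^2 7 contain
    only primes below p. *)
Lemma Gpoly_small n : (2 <= n)%N -> (2 * n + 1 < p)%N -> Gpoly n 1.
Proof.
have [N] := ubnP n; elim: N n => // N IHN n lt_nN n2 lt_np.
have small j : (0 < j < p)%N -> j%:R != 0 :> k by exact: (natr_small hchar).
have [n4|n4] := ltnP n 4.
  have [n2E|n3] : n = 2 \/ n = 3 by lia.
    rewrite n2E in lt_np *; apply: Gpoly4; apply: (@pint_frac_nat _ 1 240).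
      by rewrite (_ : 240%:R = 2%:R ^+ 4 * 3%:R * 5%:R :> k); [rewrite !mulf_neq0 ?expf_neq0 // small; lia | ring].
    by have [<- _] := Gconst46; have [G0 _] := Gconst46_neq0; rewrite mul1r mulfV.
  rewrite n3 in lt_np *; apply: Gpoly6.
  have [||//] := @pint_frac k (1 * Gconst 6) (-1) 504.
    by rewrite (_ : 504%:~R = 2%:R ^+ 3 * 3%:R ^+ 2 * 7%:R :> k); [rewrite !mulf_neq0 ?expf_neq0 // small; lia | ring].
  have [_ G6] := Gconst46; have [_ G0] := Gconst46_neq0.
  by rewrite mul1r -[504%:~R]opprK -[- 504%:~R]G6 mulrN mulfV.
apply: Gpoly_rec => // [|j /andP[j2 jn]]; last by apply: IHN; lia.
apply: (@pint_wpV _ _ (12 * (2 * n - 4 + 1) * (2 * n - 4 + 2)) ((2 * n - 4 - 2) * (2 * n - 4 + 5))).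
- by lia.
- by rewrite natrM mulf_neq0 // small; lia.
by rewrite mul1r.
Qed.

(** Here 2n + 1 = p, and the multiplier p cancels this factor. For p = 5 and p = 7 the weight is 4
    or 6, and the constant is 5/240 = 1/48 or -7/504 = -1/72. *)
Lemma Gpoly_p1 n : (2 * n + 1 = p)%N -> Gpoly n p%:R.
Proof.
move=> pE; have small j : (0 < j < p)%N -> j%:R != 0 :> k by exact: (natr_small hchar).
have [n4|n4] := ltnP n 4.
  have [n2|n3] : n = 2 \/ n = 3 by lia.
    rewrite n2; have p5 : p = 5%N by lia.
    apply: Gpoly4; apply: (@pint_frac_nat _ 1 48).
      by rewrite (_ : 48%:R = 2%:R ^+ 4 * 3%:R :> k); [rewrite !mulf_neq0 ?expf_neq0 // small; lia | ring].
    have [G4 _] := Gconst46; have [G0 _] := Gconst46_neq0.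
    transitivity ((Gconst 4)^-1 * Gconst 4); last by rewrite mulVf.
    by rewrite G4 p5; move: (Gconst 4) => g; ring.
  rewrite n3; have p7 : p = 7%N by lia.
  apply: Gpoly6; have [||//] := @pint_frac k (p%:R * Gconst 6) (-1) 72.
    by rewrite (_ : 72%:~R = 2%:R ^+ 3 * 3%:R ^+ 2 :> k); [rewrite !mulf_neq0 ?expf_neq0 // small; lia | ring].
  have [_ G6] := Gconst46; have [_ G0] := Gconst46_neq0.
  transitivity (- ((Gconst 6)^-1 * Gconst 6)); last by rewrite mulVf.
  by rewrite G6 p7; move: (Gconst 6) => g; ring.
apply: Gpoly_rec => // [|j /andP[j2 jn]]; last by apply: Gpoly_small; lia.
apply: (@pint_wpV _ _ (12 * (2 * n - 4 + 1) * (2 * n - 4 + 2)) (2 * n - 4 - 2)).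
- by lia.
- by apply: small; lia.
by rewrite -natrM; congr _%:R; rewrite (_ : p = 2 * n - 4 + 5)%N; [ring | lia].
Qed.

(** The factor 2n + 1 is now p + 2, a unit modulo p, and the recursion involves only weights up to p
    - 3, all covered by [Gpoly_small]. For p = 5 the weight is 6, and 504 is prime to 5. *)
Lemma Gpoly_p2 n : (2 * n = p + 1)%N -> Gpoly n 1.
Proof.
move=> pE; have small j : (0 < j < p)%N -> j%:R != 0 :> k by exact: (natr_small hchar).
have [n4|n4] := ltnP n 4.
  have n3 : n = 3 by lia.
  rewrite n3; have p5 : p = 5%N by lia.
  apply: Gpoly6; have [||//] := @pint_frac k (1 * Gconst 6) (-1) 504.
    have p7 : (7%:R : k) != 0 by apply: natr_prime_neq0 => //; rewrite p5.
    by rewrite (_ : 504%:~R = 2%:R ^+ 3 * 3%:R ^+ 2 * 7%:R :> k); [rewrite !mulf_neq0 ?expf_neq0 // small; lia | ring].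
  have [_ G6] := Gconst46; have [_ G0] := Gconst46_neq0.
  by rewrite mul1r -[504%:~R]opprK -[- 504%:~R]G6 mulrN mulfV.
apply: Gpoly_rec => // [|j /andP[j2 jn]]; last by apply: Gpoly_small; lia.
apply: (@pint_wpV _ _ (12 * (2 * n - 4 + 1) * (2 * n - 4 + 2)) ((2 * n - 4 - 2) * (2 * n - 4 + 5))).
- by lia.
- rewrite natrM mulf_neq0 //; first by apply: small; lia.
  rewrite (_ : 2 * n - 4 + 5 = p + 2)%N; last by lia.
  by rewrite natrD (pcharf0 hchar) add0r small //; lia.
by rewrite mul1r.
Qed.
End GserPoly.

(** * The discriminant on the real interval [0, 1) *)

Lemma between1 (F : realFieldType) (a : F) : 0 <= a -> a < 1 ->
  exists y, [/\ 0 <= y, a < y & y < 1].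
Proof. by move=> a0 a1; exists ((a + 1) / 2%:R); split; lra. Qed.

Lemma poly_lower_bound (F : realFieldType) (P : {poly F}) : P != 0 ->
  exists c Y : F, 0 < c /\ forall y, Y <= y -> c <= `|P.[y]|.
Proof.
elim/poly_ind: P => [|Q a IHQ]; first by rewrite eqxx.
have [-> | Q0 _] := eqVneq Q 0.
  rewrite mul0r add0r polyC_eq0 => a0; exists `|a|, 0; rewrite normr_gt0; split=> // y _.
  by rewrite hornerC.
have [c [Y [c0 HY]]] := IHQ Q0.
(* From this point on c y >= 1 + |a|, so the lower bound 1 holds for Q(y) y + a. *)
pose Z := (1 + `|a|) / c.
exists 1, (Num.max Y Z); split=> // y; rewrite ge_max => /andP[Yy Zy].
have Z0 : 0 <= Z by rewrite divr_ge0 ?(ltW c0) // addr_ge0.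
have y0 : 0 <= y by exact: le_trans Zy.
have cy : 1 + `|a| <= `|Q.[y]| * y.
  rewrite -(divfK (lt0r_neq0 c0) (1 + `|a|)) -/Z mulrC.
  by apply: ler_pM => //; [exact: ltW | exact: HY].
rewrite hornerMXaddC; apply: le_trans (lerB_normD _ _).
by rewrite lerBrDr normrM (ger0_norm y0).
Qed.

(** With u = 1 / (1 - x) one has xu = u - 1 and xu^2 = u^2 - u, so it suffices that 2 - 48(u^2 - u)
    + M(u - 1) <= 0, which holds for u >= M + 2. *)
Lemma decay_sign (F : realFieldType) (M : nat) (x u e : F) :
  u * (1 - x) = 1 -> M%:R + 2%:R <= u -> e <= 1 - 24%:R * (x * u ^+ 2) ->
  2%:R * e + M%:R * (x * u) <= 0.
Proof.
move=> ux Mu eE; have M0 : 0 <= M%:R :> F by exact: ler0n.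
have u2 : 2%:R <= u by apply: le_trans Mu; rewrite lerDr.
have u0 : 0 < u by apply: lt_le_trans u2; rewrite ltr0n.
have xu : x * u = u - 1 by rewrite -[in RHS]ux; ring.
have H1 : 0 <= (u - M%:R - 2%:R) * u by rewrite mulr_ge0 ?(ltW u0) //; lra.
have H2 : 0 <= (u - 2%:R) * u by rewrite mulr_ge0 ?(ltW u0) //; lra.
have H3 : 0 <= (u - 2%:R) * (u - 2%:R) by rewrite -expr2 sqr_ge0.
have xu2 : x * u ^+ 2 = u * u - u by rewrite expr2 mulrA xu; ring.
rewrite xu2 in eE; rewrite xu; have -> : M%:R * (u - 1) = M%:R * u - M%:R by ring.
have H4 : M%:R * u <= u * u - 2%:R * u by move: H1; rewrite -mulrBl; nra.
nra.
Qed.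

Lemma near_one (F : realFieldType) (a c K C Y : F) : 0 < a -> a < 1 -> 0 < c ->
  exists u x : F, [/\ (1 - x)^-1 = u, a <= x, x < 1, 0 < u &
    Y <= u /\ `|K| * C ^+ 2 < c ^+ 2 * u].
Proof.
(* [u] is the sum of all the lower bounds imposed on it; the summand 2 makes the last inequality
   strict. Then x = 1 - 1/u. *)
move=> a0 a1 c0; pose u := 2%:R + `|Y| + (1 - a)^-1 + `|K| * C ^+ 2 / c ^+ 2.
have ia : 0 < (1 - a)^-1 by rewrite invr_gt0 subr_gt0.
have i3 : 0 <= `|K| * C ^+ 2 / c ^+ 2 by apply: divr_ge0 (sqr_ge0 c); apply: mulr_ge0 (normr_ge0 K) (sqr_ge0 C).
have [nY lY] := (normr_ge0 Y, ler_norm Y).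
have u0 : 0 < u by rewrite /u; lra.
have au : (1 - a)^-1 <= u by rewrite /u; lra.
exists u, (1 - u^-1); rewrite opprB addrCA subrr addr0 invrK; split=> //.
- rewrite lerBrDr -lerBrDl -[leRHS]invrK lef_pV2 ?posrE ?invr_gt0 ?subr_gt0 //.
- by rewrite ltrBlDr ltrDl invr_gt0.
split; first by rewrite /u; lra.
rewrite [ltRHS]mulrC -ltr_pdivrMr ?exprn_gt0 //; rewrite /u; lra.
Qed.

(** The chain is c^2 u <= D^2 H^2 u <= C^2 D^2 u^(2N+1) <= |K| C^2. Working with D^2 avoids any
    discussion of the sign of D. *)
Lemma decay_contra (F : realFieldType) (K C c u D H : F) N :
  0 < c -> 0 <= C -> 0 < u -> c <= `|D * H| -> `|H| <= C * u ^+ N ->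
  D ^+ 2 * u ^+ (2 * N).+1 <= K -> `|K| * C ^+ 2 < c ^+ 2 * u -> False.
Proof.
move=> c0 C0 u0 cDH hH hD iu.
have cG : c ^+ 2 <= D ^+ 2 * H ^+ 2.
  by rewrite -exprMn -[leRHS](real_normK (num_real _)) lerXn2r ?nnegrE // ltW.
have {}hH : H ^+ 2 <= C ^+ 2 * u ^+ (2 * N).
  by rewrite mulnC exprM -exprMn -[leLHS](real_normK (num_real _)) lerXn2r ?nnegrE ?mulr_ge0 ?exprn_ge0 ?(ltW u0).
suff : c ^+ 2 * u <= `|K| * C ^+ 2 by rewrite leNgt iu.
apply: (@le_trans _ _ (D ^+ 2 * (C ^+ 2 * u ^+ (2 * N)) * u)).
  apply: ler_wpM2r; first exact: ltW.
  by apply: (le_trans cG); apply: ler_wpM2l; rewrite ?sqr_ge0.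
have -> : D ^+ 2 * (C ^+ 2 * u ^+ (2 * N)) * u = (D ^+ 2 * u ^+ (2 * N).+1) * C ^+ 2.
  by rewrite (exprSr u (2 * N)); move: (u ^+ (2 * N)) => E; ring.
apply: ler_wpM2r; first exact: sqr_ge0.
by apply: (le_trans hD); exact: ler_norm.
Qed.

Definition Edisc : fps rat := Ef4 rat ^+ 3 - Ef6 rat ^+ 2.

Lemma thetaX (R : comNzRingType) (f : fps R) n : theta (f ^+ n) = n%:R * theta f * f ^+ n.-1.
Proof.
elim: n => [|n IHn]; first by rewrite expr0 theta1 !mul0r.
rewrite exprS thetaM IHn -(natr1 n); case: n {IHn} => [|n] /=; last rewrite exprS; ring.
Qed.

Lemma theta_log_deriv (R : comNzRingType) (D G E X : fps R) M :
  theta D = E * D -> theta G = X * G ^+ 2 ->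
  theta (D ^+ 2 * G ^+ M) = (2%:R * E + M%:R * (X * G)) * (D ^+ 2 * G ^+ M).
Proof.
move=> tD tG; rewrite thetaM !thetaX tD tG.
by case: M => [|n] /=; rewrite ?exprS; ring.
Qed.

Lemma theta_Edisc : theta Edisc = Ef2 rat * Edisc.
Proof.
have [_ o4 o6] := ramanujan rat.
rewrite /Edisc raddfB /= !thetaX /= o4 o6; ring.
Qed.

(** The divisor d = n alone gives the bound; the correction at n = 0 accounts for 0^0 = 1. *)
Lemma dser_ge s n : n%:R ^+ s <= dser (R := rat) (fun d => d%:R ^+ s) n + (n == 0%N)%:R.
Proof.
rewrite dserE; have [-> | n0] := posnP n.
  by rewrite /dsum eqxx add0r; case: s => [|s]; rewrite ?expr0 // expr0n.
rewrite addr0 (dsum_ord _ n0 (leqnn n)) (bigD1 ord_max) //= lerDl.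
by apply: sumr_ge0 => i _; rewrite exprn_ge0.
Qed.

(** * Evaluation of power series at real points of the unit interval *)

Module RealEval.
Import Rstruct Reals Rbar Lim_seq Series PSeries Derive Hierarchy Coquelicot.
Local Open Scope ring_scope.
Delimit Scope nat_scope with N.
Local Notation R := Rdefinitions.R.
Implicit Types (f g : fps rat) (x y : R).

Definition rcoef f (n : nat) : R := ratr (f n).
Definition ev f x : R := PSeries (rcoef f) x.
Definition conv f := forall x, `|x| < 1 -> Rbar_lt (Finite `|x|) (CV_radius (rcoef f)).

Lemma conv_ex f x : conv f -> `|x| < 1 -> ex_pseries (rcoef f) x.
Proof. by move=> cf /cf; rewrite -RabsE => /CV_radius_inside. Qed.

(** Convergence at a point y with |x| < y < 1 puts x strictly inside the disk of convergence. *)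
Lemma ex_conv f : (forall x, `|x| < 1 -> ex_pseries (rcoef f) x) -> conv f.
Proof.
move=> exf x x1; have [y [y0 xy y1]] := between1 (normr_ge0 x) x1.
have [//|CV_le] := Classical_Prop.classic (Rbar_lt (Finite `|x|) (CV_radius (rcoef f))).
have le_x := Rbar_not_lt_le _ _ CV_le.
exfalso; apply: (CV_disk_outside (rcoef f) y).
  apply: (Rbar_le_lt_trans _ _ _ le_x); rewrite /= RabsE (ger0_norm y0); exact/RltP.
by apply: ex_series_lim_0; apply/ex_pseries_R; apply: exf; rewrite ger0_norm.
Qed.

Lemma rcoefM f g n : rcoef (f * g) n = PS_mult (rcoef f) (rcoef g) n.
Proof.
rewrite /PS_mult sum_f_R0E big_mkord /rcoef fcoefM rmorph_sum.
by apply: eq_bigr => i _; rewrite rmorphM.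
Qed.

Lemma rcoefD f g n : rcoef (f + g) n = PS_plus (rcoef f) (rcoef g) n.
Proof. by rewrite /rcoef fcoefD rmorphD. Qed.

Lemma convM f g : conv f -> conv g -> conv (f * g).
Proof.
move=> cf cg; apply: ex_conv => x x1; apply: (ex_pseries_ext (PS_mult (rcoef f) (rcoef g))).
  by move=> n; rewrite -rcoefM.
by apply: ex_pseries_mult; rewrite RabsE; [apply: cf | apply: cg].
Qed.

Lemma evM f g x : conv f -> conv g -> `|x| < 1 -> ev (f * g) x = ev f x * ev g x.
Proof.
move=> cf cg x1; rewrite /ev (PSeries_ext _ _ _ (rcoefM f g)).
by apply: PSeries_mult; rewrite RabsE; [apply: cf | apply: cg].
Qed.

Lemma convD f g : conv f -> conv g -> conv (f + g).
Proof.
move=> cf cg; apply: ex_conv => x x1; apply: (ex_pseries_ext (PS_plus (rcoef f) (rcoef g))).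
  by move=> n; rewrite -rcoefD.
by apply: ex_pseries_plus; exact: conv_ex.
Qed.

Lemma evD f g x : conv f -> conv g -> `|x| < 1 -> ev (f + g) x = ev f x + ev g x.
Proof.
move=> cf cg x1; rewrite /ev (PSeries_ext _ _ _ (rcoefD f g)).
by apply: PSeries_plus; exact: conv_ex.
Qed.

Lemma ex_pseries_dom (a b : nat -> R) (C x : R) :
  (forall n, `|a n| <= C * b n) -> ex_pseries b `|x| ->
  ex_series (fun n => Rabs (a n * x ^+ n)).
Proof.
move=> le_ab /ex_pseries_R exb.
apply: (@ex_series_le _ _ _ (fun n => C * (b n * `|x| ^+ n))).
  move=> n; apply/RleP; rewrite /norm /= /abs /= Rabs_Rabsolu RabsE normrM normrX mulrA.
  by apply: ler_wpM2r; rewrite ?exprn_ge0.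
apply: (ex_series_scal_l C); apply: (ex_series_ext _ _ _ exb) => n.
by rewrite RpowE.
Qed.
Lemma rcoef_dom f g (C : rat) (n : nat) : `|f n| <= C * g n ->
  `|rcoef f n| <= ratr C * rcoef g n.
Proof. by move=> dom; rewrite /rcoef -ratr_norm -rmorphM ler_rat. Qed.

Lemma conv_dom f g (C : rat) : (forall n, `|f n| <= C * g n) -> conv g -> conv f.
Proof.
move=> dom cg; apply: ex_conv => x x1; apply/ex_pseries_R.
apply: (ex_series_ext (fun n => rcoef f n * x ^+ n)) => [n|]; first by rewrite RpowE.
apply/ex_series_Rabs/(@ex_pseries_dom _ (rcoef g) (ratr C)).
  by move=> n; exact: rcoef_dom.
by apply: conv_ex; rewrite // normr_id.
Qed.

Lemma ev_dom f g (C : rat) x : (forall n, `|f n| <= C * g n) -> conv g ->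
  0 <= x -> x < 1 -> `|ev f x| <= ratr C * ev g x.
Proof.
move=> dom cg x0 x1; have nx1 : `|x| < 1 by rewrite ger0_norm.
have exf : ex_series (fun n => Rabs (rcoef f n * x ^+ n)).
  apply: (@ex_pseries_dom _ (rcoef g) (ratr C)) => [n|]; first exact: rcoef_dom.
  by apply: conv_ex; rewrite // normr_id.
have -> : ev f x = Series (fun n => rcoef f n * x ^+ n).
  by apply: Series_ext => n; rewrite RpowE.
have -> : ratr C * ev g x = Series (fun n => ratr C * (rcoef g n * x ^+ n)).
  rewrite Series_scal_l; congr (_ * _); apply: Series_ext => n.
  by rewrite RpowE.
rewrite -RabsE; apply/RleP.
apply: (RIneq.Rle_trans _ _ _ (Series_Rabs _ exf)).
apply: Series_le => [n|]; last first.
  apply: (ex_series_scal_l (ratr C : R)); apply: (ex_series_ext (fun n => (rcoef g n * pow x n)%R)).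
    by move=> n; rewrite RpowE.
  by apply/ex_pseries_R; exact: conv_ex.
split; apply/RleP; rewrite RabsE ?normr_ge0 // normrM normrX (ger0_norm x0) mulrA.
by apply: ler_wpM2r; rewrite ?exprn_ge0 // rcoef_dom.
Qed.

Lemma ev_ge0 f x : (forall n, 0 <= f n) -> conv f -> 0 <= x -> x < 1 -> 0 <= ev f x.
Proof.
move=> f0 cf x0 x1; have nx1 : `|x| < 1 by rewrite ger0_norm.
have -> : 0 = PSeries (fun=> 0) x :> R by rewrite PSeries_const_0.
apply/RleP/Series_le => [n|]; last by apply/ex_pseries_R; exact: conv_ex.
split; apply/RleP; rewrite RpowE ?RmultE mul0r //.
by rewrite mulr_ge0 ?exprn_ge0 // ler0q.
Qed.

Lemma bounded_conv f (C : rat) : (forall n, `|f n| <= C) -> conv f.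
Proof.
move=> dom; apply: (@conv_dom f (Fps (fun=> 1)) C) => [n|]; first by rewrite fpsE mulr1.
apply: ex_conv => x x1; apply/ex_pseries_R.
apply: (ex_series_ext (fun n => pow x n)) => [n|].
  by rewrite /rcoef fpsE rmorph1 Raxioms.Rmult_1_l.
by exists (/ (1 - x))%R; apply: is_series_geom; rewrite RabsE; apply/RltP.
Qed.

Lemma convC c : conv (fpsC c).
Proof.
apply: (@bounded_conv _ `|c|) => n; rewrite fcoefC.
by case: eqP; rewrite ?normr0.
Qed.

Lemma evC c x : `|x| < 1 -> ev (fpsC c) x = ratr c.
Proof.
move=> x1; rewrite /ev PSeries_decr_1; last by apply: conv_ex; [exact: convC|].
rewrite (PSeries_ext _ (fun=> IZR 0)) ?PSeries_const_0 ?RIneq.Rmult_0_r ?RIneq.Rplus_0_r //.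
by move=> n; rewrite /PS_decr_1 /rcoef fcoefC /= rmorph0.
Qed.

Definition geo : fps rat := Fps (fun=> 1).

Lemma conv_geo : conv geo.
Proof. by apply: (@bounded_conv _ 1) => n; rewrite fpsE normr1. Qed.

Lemma ev_geo x : `|x| < 1 -> ev geo x = (1 - x)^-1.
Proof.
move=> x1; rewrite /ev /PSeries (Series_ext _ (fun n => pow x n)) => [|n].
  by rewrite Series_geom // RabsE; apply/RltP.
by rewrite /rcoef fpsE rmorph1 Raxioms.Rmult_1_l.
Qed.

Lemma convN f : conv f -> conv (- f).
Proof.
move=> cf; have -> : - f = fpsC (-1) * f by rewrite rmorphN rmorph1 mulN1r.
by apply: convM => //; exact: convC.
Qed.

Lemma evN f x : conv f -> `|x| < 1 -> ev (- f) x = - ev f x.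
Proof.
move=> cf x1; have -> : - f = fpsC (-1) * f by rewrite rmorphN rmorph1 mulN1r.
rewrite evM //; last exact: convC.
by rewrite evC // rmorphN rmorph1 mulN1r.
Qed.

Lemma ev_le f g x : (forall n, f n <= g n) -> conv f -> conv g ->
  0 <= x -> x < 1 -> ev f x <= ev g x.
Proof.
move=> le_fg cf cg x0 x1; have nx1 : `|x| < 1 by rewrite ger0_norm.
have := @ev_ge0 (g - f) x _ (convD cg (convN cf)) x0 x1; rewrite evD ?evN //; last exact: convN.
by rewrite subr_ge0; apply=> n; rewrite fcoefB subr_ge0.
Qed.

Lemma is_derive_ev f x : conv f -> `|x| < 1 ->
  is_derive (ev f) x (PSeries (PS_derive (rcoef f)) x).
Proof. by move=> cf x1; apply: is_derive_PSeries; rewrite RabsE; apply: cf. Qed.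

Lemma ev_theta f x : ev (theta f) x = x * PSeries (PS_derive (rcoef f)) x.
Proof.
rewrite -[RHS]PSeries_incr_1 /ev; apply: PSeries_ext => -[|n].
  by rewrite /rcoef fcoef_theta mul0r rmorph0.
by rewrite /= /PS_derive /rcoef fcoef_theta rmorphM INRE rmorph_nat.
Qed.

(** The mean value theorem: for x > 0 the value of [theta f], which is x f'(x), has the sign of the
    derivative. *)
Lemma ev_decreasing f (a : R) : conv f -> 0 < a ->
  (forall x, a <= x -> x < 1 -> ev (theta f) x <= 0) ->
  forall x, a <= x -> x < 1 -> ev f x <= ev f a.
Proof.
move=> cf a0 decr x ax x1.
have inside c : a <= c -> c <= x -> 0 < c /\ `|c| < 1.
  move=> ac cx; have c0 : 0 < c by exact: lt_le_trans ac.
  by split=> //; rewrite gtr0_norm //; exact: le_lt_trans x1.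
have minE : Rmin a x = a by rewrite RminE min_l.
have maxE : Rmax a x = x by rewrite RmaxE max_r.
have [||c [[ac cx] fE]] := MVT_gen (ev f) a x (PSeries (PS_derive (rcoef f))).
- move=> c; rewrite minE maxE => -[/RltP ac /RltP cx].
  by apply: is_derive_ev => //; have [] := inside c (ltW ac) (ltW cx).
- move=> c; rewrite minE maxE => -[/RleP ac /RleP cx].
  have [c0 c1] := inside c ac cx.
  by apply: PSeries_continuity; rewrite RabsE; exact: cf.
move: ac cx; rewrite minE maxE => /RleP ac /RleP cx.
have [c0 c1] := inside c ac cx.
have d0 : PSeries (PS_derive (rcoef f)) c <= 0.
  have := decr c ac (le_lt_trans cx x1); rewrite ev_theta.
  by rewrite pmulr_rle0.
rewrite -subr_le0; move: fE; rewrite RminusE RmultE RminusE => ->.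
by rewrite mulr_le0_ge0 // subr_ge0.
Qed.

(* At most polynomial growth in 1 / (1 - x) as x tends to 1. *)
Definition bnd f := conv f /\ exists (C : R) (M : nat), 0 <= C /\
  forall x, 0 <= x -> x < 1 -> `|ev f x| <= C * (1 - x)^-1 ^+ M.

Lemma bndC c : bnd (fpsC c).
Proof.
split; first exact: convC.
exists `|ratr c : R|, 0%N; split=> // x x0 x1.
by rewrite expr0 mulr1 evC // ger0_norm.
Qed.

Lemma ge1_geo x : 0 <= x -> x < 1 -> 1 <= (1 - x)^-1.
Proof.
move=> x0 x1; rewrite -[X in X <= _]invr1 lef_pV2 ?posrE ?subr_gt0 ?ltr01 //.
by rewrite lerBlDr lerDl.
Qed.

Lemma bndD f g : bnd f -> bnd g -> bnd (f + g).
Proof.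
move=> [cf [C [M [C0 bf]]]] [cg [D [N [D0 bg]]]]; split; first exact: convD.
exists (C + D), (M + N)%N; split; first exact: addr_ge0.
move=> x x0 x1; have u1 := ge1_geo x0 x1.
rewrite evD //; last by rewrite ger0_norm.
apply: le_trans (ler_normD _ _) _.
rewrite mulrDl; apply: lerD.
  apply: le_trans (bf x x0 x1) _; apply: ler_wpM2l => //.
  by apply: ler_weXn2l => //; exact: leq_addr.
apply: le_trans (bg x x0 x1) _; apply: ler_wpM2l => //.
by apply: ler_weXn2l => //; exact: leq_addl.
Qed.

Lemma bndM f g : bnd f -> bnd g -> bnd (f * g).
Proof.
move=> [cf [C [M [C0 bf]]]] [cg [D [N [D0 bg]]]]; split; first exact: convM.
exists (C * D), (M + N)%N; split; first exact: mulr_ge0.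
move=> x x0 x1; rewrite evM //; last by rewrite ger0_norm.
rewrite normrM exprD mulrACA.
by apply: ler_pM => //; [exact: bf | exact: bg].
Qed.

Lemma bnd_geo : bnd geo.
Proof.
split; first exact: conv_geo.
exists 1, 1%N; split=> // x x0 x1; have u1 := ge1_geo x0 x1.
rewrite ev_geo; last by rewrite ger0_norm.
by rewrite mul1r expr1 ger0_norm // (le_trans ler01 u1).
Qed.

Lemma bndX f n : bnd f -> bnd (f ^+ n).
Proof.
move=> bf; elim: n => [|n IHn]; last by rewrite exprS; exact: bndM.
by rewrite expr0 -(rmorph1 (@fpsC rat)); exact: bndC.
Qed.

Lemma bnd_dom f g (C : rat) : (forall n, `|f n| <= C * g n) -> bnd g -> bnd f.
Proof.
move=> dom [cg [D [N [D0 bg]]]]; split; first exact: (conv_dom dom).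
exists (`|ratr C| * D), N; split; first exact: mulr_ge0.
move=> x x0 x1; apply: le_trans (ev_dom dom cg x0 x1) _.
apply: le_trans (ler_norm _) _; rewrite normrM -mulrA.
by apply: ler_wpM2l => //; exact: bg.
Qed.

Lemma evX f n x : conv f -> `|x| < 1 -> ev (f ^+ n) x = ev f x ^+ n /\ conv (f ^+ n).
Proof.
move=> cf x1; elim: n => [|n [IHn cn]].
  rewrite !expr0 -(rmorph1 (@fpsC rat)) evC //; split; last exact: convC.
  by rewrite rmorph1.
by rewrite !exprS evM // IHn; split=> //; exact: convM.
Qed.

Lemma geoX s n : (geo ^+ s.+1) n = ('C(n + s, s))%:R.
Proof.
elim: s n => [|s IHs] n; first by rewrite expr1 bin0.
rewrite exprS fcoefM; elim: n => [|n IHn].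
  by rewrite big_ord1 mul1r subnn IHs !add0n !binn.
rewrite big_ord_recl subn0 fpsE mul1r IHs.
under eq_bigr => i _ do rewrite fpsE mul1r lift0 subSS.
have -> : \sum_(i < n.+1) (geo ^+ s.+1) (n - i)%N = ('C(n + s.+1, s.+1))%:R.
  by rewrite -IHn; apply: eq_bigr => i _; rewrite mul1r.
rewrite -natrD; congr _%:R.
by rewrite !addSn [in RHS]addnS binS addnS addnC.
Qed.

(** The divisor sum is at most (n + 1)^(s+1), hence at most (s + 1)! C(n + s + 1, s + 1), and these
    binomial coefficients are those of (1 - q)^(-s-2). *)
Lemma bnd_dser s : bnd (dser (fun d => d%:R ^+ s)).
Proof.
apply: (@bnd_dom _ (geo ^+ s.+2) (s.+1)`!%:R); last by apply: bndX; exact: bnd_geo.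
move=> n; have [-> | n0] := posnP n; first by rewrite normr0 geoX -natrM ler0n.
rewrite geoX dserE (dsum_ord _ n0 (leqnn n)) ger0_norm; last first.
  by apply: sumr_ge0 => i _; rewrite exprn_ge0.
apply: (@le_trans _ _ (expn n.+1 s.+1)%:R).
  rewrite big_mkcond expnS natrM natrX.
  apply: (@le_trans _ _ (\sum_(i < n.+1) (n.+1)%:R ^+ s)).
    apply: ler_sum => i _; case: ifP => _; last by rewrite exprn_ge0.
    by apply: lerXn2r; rewrite ?nnegrE // ler_nat ltnW.
  by rewrite sumr_const card_ord mulr_natl.
rewrite -natrM ler_nat mulnC bin_ffact ffact_prod.
have -> : (expn n.+1 s.+1 = \prod_(i < s.+1) n.+1)%N by rewrite prod_nat_const card_ord.
by apply: leq_prod => i _; have := ltn_ord i; lia.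
Qed.

Lemma bnd_nat n f : bnd f -> bnd (n%:R * f).
Proof. by move=> bf; rewrite -(rmorph_nat (@fpsC rat)); apply: bndM => //; exact: bndC. Qed.

Lemma bndN f : bnd f -> bnd (- f).
Proof.
by move=> bf; rewrite -mulN1r -(rmorph1 (@fpsC rat)) -rmorphN; apply: bndM => //; exact: bndC.
Qed.

Lemma bnd1 : bnd 1. Proof. by rewrite -(rmorph1 (@fpsC rat)); exact: bndC. Qed.

Lemma bnd_Ef : [/\ bnd (Ef2 rat), bnd (Ef4 rat) & bnd (Ef6 rat)].
Proof.
by split; apply: bndD; rewrite ?bnd1 //; try apply: bndN; try exact: bnd1;
  apply: bnd_nat; exact: bnd_dser.
Qed.

Lemma bnd_qexp2 (f : {mpoly rat[2]}) : bnd (qexp2 f).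
Proof.
have [_ b4 b6] := bnd_Ef; move: f; apply: mpoly_gen_ind => [c|i|f g bf bg|f g bf bg].
- by rewrite qexp2C; exact: bndC.
- by rewrite /= mmapX mmap1U /qexp2_var; case: ifP.
- by rewrite rmorphD; exact: bndD.
by rewrite rmorphM; exact: bndM.
Qed.

Lemma Ef4_ge_geo n : geo n <= Ef4 rat n.
Proof.
rewrite /Ef4 fcoefD fcoef1 -(rmorph_nat (@fpsC rat)) fcoefCM fpsE.
have := dser_ge 3 n; set d := dser _ n; case: n @d => [|n] d.
  by rewrite expr0n /= /d dserE mulr0 addr0.
rewrite addr0 add0r => le_d; have n1 : 1 <= n.+1%:R ^+ 3 :> rat by rewrite exprn_ege1 // ler1n.
have d1 : 1 <= d := le_trans n1 le_d.
by apply: (le_trans d1); rewrite ler_peMl ?ler1n // (le_trans ler01 d1).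
Qed.

Lemma Xgeo2E n : (fpsX rat * geo ^+ 2) n = n%:R.
Proof. by rewrite fcoefXM; case: n => // n; rewrite geoX bin1 addn1. Qed.

Lemma Ef2_le n : Ef2 rat n <= (1 - 24%:R * (fpsX rat * geo ^+ 2)) n.
Proof.
rewrite /Ef2 !fcoefB -!(rmorph_nat (@fpsC rat)) !fcoefCM Xgeo2E lerD2l lerN2.
apply: ler_wpM2l => //; have := dser_ge 1 n; case: n => [|n]; last by rewrite addr0 expr1.
by rewrite dserE.
Qed.

Lemma theta_geo : theta geo = fpsX rat * geo ^+ 2.
Proof. by apply/fpsP => n; rewrite fcoef_theta Xgeo2E mulr1. Qed.

Lemma bnd_X : bnd (fpsX rat).
Proof.
apply: (@bnd_dom _ geo 1); last exact: bnd_geo.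
by move=> n; rewrite fcoef_X fpsE mulr1; case: eqP; rewrite ?normr1 ?normr0.
Qed.

Lemma ev_fpsX x : `|x| < 1 -> ev (fpsX rat) x = x.
Proof.
move=> x1; have <- : fpsX rat * 1 = fpsX rat by rewrite mulr1.
have -> : ev (fpsX rat * 1) x = x * ev 1 x.
  rewrite -[RHS]PSeries_incr_1; apply: PSeries_ext => -[|n].
    by rewrite /rcoef fcoefXM rmorph0.
  by rewrite /rcoef fcoefXM.
by rewrite -(rmorph1 (@fpsC rat)) evC // rmorph1 mulr1.
Qed.

Lemma conv_ev f x : bnd f -> 0 <= x -> x < 1 -> conv f /\ `|x| < 1.
Proof. by move=> [cf _] x0 x1; rewrite ger0_norm. Qed.

(* The logarithmic derivative of Delta^2 (1 - x)^(-M) is 2 E_2 + M x / (1 - x); it is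
   negative near x = 1 because E_2 <= 1 - 24 x / (1 - x)^2. *)
Lemma Edisc_decay (M : nat) : exists (a K : R), [/\ 0 < a, a < 1 &
  forall x, a <= x -> x < 1 -> ev Edisc x ^+ 2 * (1 - x)^-1 ^+ M <= K].
Proof.
have [b2 b4 b6] := bnd_Ef.
have bD : bnd Edisc by apply: bndD; [exact: bndX | apply: bndN; exact: bndX].
pose L := 2%:R * Ef2 rat + M%:R * (fpsX rat * geo).
pose g := Edisc ^+ 2 * geo ^+ M.
have bXg : bnd (fpsX rat * geo) by apply: bndM; [exact: bnd_X | exact: bnd_geo].
have bXg2 : bnd (fpsX rat * geo ^+ 2) by apply: bndM; [exact: bnd_X | apply: bndX; exact: bnd_geo].
have bL : bnd L by apply: bndD; apply: bnd_nat.
have bg : bnd g by apply: bndM; apply: bndX => //; exact: bnd_geo.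
have theta_g : theta g = L * g by exact: theta_log_deriv theta_Edisc theta_geo.
have evg x : 0 <= x -> x < 1 -> ev g x = ev Edisc x ^+ 2 * (1 - x)^-1 ^+ M.
  move=> x0 x1; have [cD nx1] := conv_ev bD x0 x1.
  have [eD c2] := evX 2 cD nx1; have [eG cG] := evX M conv_geo nx1.
  by rewrite /g evM // eD eG ev_geo.
(* For y >= a one has 1 / (1 - y) >= M + 2, as [decay_sign] requires. *)
pose a : R := 1 - (M%:R + 2%:R)^-1.
have m2 : (0 : R) < M%:R + 2%:R by rewrite ltr_wpDl ?ler0n ?ltr0n.
have m1 : (1 : R) < M%:R + 2%:R by rewrite -natrD ltr1n addn2.
have a0 : 0 < a by rewrite subr_gt0 invf_lt1.
have a1 : a < 1 by rewrite ltrBlDr ltrDl invr_gt0.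
exists a, (ev g a); split=> // x ax x1.
have x0 : 0 <= x by exact: le_trans (ltW a0) ax.
rewrite -evg //; apply: (ev_decreasing (bg.1) a0) ax x1 => y ay y1.
have y0 : 0 <= y by exact: le_trans (ltW a0) ay.
have ny1 : `|y| < 1 by rewrite ger0_norm.
rewrite theta_g evM //; [|exact: bL.1 | exact: bg.1].
apply: mulr_le0_ge0; last first.
  rewrite evg // mulr_ge0 ?sqr_ge0 // exprn_ge0 // invr_ge0 subr_ge0; exact: ltW.
have evXg n : ev (fpsX rat * geo ^+ n) y = y * (1 - y)^-1 ^+ n.
  have [eG cG] := evX n conv_geo ny1.
  rewrite evM //; last exact: bnd_X.1.
  by rewrite ev_fpsX // eG ev_geo.
have evnat n f : conv f -> ev (n%:R * f) y = n%:R * ev f y.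
  move=> cf; rewrite -(rmorph_nat (@fpsC rat)) evM //; last exact: convC.
  by rewrite evC // rmorph_nat.
rewrite /L evD //; [|exact: (bnd_nat 2 b2).1 | exact: (bnd_nat M bXg).1].
rewrite (evnat 2%N _ b2.1) (evnat M _ bXg.1).
have -> : ev (fpsX rat * geo) y = y * (1 - y)^-1 by rewrite -[geo]expr1 evXg expr1.
apply: decay_sign.
- by rewrite mulVf // subr_eq0 gt_eqF.
- rewrite -[leLHS]invrK lef_pV2 ?posrE ?invr_gt0 ?subr_gt0 //.
  by rewrite lerBlDr addrC -lerBlDr.
apply: (le_trans (ev_le Ef2_le b2.1 _ y0 y1)).
  by apply: convD; [exact: bnd1.1 | exact: (bndN (bnd_nat 24 bXg2)).1].
rewrite evD //; [|exact: bnd1.1 | exact: (bndN (bnd_nat 24 bXg2)).1].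
rewrite evN //; last exact: (bnd_nat 24 bXg2).1.
rewrite (evnat 24%N _ bXg2.1) evXg -(rmorph1 (@fpsC rat)) evC // rmorph1.
exact: lexx.
Qed.

Lemma ev_horner (G : {poly rat}) f x : conv f -> `|x| < 1 ->
  conv (map_poly (@fpsC rat) G).[f] /\
  ev (map_poly (@fpsC rat) G).[f] x = (map_poly ratr G).[ev f x].
Proof.
move=> cf x1; elim/poly_ind: G => [|G c [cG evG]].
  rewrite !rmorph0 !horner0 -(rmorph0 (@fpsC rat)) evC //; split; last exact: rmorph0.
  exact: convC.
rewrite !rmorphD !rmorphM /= !map_polyX !map_polyC !hornerMXaddC.
split; first by apply: convD; [exact: convM | exact: convC].
by rewrite evD ?evM ?evG ?evC //; [exact: convM | exact: convC].
Qed.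

(* As x tends to 1, E_4 >= 1 / (1 - x) is unbounded while Delta H tends to 0. *)
Lemma Edisc_ndvd_poly_Ef4 (G : {poly rat}) (H : fps rat) : bnd H ->
  (map_poly (@fpsC rat) G).[Ef4 rat] = Edisc * H -> G = 0.
Proof.
move=> [cH [C [N [C0 bH]]]] GE.
have [_ b4 b6] := bnd_Ef.
have bD : bnd Edisc by apply: bndD; [exact: bndX | apply: bndN; exact: bndX].
(* The bound on H accounts for u^(2N) after squaring; the additional power of u forces D H to tend
   to 0. *)
have [a [K [a0 a1 DK]]] := Edisc_decay (2 * N).+1.
apply/eqP/negP => /negP G0.
have rG0 : map_poly ratr G != 0 :> {poly R} by rewrite map_poly_eq0.
have [c [Y [c0 HY]]] := poly_lower_bound rG0.
have [u [x [ux ax x1 u0 [Yu iu]]]] := near_one K C Y a0 a1 c0.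
have x0 : 0 <= x := le_trans (ltW a0) ax.
have nx1 : `|x| < 1 by rewrite ger0_norm.
have Ey : u <= ev (Ef4 rat) x.
  by have := ev_le Ef4_ge_geo conv_geo b4.1 x0 x1; rewrite ev_geo // ux.
have [_ evG] := ev_horner G b4.1 nx1.
have cG := HY _ (le_trans Yu Ey); rewrite -evG GE evM // in cG; last exact: bD.1.
apply: (@decay_contra _ K C c u (ev Edisc x) (ev H x) N) => //.
  by have := bH x x0 x1; rewrite ux.
by have := DK x ax x1; rewrite ux.
Qed.
End RealEval.

(** * Algebraic independence of E_4 and E_6 *)

Section AlgebraicIndependence.
Local Notation M2 := {mpoly rat[2]}.
Local Notation x := ('X_ord0 : M2).
Local Notation y := ('X_ord_max : M2).

Definition horner_e4 : {rmorphism {poly rat} -> M2} := horner_eval x \o map_poly (@mpolyC 2 rat).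

Lemma qexp2_horner_e4 (P : {poly rat}) : qexp2 (horner_e4 P) = (map_poly (@fpsC rat) P).[Ef4 rat].
Proof.
have [<- _] := qexp2X; rewrite /= /horner_eval -(horner_map qexp2) /= -map_poly_comp.
by congr (_.[_]); apply: eq_map_poly => c; exact: qexp2C.
Qed.

Lemma horner_e4_X3 : exists T, horner_e4 T = x ^+ 3 /\ T = 'X^3.
Proof. by exists 'X^3; rewrite rmorphXn /= map_polyX /horner_eval hornerX. Qed.

(** Modulo the discriminant y^2 = x^3, so 1 and y generate the quotient over the polynomials in
    x. *)
Lemma disc_decomp (f : M2) : exists P Q h, f = horner_e4 P + y * horner_e4 Q + (x ^+ 3 - y ^+ 2) * h.
Proof.
elim/mpoly_gen_ind: f => [c|i|f g [P [Q [h ->]]] [P' [Q' [h' ->]]]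
    |f g [P [Q [h ->]]] [P' [Q' [h' ->]]]].
- exists c%:P, 0, 0; rewrite rmorph0 !mulr0 !addr0.
  by rewrite /= map_polyC /horner_eval hornerC.
- have [-> | i0] := eqVneq i ord0.
    exists 'X, 0, 0; rewrite rmorph0 !mulr0 !addr0.
    by rewrite /= map_polyX /horner_eval hornerX.
  have -> : i = ord_max by apply/val_inj; case: i i0 => -[|[|[]]].
  by exists 0, 1, 0; rewrite rmorph0 rmorph1 mulr0 mulr1 addr0 add0r.
- exists (P + P'), (Q + Q'), (h + h'); rewrite !(rmorphD horner_e4); ring.
(* In (P + yQ)(P' + yQ') the term y^2 QQ' is replaced by x^3 QQ' minus the discriminant times
   QQ'. *)
have [T [TE _]] := horner_e4_X3; exists (P * P' + T * (Q * Q')), (P * Q' + Q * P'),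
  ((horner_e4 P + y * horner_e4 Q) * h' + h * (horner_e4 P' + y * horner_e4 Q' + (x ^+ 3 - y ^+ 2) * h') - horner_e4 Q * horner_e4 Q').
rewrite !(rmorphD horner_e4) !(rmorphM horner_e4) TE; ring.
Qed.

(** For nonzero P and Q the degrees of the two sides would have different parity. *)
Lemma sqr_eq_X3sqr (P Q : {poly rat}) : P ^+ 2 = 'X^3 * Q ^+ 2 -> P = 0 /\ Q = 0.
Proof.
move=> PQ; have [Q0|Q0] := eqVneq Q 0.
  by move/eqP: PQ; rewrite Q0 expr0n mulr0 sqrf_eq0 => /eqP.
have X0 : 'X^3 != 0 :> {poly rat} by rewrite monic_neq0 ?monicXn.
have P0 : P != 0 by rewrite -sqrf_eq0 PQ mulf_neq0 // sqrf_eq0.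
have := congr1 (fun p : {poly rat} => size p) PQ.
rewrite /= (size_mul X0) ?sqrf_eq0 // size_polyXn !expr2 !size_mul //.
move: Q0 P0; rewrite -!size_poly_gt0.
by case: (size P) (size Q) => // a [] // b _ _; rewrite !addSn !addnS /=; lia.
Qed.

(* Write f = P(e_4) + e_6 Q(e_4) + Delta h; the norm P^2 - e_4^3 Q^2 of the first part
   has an expansion divisible by that of Delta, so it is 0. *)
Lemma qexp2_inj (f : M2) : qexp2 f = 0 -> f = 0.
Proof.
have [n] := ubnP (msize f); elim: n f => // n IHn f fn f0.
pose D := x ^+ 3 - y ^+ 2.
have [qx qy] := qexp2X.
have qD : qexp2 D = Edisc by rewrite (rmorphB qexp2) !(rmorphXn qexp2) qx qy.
have [P [Q [h fE]]] := disc_decomp f.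
have [T [TE TX]] := horner_e4_X3.
have [|P0 Q0] := @sqr_eq_X3sqr P Q.
  apply/eqP; rewrite -subr_eq0 -TX; apply/eqP.
  (* The cofactor comes from P^2 - x^3 Q^2 = f (P - yQ) - D (Q^2 + h (P - yQ)), where f has zero
     expansion. *)
  apply: (RealEval.Edisc_ndvd_poly_Ef4
    (RealEval.bnd_qexp2 (- (horner_e4 Q ^+ 2 + h * (horner_e4 P - y * horner_e4 Q))))).
  rewrite -qexp2_horner_e4 -qD -(rmorphM qexp2) -[RHS]add0r.
  have -> : 0 = qexp2 (f * (horner_e4 P - y * horner_e4 Q)) by rewrite (rmorphM qexp2) f0 mul0r.
  rewrite -(rmorphD qexp2) (rmorphB horner_e4) !expr2 !(rmorphM horner_e4) TE fE /D.
  by congr (qexp2 _); ring.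
have {}fE : f = D * h by rewrite fE P0 Q0 !rmorph0 mulr0 !add0r.
have h0 : qexp2 h = 0.
  by apply: discriminant_mul_eq0; rewrite ?pnatr_eq0 // -/Edisc -qD -(rmorphM qexp2) -fE.
have [h00|nh] := eqVneq h 0; first by rewrite fE h00 mulr0.
rewrite fE (IHn h) ?mulr0 //.
(* The total degree of D is at least 3, so h is smaller than f and the induction on [msize]
   applies. *)
have D3 : (3 < msize D)%N.
  have Dx : (U_(ord0) *+ 3)%MM \in msupp D.
    rewrite mcoeff_msupp mcoeffB !mpolyXn !mcoeffX eqxx.
    have /negbTE-> : (U_(ord_max) *+ 2 != U_(ord0) *+ 3 :> 'X_{1..2})%MM.
      by apply/eqP => /mnmP /(_ ord0); rewrite !mulmnE !mnm1E.
    by rewrite subr0.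
  by have := msize_mdeg_lt Dx; rewrite mdegMn mdeg1.
have D0 : D != 0 by rewrite -msize_poly_eq0; lia.
move: fn; rewrite fE (msizeM D0 nh); rewrite -msize_poly_eq0 in nh.
by move: D3 nh; move: (msize D) (msize h) => a b; lia.
Qed.
End AlgebraicIndependence.

(** * Reduction of E_{p-1} and E_{p+1} *)

Definition Eser nu : fps rat := 1 + fpsC (Gconst nu)^-1 * Sser nu.-1.

Lemma EcoefE nu n : Ecoef nu n = Eser nu n.
Proof.
rewrite /Ecoef /Eser fcoefD fcoef1 fcoefCM SserE /dsum; case: eqP => [_|_].
  by rewrite mulr0 addr0.
rewrite add0r /Gconst invf_div invrN mulrN; congr (- _ * _).
by rewrite /sigma natr_sum; apply: eq_bigr => d _; rewrite natrX.
Qed.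

Definition agree N (P : {poly rat}) (f : fps rat) := forall n, (n < N)%N -> P`_n = f n.

Lemma agreeM N P Q f g : agree N P f -> agree N Q g -> agree N (P * Q) (f * g).
Proof.
move=> Pf Qg n ltnN; rewrite coefM fcoefM; apply: eq_bigr => i _.
by rewrite Pf ?Qg //; have := ltn_ord i; lia.
Qed.

Lemma agree_Etrunc nu N : agree N (Etrunc nu N) (Eser nu).
Proof. by move=> n lt_nN; rewrite coef_poly lt_nN EcoefE. Qed.

Lemma Eser46 : Eser 4 = Ef4 rat /\ Eser 6 = Ef6 rat.
Proof.
have [G4 G6] := Gconst46; split; first by rewrite /Eser G4 (rmorph_nat (@fpsC rat) 240).
by rewrite /Eser G6 (rmorphN (@fpsC rat)) (rmorph_nat (@fpsC rat) 504) mulNr.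
Qed.

Lemma agree_evalE46 A N : agree N (evalE46 A N) (qexp2 A).
Proof.
have [E4 E6] := Eser46.
elim/mpoly_gen_ind: A => [c|i|f g IHf IHg|f g IHf IHg].
- by move=> n _; rewrite /evalE46 mmapC qexp2C coefC fcoefC.
- rewrite /evalE46 /= !mmapX !mmap1U /qexp2_var; case: ifP => _.
    by rewrite -E4; exact: agree_Etrunc.
  by rewrite -E6; exact: agree_Etrunc.
- move=> n lt_nN; rewrite /evalE46 rmorphD (rmorphD qexp2) coefD fcoefD.
  by rewrite -IHf // -IHg.
rewrite /evalE46 rmorphM (rmorphM qexp2); exact: agreeM.
Qed.

Lemma qexp2_Epoly A nu : is_Epoly A nu -> qexp2 A = Eser nu.
Proof.
move=> hA; apply/fpsP => n; have lt_n := ltnSn n.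
rewrite -(agree_evalE46 A lt_n) -(agree_Etrunc nu lt_n) -hA.
by rewrite -Pdiv.IdomainMonic.take_poly_modp coef_take_poly lt_n.
Qed.

Section Reduction.
Variables (k : fieldType) (p : nat).
Hypothesis hp5 : (5 <= p)%N.
Hypothesis hchar : p \in [pchar k].

Lemma Red_map_int (f : fps int) n :
  Red (map_fps (intmul (1 : rat)) f n) (map_fps (intmul (1 : k)) f n).
Proof. by rewrite !fcoef_map; exact: pint_int. Qed.

(** The coefficients are integers, so both expansions are images of one series over the integers. *)
Lemma Red_Ef_monomial a b n :
  Red ((Ef4 rat ^+ a * Ef6 rat ^+ b) n) ((Ef4 k ^+ a * Ef6 k ^+ b) n).
Proof.
have := Red_map_int (Ef4 int ^+ a * Ef6 int ^+ b) n.
by rewrite !rmorphM !rmorphXn /= !map_Ef4 !map_Ef6.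
Qed.

Lemma Red_Sser s n : Red (Sser s n) (dser (R := k) (fun d => d%:R ^+ s) n).
Proof.
by have := Red_map_int (dser (fun d => d%:R ^+ s)) n; rewrite !map_dser.
Qed.

Lemma red46E A : red46 k A =
  \sum_(m <- msupp A) redr k A@_m *: (e4 k ^+ m ord0 * e6 k ^+ m ord_max).
Proof.
rewrite /red46 /mmap; apply: eq_bigr => m _; rewrite mul_mpolyC; congr (_ *: _).
rewrite /mmap1 !big_ord_recl big_ord0 mulr1 /=.
by rewrite (_ : lift ord0 ord0 = ord_max) //; apply/val_inj.
Qed.

Lemma modular_red46 A w : A \is w.-homog for wt46 -> modular w (red46 k A).
Proof.
move=> /dhomogP hA; rewrite red46E big_seq.
apply: big_ind => [|f g|m mA]; [exact: modular0 | exact: modularD |].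
apply: modularZ; have <- : (m ord0 * 2 + m ord_max * 3 = w)%N.
  by have := hA m mA; rewrite /= /wt46; lia.
by apply: modularM; apply: modularX; [exact: modular_e4 | exact: modular_e6].
Qed.

Lemma qexp_red46 A n : A \is a mpolyOver 2 (pint k) ->
  qexp k (red46 k A) n = redr k (qexp2 A n).
Proof.
move=> /mpolyOverP pA; have [q2 q4 q6] := qexp_e k.
have -> : qexp2 A = \sum_(m <- msupp A) fpsC A@_m * (Ef4 rat ^+ m ord0 * Ef6 rat ^+ m ord_max).
  apply: eq_bigr => m _; congr (_ * _).
  rewrite /mmap1 !big_ord_recl big_ord0 mulr1 /=.
  by rewrite (_ : lift ord0 ord0 = ord_max) //; apply/val_inj.
have RedE m : Red (A@_m * (Ef4 rat ^+ m ord0 * Ef6 rat ^+ m ord_max) n)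
   (redr k A@_m * (Ef4 k ^+ m ord0 * Ef6 k ^+ m ord_max) n).
  by apply: RedM (Red_Ef_monomial _ _ _); split.
rewrite red46E (rmorph_sum (qexp k)) !fcoef_sum red_sum => [|m _].
  apply: eq_bigr => m _; rewrite fcoefCM (RedE m).2 -mul_mpolyC.
  by rewrite !(rmorphM (qexp k)) qexpC fcoefCM !(rmorphXn (qexp k)) q4 q6.
by rewrite fcoefCM; case: (RedE m).
Qed.

(** By algebraic independence A is P divided by c [Gconst (2 * n)]. This constant has nonzero
    reduction u, so its inverse is p-integral and A inherits the properties of P. *)
Lemma Epoly_props A n c u : is_Epoly A (2 * n) -> Gpoly k n c ->
  Red (c * Gconst (2 * n)) u -> u != 0 :> k ->
  [/\ A \is a mpolyOver 2 (pint k), A \is n.-homog for wt46 & Gconst (2 * n) != 0].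
Proof.
move=> hA [P [oP hP qP]] [pcG <-] u0.
have cG0 : c * Gconst (2 * n) != 0.
  by apply: contra_neq u0 => ->; exact: red0.
have [pV _] := pint_inv pcG u0.
move: (cG0); rewrite mulf_eq0 negb_or => /andP[c0 G0].
have -> : A = ((c * Gconst (2 * n))^-1)%:MP * P.
  apply/eqP; rewrite -subr_eq0; apply/eqP/qexp2_inj.
  rewrite (rmorphB qexp2) (rmorphM qexp2) qexp2C qP (qexp2_Epoly hA).
  rewrite /Eser -Gser_normalize // mulrA -(rmorphM (@fpsC rat)) (invfM c (Gconst _)) [c^-1 / _ * c]mulrAC.
  by rewrite mulVf // mul1r subrr.
split=> //; last by rewrite mul_mpolyC; exact: dhomogZ.
by rewrite rpredM ?mpolyOverC.
Qed.

Lemma qexp_red46_Epoly A nu n v : is_Epoly A nu -> A \is a mpolyOver 2 (pint k) ->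
  Red (Gconst nu)^-1 v ->
  qexp k (red46 k A) n = (n == 0%N)%:R + v * dser (fun d => d%:R ^+ nu.-1) n.
Proof.
move=> hA oA rG; rewrite qexp_red46 // (qexp2_Epoly hA) /Eser fcoefD fcoef1 fcoefCM.
have r1 : Red (n == 0%N)%:R ((n == 0%N)%:R : k) by exact: pint_nat.
by have [_] := RedD r1 (RedM rG (Red_Sser nu.-1 n)).
Qed.

Lemma Red_inv x u : u != 0 :> k -> Red x u -> Red x^-1 u^-1.
Proof. by move=> u0 [px rx]; rewrite -rx in u0 *; exact: pint_inv. Qed.

Lemma natr2_neq0 n : (0 < n < p)%N -> (2 * n)%:R != 0 :> k.
Proof. by move=> n0; rewrite natrM mulf_neq0 // (natr_small hchar) //; lia. Qed.

Lemma Red_Gconst_p1 : Red (p%:R * Gconst p.-1) ((2 * p.-1)%:R^-1 : k).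
Proof.
have -> : p%:R * Gconst p.-1 = - (p%:R * bernoulli p.-1) / (2 * p.-1)%:R.
  by rewrite /Gconst mulrA mulrN.
have -> : (2 * p.-1)%:R^-1 = - -1 * (2 * p.-1)%:R^-1 :> k by rewrite opprK mul1r.
apply: RedM.
  by apply: RedN; exact: p_bernoulli.
by apply: pint_natV; apply: natr2_neq0; lia.
Qed.

(** The value -1/24 is the constant term of the normalized series of weight 2, which is why E_{p+1}
    reduces to E_2. *)
Lemma Red_Gconst_p2 : Red (Gconst p.+1) (- 24%:R^-1 : k).
Proof.
have p0 : (2 * p.+1)%:R = 2%:R :> k by rewrite mulnS natrD natrM (pcharf0 hchar) mulr0 addr0.
have -> : - 24%:R^-1 = - 12%:R^-1 * (2 * p.+1)%:R^-1 :> k.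
  by rewrite p0 mulNr -invfM -natrM.
apply: RedM; first by apply: RedN; exact: bernoulli_p1.
by apply: pint_natV; rewrite p0 (natr_small hchar) //; lia.
Qed.

Lemma red46_Epoly_p1 A w : (2 * w + 1)%N = p -> is_Epoly A p.-1 ->
  modular w (red46 k A) /\ qexp k (red46 k A) = 1.
Proof.
move=> wE hA; have pw : p.-1 = (2 * w)%N by lia.
have n0 : (2 * p.-1)%:R != 0 :> k by apply: natr2_neq0; lia.
have rG := Red_Gconst_p1; have := hA; rewrite pw => hA'.
have uV : (2 * (2 * w))%:R^-1 != 0 :> k by rewrite -pw invr_eq0.
rewrite pw in rG; have [oA wA _] := Epoly_props hA' (Gpoly_p1 hp5 hchar wE) rG uV.
split; first exact: modular_red46.
(* The inverse of [Gconst p.-1] is p times the inverse of a p-integral number with nonzero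
   reduction, so every nonconstant coefficient of E_{p-1} reduces to 0. *)
have rV : Red (Gconst p.-1)^-1 (0 : k).
  have p0 : p%:R != 0 :> rat by rewrite pnatr_eq0; lia.
  have -> : (Gconst p.-1)^-1 = p%:R * (p%:R * Gconst p.-1)^-1 by rewrite (invfM p%:R (Gconst _)) mulVKf.
  rewrite pw -[0 : k](mul0r (2 * (2 * w))%:R^-1^-1); apply: RedM; last exact: Red_inv.
  by rewrite -(pcharf0 hchar); exact: pint_nat.
by apply/fpsP => n; rewrite (qexp_red46_Epoly n hA oA rV) mul0r addr0 fcoef1.
Qed.

Lemma red46_Epoly_p2 B w : (2 * w + 1)%N = p -> is_Epoly B p.+1 ->
  modular w.+1 (red46 k B) /\ qexp k (red46 k B) = Ef2 k.
Proof.
move=> wE hB; have pw : p.+1 = (2 * w.+1)%N by lia.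
have n24 : 24%:R != 0 :> k.
  by rewrite (natrM _ 12 2) mulf_neq0 ?(natr12 hp5 hchar) // (natr_small hchar) //; lia.
have u0 : - 24%:R^-1 != 0 :> k by rewrite oppr_eq0 invr_eq0.
have rG := Red_Gconst_p2; have := hB; rewrite pw => hB'.
have w1E : (2 * w.+1 = p + 1)%N by lia.
have rG1 : Red (1 * Gconst (2 * w.+1)) (- 24%:R^-1 : k) by rewrite mul1r -pw.
have [oB wB _] := Epoly_props hB' (Gpoly_p2 hp5 hchar w1E) rG1 u0.
split; first exact: modular_red46.
apply/fpsP => n; rewrite (qexp_red46_Epoly n hB oB (Red_inv u0 rG)).
rewrite /Ef2 fcoefB fcoef1 -(rmorph_nat (@fpsC k)) fcoefCM invrN invrK mulNr.
congr (_ - _ * _); rewrite !dserE /dsum; case: eqP => // _.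
(* Fermat's congruence d^p = d turns the divisor sums with exponent p into those with exponent 1. *)
by apply: eq_bigr => d _; rewrite (natr_expp hchar).
Qed.
End Reduction.

Theorem theorem1 (k : fieldType) (p : nat) (hp : prime p) (hp5 : (5 <= p)%N)
  (hchar : p \in [pchar k]) (A B : {mpoly rat[2]})
  (hA : is_Epoly A p.-1) (hB : is_Epoly B p.+1) :
  let At := red46 k A in
  let Bt := red46 k B in
  forall f : {mpoly k[3]},
    iter p (Ramanujan k) f =
    vfield k (invn k 12 * (Bt ^+ 2 - e4 k * At ^+ 2))
           (invn k 3 * (At * (e4 k * Bt - e6 k * At)))
           (invn k 2 * (At * (e6 k * Bt - e4 k ^+ 2 * At))) f.
Proof.
(* Since p is odd, [p./2] is (p - 1) / 2, half the weight of A. *)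
move=> At Bt f; have wE : (2 * p./2 + 1)%N = p.
  by have [|] := even_prime hp; lia.
have [mA qA] := red46_Epoly_p1 hp5 hchar wE hA.
have [mB qB] := red46_Epoly_p2 hp5 hchar wE hB.
exact: (Ramanujan_pth_power hp5 hchar wE mA mB qA qB).
Qed.
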